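(* Let $X$ be an $n$-dimensional fractional Brownian motion with Hurst parameter $H>1/2$, and let $\gamma\in(1/2,H)$ be such that $\int_0^\infty|\hat\phi(\xi)|(1+\xi^\gamma)d\xi<\infty$. Then (a version of) the process $\tilde X^1$ defined by the Wiener integrals $\tilde X^{1,(i)}_{ts}(\xi)=\int_s^te^{-\xi(t-v)}dX^{(i)}_v$ almost surely satisfies: $X$ is $\gamma$-Hölder continuous on $[0,T]$, $\tilde X^1\in\tilde{\mathcal C}^\gamma_{2,\gamma}([0,T];\mathbb R^{1,n})$ and $\tilde\delta\tilde X^1=0$. Consequently, if in addition $\sigma:\mathbb R^{1,m}\to\mathbb R^{n,m}$ is of class $C^2$, bounded with bounded first and second derivatives, and $a_0\in\mathbb R^{1,m}$, then almost surely the system $$(\tilde\delta\tilde Y)_{ts}=\mathcal J_{ts}\Big(\tilde dX\,\sigma\Big(a_0+\int_0^\infty\hat\phi(\xi)\tilde Y(\xi)d\xi\Big)\Big),\qquad\tilde Y_0=0,$$ admits a unique solution in $\tilde{\mathcal C}^{0,\gamma}_{1,\gamma}([0,T];\mathbb R^{1,m})$.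
   Context: An $n$-dimensional fBm with Hurst parameter $H$ is a centered Gaussian process $X=(X^{(1)},\dots,X^{(n)})$ indexed by $\mathbb R$ (viewed as $\mathbb R^{1,n}$-valued) with $E[X^{(i)}_sX^{(j)}_t]=\frac12\delta_{ij}(|s|^{2H}+|t|^{2H}-|t-s|^{2H})$. For $H>1/2$, Wiener integrals $\int_{\mathbb R}f\,dX^{(i)}$ of deterministic $f$ are defined by isometry on the completion of step functions under $\langle f,g\rangle=H(2H-1)\int\int f_ug_v|u-v|^{2H-2}dudv$. Measurable $\hat\phi:(0,\infty)\to\mathbb R$ is fixed. $\mathcal L_\gamma(V)$: measurable $g:[0,\infty)\to V$ with $\mathcal N[g;\mathcal L_\gamma]=\int_0^\infty|\hat\phi(\xi)|(1+\xi^\gamma)\|g(\xi)\|d\xi<\infty$. $\tilde{\mathcal C}_{k,\gamma}$: continuous maps from $\{t_1\ge\dots\ge t_k\}\subset[0,T]^k$ into $\mathcal L_\gamma$. $(\tilde\delta f)_{ts}(\xi)=f_t(\xi)-e^{-\xi(t-s)}f_s(\xi)$, $(\tilde\delta B)_{tus}(\xi)=B_{ts}(\xi)-B_{tu}(\xi)-e^{-\xi(t-u)}B_{us}(\xi)$. $\tilde{\mathcal C}^\gamma_{2,\gamma}$: two-parameter $B$ with $\sup_{s<t}\mathcal N[B_{ts};\mathcal L_\gamma]/|t-s|^\gamma<\infty$. $\tilde{\mathcal C}^{0,\gamma}_{1,\gamma}$: one-parameter $\tilde y$ with finite $\sup_s\mathcal N[\tilde y_s;\mathcal L_\gamma]+\sup_{s<t}\mathcal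 N[(\tilde\delta\tilde y)_{ts};\mathcal L_\gamma]/|t-s|^\gamma$. The integral is the Young convolutional integral: for a $\gamma$-Hölder matrix path $z$, $\mathcal J_{ts}(\tilde dX\,z)=\tilde X^1_{ts}z_s+\tilde\Lambda[h]_{ts}$ with $h_{tus}=\tilde X^1_{tu}(z_u-z_s)$, where $\tilde\Lambda h$ is the unique two-parameter element of $\mathcal L_\gamma$-Hölder regularity $\mu>1$ with $\tilde\delta\tilde\Lambda h=h$ (convolutional sewing map, defined for three-parameter $h$ of Hölder regularity $\mu>1$ lying in the image of $\tilde\delta$). *)

(* Defs.v *)
From HB Require Import structures.
From mathcomp Require Import all_boot all_order all_algebra.
From mathcomp Require Import all_classical all_reals all_analysis.
Set Implicit Arguments. Unset Strict Implicit. Unset Printing Implicit Defensive.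
Import Order.TTheory GRing.Theory Num.Theory.
Import numFieldNormedType.Exports.
Local Open Scope classical_set_scope.
Local Open Scope ring_scope.

Section Defs.
Context {R : realType}.
Notation mu := (@lebesgue_measure R).

Definition centered_gaussian {d} {Om : measurableType d} (P : probability Om R)
  (Y : Om -> R) (v : R) : Prop :=
  measurable_fun setT Y /\
  forall A : set R, measurable A ->
    P (Y @^-1` A) = (if v == 0 then \d_(0:R) A else normal_prob 0 (Num.sqrt v) A).

Definition fbm_cov (H s t : R) : R :=
  (`|s| `^ (2 * H) + `|t| `^ (2 * H) - `|t - s| `^ (2 * H)) / 2.

(* X : 'I_n -> R -> Om -> R is an n-dimensional fBm with Hurst parameter H:
   centered jointly Gaussian with E[X^i_s X^j_t] = delta_ij fbm_cov H s t. *)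
Definition is_fBm {d} {Om : measurableType d} (P : probability Om R) (n : nat)
  (H : R) (X : 'I_n -> R -> Om -> R) : Prop :=
  forall (k : nat) (idx : 'I_k -> 'I_n) (tt : 'I_k -> R) (a : 'I_k -> R),
    centered_gaussian P (fun w => \sum_(l < k) a l * X (idx l) (tt l) w)
      (\sum_(l < k) \sum_(l' < k)
          a l * a l' * (if idx l == idx l' then fbm_cov H (tt l) (tt l') else 0)).

(* step function sum_p c_p 1_[a_p, b_p), p = (c, a, b) with a <= b *)
Definition stepfun := seq (R * R * R).
Definition step_ok (f : stepfun) : bool := all (fun p => p.1.2 <= p.2) f.
Definition step_val (f : stepfun) (u : R) : R :=
  \sum_(p <- f) p.1.1 * (if (p.1.2 <= u) && (u < p.2) then 1 else 0).
Definition step_wiener {d} {Om : measurableType d} (Xi : R -> Om -> R)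
  (f : stepfun) (w : Om) : R :=
  \sum_(p <- f) p.1.1 * (Xi p.2 w - Xi p.1.2 w).

Definition fbm_sqnorm (H : R) (F : R -> R) : \bar R :=
  ((H * (2 * H - 1))%:E *
   \int[mu]_(u in setT) \int[mu]_(v in setT) (F u * F v * `|u - v| `^ (2 * H - 2))%:E)%E.

(* Z is (a version of) the Wiener integral int F dXi: the image of F under the
   isometric extension of 1_[a,b) |-> Xi_b - Xi_a, i.e. the L^2(P)-limit of the
   integrals of step functions converging to F in the <.,.> norm. *)
Definition wiener_integral {d} {Om : measurableType d} (P : probability Om R)
  (H : R) (Xi : R -> Om -> R) (F : R -> R) (Z : Om -> R) : Prop :=
  measurable_fun setT Z /\
  exists fk : nat -> stepfun,
    (forall k, step_ok (fk k)) /\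
    (fun k => fbm_sqnorm H (fun u => F u - step_val (fk k) u)) @ \oo --> 0%E /\
    (fun k => (\int[P]_(w in setT) ((step_wiener Xi (fk k) w - Z w) ^+ 2)%:E)%E)
      @ \oo --> 0%E.

Variables (phi : R -> R) (gamma T : R).

Definition Nphi {k : nat} (g : R -> 'rV[R]_k) : \bar R :=
  (\int[mu]_(xi in (`[0%R, +oo[%classic : set R)) (`|phi xi| * (1 + xi `^ gamma) * `|g xi|)%:E)%E.

Definition inL {k : nat} (g : R -> 'rV[R]_k) : Prop :=
  (forall j, measurable_fun (`[0%R, +oo[%classic : set R) (fun xi => g xi 0 j)) /\ (Nphi g < +oo)%E.

Definition Leq {k : nat} (g1 g2 : R -> 'rV[R]_k) : Prop :=
  Nphi (fun xi => g1 xi - g2 xi) = 0%E.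

Definition dtilde1 {k : nat} (y : R -> R -> 'rV[R]_k) (t s xi : R) : 'rV[R]_k :=
  y t xi - expR (- (xi * (t - s))) *: y s xi.
Definition dtilde2 {k : nat} (B : R -> R -> R -> 'rV[R]_k) (t u s xi : R) : 'rV[R]_k :=
  B t s xi - B t u xi - expR (- (xi * (t - u))) *: B u s xi.

Definition in_simplex2 (t s : R) : Prop := 0 <= s /\ s <= t /\ t <= T.

Definition inC1 {k : nat} (y : R -> R -> 'rV[R]_k) : Prop :=
  (forall s, 0 <= s <= T -> inL (y s)) /\
  (forall s, 0 <= s <= T -> forall e : R, 0 < e -> exists2 dl : R, 0 < dl &
     forall s', 0 <= s' <= T -> `|s - s'| < dl ->
       (Nphi (fun xi => (y s xi - y s' xi)%R) < e%:E)%E).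

Definition inC2 {k : nat} (B : R -> R -> R -> 'rV[R]_k) : Prop :=
  (forall t s, in_simplex2 t s -> inL (B t s)) /\
  (forall t s, in_simplex2 t s -> forall e : R, 0 < e -> exists2 dl : R, 0 < dl &
     forall t' s', in_simplex2 t' s' -> `|t - t'| < dl -> `|s - s'| < dl ->
       (Nphi (fun xi => (B t s xi - B t' s' xi)%R) < e%:E)%E).

Definition hoelder2 {k : nat} (mu' : R) (B : R -> R -> R -> 'rV[R]_k) : Prop :=
  exists C : R, forall t s, 0 <= s -> s < t -> t <= T ->
    (Nphi (B t s) <= ((C * (t - s) `^ mu')%R)%:E)%E.

Definition hoelder3 {k : nat} (mu' : R) (h : R -> R -> R -> R -> 'rV[R]_k) : Prop :=
  exists C : R, forall t u s, 0 <= s -> s <= u -> u <= t -> s < t -> t <= T ->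
    (Nphi (h t u s) <= ((C * (t - s) `^ mu')%R)%:E)%E.

Definition inC2gamma {k : nat} (B : R -> R -> R -> 'rV[R]_k) : Prop :=
  inC2 B /\ hoelder2 gamma B.

Definition inC1gamma {k : nat} (y : R -> R -> 'rV[R]_k) : Prop :=
  inC1 y /\ (exists C : R, forall s, 0 <= s <= T -> (Nphi (y s) <= C%:E)%E) /\
  hoelder2 gamma (fun t s => dtilde1 y t s).

Definition hoelder_mx {n m : nat} (z : R -> 'M[R]_(n, m)) : Prop :=
  exists C : R, forall i j s t, 0 <= s <= T -> 0 <= t <= T ->
    `|z t i j - z s i j| <= C * `|t - s| `^ gamma.

(* J = J(d~X z) as an element of L_gamma:  J_ts = X~_ts z_s + Lambda~[h]_ts with
   h_tus = X~_tu (z_u - z_s), where Lambda~[h] is the unique two-parameter element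
   of regularity mu > 1 with dtilde Lambda~[h] = h. *)
Definition conv_young {n m : nat} (Xt : R -> R -> R -> 'rV[R]_n)
  (z : R -> 'M[R]_(n, m)) (J : R -> R -> R -> 'rV[R]_m) : Prop :=
  hoelder_mx z /\
  let h := fun t u s xi => Xt t u xi *m (z u - z s) in
  let Lam := fun t s xi => J t s xi - Xt t s xi *m z s in
  exists mu' : R, 1 < mu' /\ hoelder3 mu' h /\
    (forall t s, in_simplex2 t s -> inL (Lam t s)) /\ hoelder2 mu' Lam /\
    (forall t u s, 0 <= s -> s <= u -> u <= t -> t <= T ->
       Leq (dtilde2 Lam t u s) (h t u s)).

Definition phi_int {k : nat} (y : R -> 'rV[R]_k) : 'rV[R]_k :=
  \row_j fine (\int[mu]_(xi in (`]0%R, +oo[%classic : set R)) (phi xi * y xi 0 j)%:E)%E.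

Definition solves_rde {n m : nat} (Xt : R -> R -> R -> 'rV[R]_n)
  (sigma : 'rV[R]_m -> 'M[R]_(n, m)) (a0 : 'rV[R]_m) (Y : R -> R -> 'rV[R]_m) : Prop :=
  inC1gamma Y /\ Leq (Y 0) (fun _ => 0) /\
  conv_young Xt (fun s => sigma (a0 + phi_int (Y s))) (fun t s xi => dtilde1 Y t s xi).

End Defs.

Definition bounded_fun {R : realType} {k : nat} (f : 'rV[R]_k -> R) : Prop :=
  exists M : R, forall x, `|f x| <= M.

Definition C2b {R : realType} {k : nat} (f : 'rV[R]_k -> R) : Prop :=
  continuous f /\ bounded_fun f /\
  forall a : 'I_k,
    let ea : 'rV[R]_k := delta_mx 0 a in
    let fa := fun x => derive f x ea in
    (forall x, derivable f x ea) /\ continuous fa /\ bounded_fun fa /\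
    forall b : 'I_k,
      let eb : 'rV[R]_k := delta_mx 0 b in
      (forall x, derivable fa x eb) /\ continuous (fun x => derive fa x eb) /\
      bounded_fun (fun x => derive fa x eb).

(* Main.v *)
Require Import Defs.
From HB Require Import structures.
From mathcomp Require Import all_boot all_order all_algebra.
From mathcomp Require Import all_classical all_reals all_analysis.
From mathcomp Require Import finmap measurable_realfun.
From mathcomp Require Import ring lra zify.
Set Implicit Arguments. Unset Strict Implicit. Unset Printing Implicit Defensive.
Import Order.TTheory GRing.Theory Num.Theory.
Import numFieldNormedType.Exports.
Local Open Scope classical_set_scope.
Local Open Scope ring_scope.

(** For every [xi >= 0] the convolution [int_0^t exp(- xi (t - v)) dX_v] is the limit of its dyadic
    Riemann sums, obtained by a sewing argument whose bounds do not depend on [xi]; the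
    paths [X~^1_ts = A_t - exp(- xi (t - s)) A_s] built from these limits satisfy the algebraic
    relation [dtilde X~^1 = 0] exactly, and inherit the Hölder exponent of [X].  Hölder
    continuity of a version of [X] comes from dyadic chaining with Gaussian moments.  The same
    dyadic sums, read in [L^2(P)], are the Wiener integrals of step functions converging to the
    kernel, because one refinement of the grid costs [O(2^(- H k))] in [L^2].

    The Young convolutional equation only sees [Y] through
    [a_t = a0 + int phi(xi) Y_t(xi) dxi], so it reduces to a fixed point [a = a0 + V(sigma(a))] for
    a linear Volterra-type operator [V], which is a contraction in a Hölder norm with exponential
    weight [exp(lambda t)], [lambda] large.  A [C^2] bounded [sigma] acts on such paths by the
    four-point inequality for [sigma(a) - sigma(b) - sigma(a') + sigma(b')].  Two solutions have the
    same [a], and then coincide in [L_gamma] by uniqueness of the sewing. *)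

(** The sewing bound for the germ [p t - p s] has a constant proportional to [xi], so it yields
    convergence only; the estimate uniform in [xi] comes from an averaging property of the discrete
    sums. Uniformity holds for convolutional increments, whereas a plain increment also costs [1 -
    exp(- xi (t - s)) <= xi^gamma (t - s)^gamma]. The weight [1 + xi^gamma] pays for this once, when
    [phi] is integrated out.

    The small factor of the contraction is [lambda^(- gamma)]: it bounds the supremum of a path that
    vanishes at 0 by its weighted Hölder constant. Integrands must therefore vanish at 0, and
    constants are treated apart. The four-point inequality is quadratic, so the map contracts only
    on Hölder balls, with [lambda] depending on the ball: a first [lambda] makes one ball stable, a
    second one gives the contraction there.

    The version of [X] is Hölder for every [w], not only for almost every one, so the equation is
    solved path by path and no exceptional set depends on [xi], [sigma] or [a0]. *)

(** * Limits with a geometric rate, and powers *)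

Lemma cvgn_norm_le (R : realType) (u : nat -> R) (l a c : R) (N : nat) :
  u @ \oo --> l -> (forall n, (N <= n)%N -> `|u n - a| <= c) -> `|l - a| <= c.
Proof.
move=> ul h.
have ua : (fun n => `|u n - a|) @ \oo --> `|l - a|.
  by apply: cvg_norm; apply: cvgB => //; exact: cvg_cst.
apply: (ler_cvg_to ua (cvg_cst c)).
by exists N => // n /= Nn; apply: h.
Qed.

Lemma geometric_cvg (R : realType) (u : nat -> R) (C q : R) :
  0 <= q < 1 -> (forall k, `|u k.+1 - u k| <= C * q ^+ k) ->
  u @ \oo --> limn u /\ forall k, `|limn u - u k| <= C * q ^+ k / (1 - q).
Proof.
move=> /andP[q0 q1] hu.
have C0 : 0 <= C by have := hu 0; rewrite expr0 mulr1; apply: le_trans.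
have cu : cvgn u.
  have cs : cvgn (series (telescope u)).
    apply: normed_cvg.
    apply: (@series_le_cvg _ _ (geometric C q)) => [n|n|n|].
    - exact: normr_ge0.
    - by rewrite /geometric /= mulr_ge0// exprn_ge0.
    - exact: hu.
    - by apply: is_cvg_geometric_series; rewrite ger0_norm.
  have -> : u = (fun n => u 0%N + series (telescope u) n).
    by apply/funext => n; rewrite -eq_sum_telescope.
  by apply: is_cvgD => //; exact: is_cvg_cst.
split=> // k.
(* The exact partial sum of the geometric series is carried along: the bound by the whole series is
   not stable under the induction. *)
have h : forall m, `|u (m + k)%N - u k| <= C * q ^+ k * (1 - q ^+ m) / (1 - q).
  elim=> [|m IH]; first by rewrite add0n subrr normr0 expr0 subrr mulr0 mul0r.
  have -> : u (m.+1 + k)%N - u k = (u (m + k).+1 - u (m + k)%N) + (u (m + k)%N - u k).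
    by rewrite addSn; ring.
  apply: (le_trans (ler_normD _ _)).
  apply: (le_trans (lerD (hu _) IH)).
  rewrite exprD exprS le_eqVlt; apply/orP; left; apply/eqP.
  by field; rewrite subr_eq0 gt_eqF.
apply: (cvgn_norm_le (N := k) cu) => n kn; rewrite -(subnK kn).
apply: (le_trans (h _)).
rewrite ler_pM2r ?invr_gt0 ?subr_gt0//.
rewrite ler_piMr ?mulr_ge0 ?exprn_ge0//.
by rewrite gerBl exprn_ge0.
Qed.

Lemma powR_exprn (R : realType) (a v : R) (k : nat) :
  0 <= a -> (a ^+ k) `^ v = (a `^ v) ^+ k.
Proof.
by move=> a0; rewrite -powR_mulrn// -powRrM mulrC powRrM powR_mulrn// powR_ge0.
Qed.

Lemma powR_mono (R : realType) (v a b : R) : 0 <= v -> 0 <= a -> a <= b -> a `^ v <= b `^ v.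
Proof. by move=> v0 a0 ab; apply: ge0_ler_powR; rewrite ?nnegrE// (le_trans a0). Qed.

(** * Dyadic grids and convolutional sewing *)

Section grid.
Context {R : realType}.
Variable T : R.
Hypothesis T0 : 0 < T.

Definition mesh (k : nat) : R := T / 2 ^+ k.
Definition pt (k j : nat) : R := j%:R * mesh k.
(** Index of the last grid point not after [t], for [t >= 0]. A negative [t] is sent to 0, hence the
    sign conditions below. *)
Definition gidx (k : nat) (t : R) : nat := Num.truncn (t / mesh k).

Lemma mesh_gt0 k : 0 < mesh k.
Proof. by rewrite divr_gt0// exprn_gt0. Qed.

Lemma meshS k : mesh k = 2 * mesh k.+1.
Proof. by rewrite /mesh exprS; field; rewrite expf_neq0. Qed.

Lemma mesh_powR k (v : R) : mesh k `^ v = T `^ v * (2^-1 `^ v) ^+ k.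
Proof.
have -> : mesh k = T * 2^-1 ^+ k by rewrite /mesh exprVn.
have i0 : 0 <= 2^-1 :> R by rewrite invr_ge0.
rewrite powRM; [|exact: ltW|exact: exprn_ge0].
by rewrite powR_exprn.
Qed.

Lemma half_powR_lt1 (v : R) : 0 < v -> 0 <= (2^-1 : R) `^ v < 1.
Proof.
move=> v0; rewrite powR_ge0/=.
have : (2^-1 : R) `^ v < 1 `^ v.
  by apply: (gt0_ltr_powR v0); rewrite ?nnegrE ?invr_ge0 ?ler01 ?invf_lt1 ?ltr1n.
by rewrite powR1.
Qed.

Lemma ptS k j : pt k j.+1 = pt k j + mesh k.
Proof. by rewrite /pt -natr1; ring. Qed.

Lemma pt_ge0 k j : 0 <= pt k j.
Proof. by rewrite mulr_ge0// ltW// mesh_gt0. Qed.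

Lemma pt_le k i j : (i <= j)%N -> pt k i <= pt k j.
Proof. by move=> ij; rewrite ler_pM2r ?mesh_gt0// ler_nat. Qed.

Lemma pt_double k j : pt k.+1 j.*2 = pt k j.
Proof. by rewrite /pt (meshS k) -muln2 natrM; ring. Qed.

Lemma gidxP k t : 0 <= t -> pt k (gidx k t) <= t < pt k (gidx k t).+1.
Proof.
move=> t0; have /truncn_itv : 0 <= t / mesh k by rewrite divr_ge0// ltW// mesh_gt0.
by rewrite ler_pdivlMr ?mesh_gt0// ltr_pdivrMr ?mesh_gt0.
Qed.

Lemma gidx_ge k t j : 0 <= t -> (j <= gidx k t)%N = (pt k j <= t).
Proof.
move=> t0; have /andP[h1 h2] := gidxP k t0.
apply/idP/idP => [/(pt_le k)|jt]; first by move/le_trans; apply.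
have : pt k j < pt k (gidx k t).+1 by apply: le_lt_trans h2.
by rewrite ltr_pM2r ?mesh_gt0// ltr_nat ltnS.
Qed.

Lemma gidx_lt k t j : 0 <= t -> (gidx k t < j)%N = (t < pt k j).
Proof. by move=> t0; rewrite ltNge -gidx_ge// ltnNge. Qed.

Lemma gidx_le k s t : 0 <= s -> s <= t -> (gidx k s <= gidx k t)%N.
Proof.
move=> s0 st; rewrite gidx_ge ?(le_trans s0)//.
by have /andP[h _] := gidxP k s0; apply: le_trans st.
Qed.

Lemma pt_full k : pt k (2 ^ k) = T.
Proof. by rewrite /pt /mesh natrX; field; rewrite expf_neq0. Qed.

Lemma gidx_max k t : 0 <= t <= T -> (gidx k t <= 2 ^ k)%N.
Proof.
move=> /andP[t0 tT]; rewrite -(@leq_pmul2l 1)// !mul1n -ltnS gidx_lt// ptS pt_full.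
by rewrite (le_lt_trans tT)// ltrDl mesh_gt0.
Qed.

(** The point [t] lies in the left or in the right half of its cell, so one refinement keeps the
    last grid point or moves it to a new midpoint. *)
Lemma gidxS k t : 0 <= t ->
  gidx k.+1 t = (gidx k t).*2 \/ gidx k.+1 t = (gidx k t).*2.+1.
Proof.
move=> t0; have /andP[h1 h2] := gidxP k t0.
have : ((gidx k t).*2 <= gidx k.+1 t)%N by rewrite gidx_ge// pt_double.
have : (gidx k.+1 t < (gidx k t).+1.*2)%N by rewrite gidx_lt// pt_double.
lia.
Qed.

Lemma gidx0 k : gidx k 0 = 0%N.
Proof. by rewrite /gidx mul0r truncn0. Qed.

Lemma mesh_cvg (v : R) : 0 < v -> (fun k => mesh k `^ v) @ \oo --> (0 : R).
Proof.
move=> /half_powR_lt1/andP[q0 q1].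
have -> : (fun k => mesh k `^ v) = geometric (T `^ v) (2^-1 `^ v).
  by apply/funext => k; rewrite mesh_powR.
by apply: cvg_geometric; rewrite ger0_norm.
Qed.

Lemma mesh_small (e : R) : 0 < e -> exists N, forall k, (N <= k)%N -> mesh k <= e.
Proof.
move=> e0; have /cvgrPdist_le /(_ e e0)[N _ h] := mesh_cvg ltr01.
exists N => k /h /=; rewrite sub0r normrN powRr1 ?(ltW (mesh_gt0 k))//.
by apply: le_trans; exact: ler_norm.
Qed.

Lemma dyadic_level (e : R) : 0 < e <= T -> exists k, mesh k.+1 < e <= mesh k.
Proof.
move=> /andP[e0 eT].
have ex : exists k, mesh k < e.
  have [N h] := mesh_small (divr_gt0 e0 (ltr0n R 2)); exists N.
  by apply: (le_lt_trans (h N (leqnn _))); lra.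
case: (ex_minnP ex) => [[|k]] h hm; first by move: h; rewrite /mesh expr0 divr1 ltNge eT.
exists k; rewrite h leNgt /=.
by apply/negP => /hm; rewrite ltnn.
Qed.

End grid.

Section sewing.
Context {R : realType}.
Implicit Types (x mu D t s u : R) (Xi : R -> R -> R).

Definition damp x t s : R := expR (- (x * (t - s))).

Lemma damp_gt0 x t s : 0 < damp x t s.
Proof. exact: expR_gt0. Qed.

Lemma damp_le1 x t s : 0 <= x -> s <= t -> damp x t s <= 1.
Proof. by move=> x0 st; rewrite -expR0 ler_expR oppr_le0 mulr_ge0// subr_ge0. Qed.

Lemma damp_norm_le x t s a c : 0 <= x -> s <= t -> `|a| <= c -> `|damp x t s * a| <= c.
Proof.
move=> x0 st ac; rewrite normrM (ger0_norm (ltW (damp_gt0 _ _ _))).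
by apply: le_trans ac; rewrite ler_piMl// damp_le1.
Qed.

Lemma dampM x t u s : damp x t u * damp x u s = damp x t s.
Proof. by rewrite /damp -expRD; congr expR; ring. Qed.

Lemma dampxx x t : damp x t t = 1.
Proof. by rewrite /damp subrr mulr0 oppr0 expR0. Qed.

Definition psum T x Xi k (a b : nat) t : R :=
  \sum_(a <= j < b) damp x t (pt T k j.+1) * Xi (pt T k j.+1) (pt T k j).

(** The incomplete cell that contains [t] is left out; germs are small on short intervals, so the
    limit does not see it. *)
Definition rsum T x Xi t k : R := psum T x Xi k 0 (gidx T k t) t.

Definition sew T x Xi t : R := limn (rsum T x Xi t).

(** The horizon [tau] is separate from the grid length [T]: weighted estimates take [tau = t],
    because their constant contains [exp(lam t)]. *)
Definition germ_le x mu D tau Xi := forall s u t, 0 <= s -> s <= u -> u <= t -> t <= tau ->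
  `|Xi t s - Xi t u - damp x t u * Xi u s| <= D * (t - s) `^ mu.

Variable T : R.
Hypothesis T0 : 0 < T.

Lemma psum_shift x Xi k a b t s : damp x t s * psum T x Xi k a b s = psum T x Xi k a b t.
Proof.
rewrite /psum big_distrr/=; apply: eq_bigr => j _.
by rewrite mulrA dampM.
Qed.

Lemma psum_cat x Xi k a c b t : (a <= c <= b)%N ->
  psum T x Xi k a b t = psum T x Xi k a c t + psum T x Xi k c b t.
Proof. by move=> /andP[ac cb]; rewrite /psum (big_cat_nat ac cb). Qed.

Lemma psumB x Xi Xi' k a b t :
  psum T x (fun t s => Xi t s - Xi' t s) k a b t = psum T x Xi k a b t - psum T x Xi' k a b t.
Proof. by rewrite /psum -sumrB; apply: eq_bigr => j _; rewrite mulrBr. Qed.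

Lemma rsum_incr x Xi s t k : 0 <= s -> s <= t ->
  rsum T x Xi t k - damp x t s * rsum T x Xi s k = psum T x Xi k (gidx T k s) (gidx T k t) t.
Proof.
move=> s0 st; rewrite /rsum psum_shift (@psum_cat _ _ _ _ (gidx T k s)) ?gidx_le//.
by rewrite addrC addKr.
Qed.

(** The solution of [c = q c + 1] with [q = (2/3)^(mu - 1)]: a block costs its two parts, at most
    [q c] together, and one defect. The ratio is 2/3 and not 1/2 because three cells split into one
    and two. *)
Definition Cgrid mu : R := (1 - (2/3) `^ (mu - 1))^-1.

Lemma Cgrid_ge1 mu : 1 < mu -> 1 <= Cgrid mu.
Proof.
move=> mu1; have h : (2/3 : R) `^ (mu - 1) < 1 `^ (mu - 1).
  by apply: gt0_ltr_powR; rewrite ?nnegrE ?subr_gt0//; lra.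
move: h; rewrite powR1 => h.
by rewrite invf_ge1 ?subr_gt0// gerBl powR_ge0.
Qed.

(** In [a^mu = a a^(mu - 1)] and [b^mu = b b^(mu - 1)] the second factors are at most
    [(2/3 (a + b))^(mu - 1)], and the first ones add up to [a + b]. *)
Lemma powR_split mu a b : 1 < mu -> 0 <= a -> 0 <= b -> 0 < a + b ->
  a <= 2/3 * (a + b) -> b <= 2/3 * (a + b) ->
  a `^ mu + b `^ mu <= (2/3) `^ (mu - 1) * (a + b) `^ mu.
Proof.
move=> mu1 a0 b0 ab0 ha hb.
have mu0 : 0 < mu by lra.
have key c : 0 <= c -> c <= 2/3 * (a + b) ->
    c `^ mu <= c * ((2/3) `^ (mu - 1) * (a + b) `^ (mu - 1)).
  move=> c0 hc; rewrite -(mulr_powRB1 c0 mu0) ler_wpM2l// -powRM; [|lra|exact: ltW].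
  by apply: powR_mono => //; rewrite subr_ge0 ltW.
apply: (le_trans (lerD (key _ a0 ha) (key _ b0 hb))).
rewrite -(@mulr_powRB1 _ (a + b) mu)//; last exact: ltW.
by rewrite le_eqVlt; apply/orP; left; apply/eqP; ring.
Qed.

(* Induction on the number of cells: splitting the block in the middle costs one defect of [Xi],
   and [a^mu + b^mu] is smaller than [(a+b)^mu] by a fixed factor. *)
Lemma psum_grid x mu D tau Xi k a b : 0 <= x -> 1 < mu -> 0 <= D ->
  germ_le x mu D tau Xi -> (a < b)%N -> pt T k b <= tau ->
  `|psum T x Xi k a b (pt T k b) - Xi (pt T k b) (pt T k a)|
    <= Cgrid mu * D * (pt T k b - pt T k a) `^ mu.
Proof.
move=> x0 mu1 D0 hXi.
have [l] := ubnP (b - a); elim: l a b => // l IH a b hl ab btau.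
have C1 := Cgrid_ge1 mu1.
have C0 : 0 <= Cgrid mu by apply: le_trans C1.
have [|l2] := leqP (b - a) 1.
  move=> l1; have -> : b = a.+1 by lia.
  by rewrite /psum big_nat1 dampxx mul1r subrr normr0 !mulr_ge0// powR_ge0.
have [c [ac cb i1 i2 /andP[hl1 hl2]]] : exists c, [/\ (a < c)%N, (c < b)%N,
    (3 * (c - a) <= 2 * (c - a + (b - c)))%N, (3 * (b - c) <= 2 * (c - a + (b - c)))%N
    & (c - a < l)%N && (b - c < l)%N].
  exists (a + (b - a)./2)%N; clear -hl ab l2.
  by split; lia.
have ca' := ltnW ac; have cb' := ltnW cb.
have pac : pt T k a <= pt T k c by rewrite pt_le// ltnW.
have pcb : pt T k c <= pt T k b by rewrite pt_le// ltnW.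
have IH1 := IH a c hl1 ac (le_trans pcb btau).
have IH2 := IH c b hl2 cb btau.
have dfc := hXi (pt T k a) (pt T k c) (pt T k b) (pt_ge0 T0 _ _) pac pcb btau.
have sp : (pt T k c - pt T k a) `^ mu + (pt T k b - pt T k c) `^ mu <=
   (2/3) `^ (mu - 1) * (pt T k b - pt T k a) `^ mu.
  have -> : pt T k b - pt T k a = (pt T k c - pt T k a) + (pt T k b - pt T k c) by ring.
  have m0 := mesh_gt0 T0 k.
  have e1 : pt T k c - pt T k a = (c - a)%:R * mesh T k by rewrite natrB// /pt; ring.
  have e2 : pt T k b - pt T k c = (b - c)%:R * mesh T k by rewrite natrB// /pt; ring.
  rewrite e1 e2 -mulrDl -natrD.
  have r1 : 3 * (c - a)%:R <= 2 * (c - a + (b - c))%:R :> R by rewrite -!natrM ler_nat.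
  have r2 : 3 * (b - c)%:R <= 2 * (c - a + (b - c))%:R :> R by rewrite -!natrM ler_nat.
  have := @powR_split mu ((c - a)%:R * mesh T k) ((b - c)%:R * mesh T k) mu1.
  rewrite -mulrDl -natrD; apply.
  - by rewrite mulr_ge0// ltW.
  - by rewrite mulr_ge0// ltW.
  - by rewrite mulr_gt0// ltr0n addn_gt0 subn_gt0 ac.
  - by have := ler_wpM2r (ltW m0) r1; lra.
  - by have := ler_wpM2r (ltW m0) r2; lra.
rewrite (@psum_cat _ _ _ _ c) ?ca'// -(psum_shift _ _ _ _ _ (pt T k b) (pt T k c)).
set P1 := psum _ _ _ _ a c _ in IH1 *; set P2 := psum _ _ _ _ c b _ in IH2 *.
have -> : damp x (pt T k b) (pt T k c) * P1 + P2 - Xi (pt T k b) (pt T k a) =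
  damp x (pt T k b) (pt T k c) * (P1 - Xi (pt T k c) (pt T k a)) + (P2 - Xi (pt T k b) (pt T k c))
  - (Xi (pt T k b) (pt T k a) - Xi (pt T k b) (pt T k c)
      - damp x (pt T k b) (pt T k c) * Xi (pt T k c) (pt T k a)) by ring.
apply: (le_trans (ler_normB _ _)).
apply: (le_trans (lerD (ler_normD _ _) (lexx _))).
apply: (le_trans (lerD (lerD (damp_norm_le x0 pcb IH1) IH2) dfc)).
rewrite -mulrDr.
apply: (le_trans (lerD (ler_wpM2l _ sp) (lexx _))); first by rewrite mulr_ge0.
rewrite le_eqVlt; apply/orP; left; apply/eqP.
set q := (2/3) `^ (mu - 1); set p := (_ - _) `^ mu.
have q1 : 1 - q != 0.
  by apply: contraTneq C1 => e; rewrite /Cgrid -/q e invr0 -ltNge.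
by rewrite /Cgrid -/q; field.
Qed.

Lemma sum_double (F : nat -> R) N :
  \sum_(0 <= j < N.*2) F j = \sum_(0 <= j < N) (F j.*2 + F j.*2.+1).
Proof.
elim: N => [|N IH]; first by rewrite !big_nil.
by rewrite doubleS !big_nat_recr//= IH addrA.
Qed.

(** Halving a cell changes the sum by minus one defect, and at most one new cell appears before [t].
    It is kept as an identity because the pathwise and the [L^2] estimates both start from it. *)
Lemma rsum_stepE x Xi k t : 0 <= t ->
  rsum T x Xi t k.+1 - rsum T x Xi t k =
    \sum_(0 <= j < gidx T k t) damp x t (pt T k j.+1) *
       - (Xi (pt T k j.+1) (pt T k j) - Xi (pt T k j.+1) (pt T k.+1 j.*2.+1)
           - damp x (pt T k j.+1) (pt T k.+1 j.*2.+1) * Xi (pt T k.+1 j.*2.+1) (pt T k j))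
    + (if gidx T k.+1 t == (gidx T k t).*2 then 0
       else damp x t (pt T k.+1 (gidx T k.+1 t)) *
          Xi (pt T k.+1 (gidx T k.+1 t)) (pt T k.+1 (gidx T k t).*2)).
Proof.
move=> t0; set N := gidx T k t.
have main : psum T x Xi k.+1 0 N.*2 t - psum T x Xi k 0 N t =
    \sum_(0 <= j < N) damp x t (pt T k j.+1) *
       - (Xi (pt T k j.+1) (pt T k j) - Xi (pt T k j.+1) (pt T k.+1 j.*2.+1)
           - damp x (pt T k j.+1) (pt T k.+1 j.*2.+1) * Xi (pt T k.+1 j.*2.+1) (pt T k j)).
  rewrite /psum sum_double -sumrB; apply: eq_bigr => j _.
  have e0 : pt T k.+1 j.*2 = pt T k j by rewrite pt_double.
  have e2 : pt T k.+1 j.*2.+2 = pt T k j.+1 by rewrite -doubleS pt_double.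
  rewrite e0 e2 -(dampM x t (pt T k j.+1) (pt T k.+1 j.*2.+1)); ring.
rewrite -main /rsum -/N.
have [->|->] := gidxS T0 k t0; rewrite -/N; first by rewrite eqxx addr0.
rewrite (_ : (N.*2.+1 == N.*2) = false); last by apply/negbTE; rewrite neq_ltn ltnSn orbT.
by rewrite (@psum_cat _ _ _ _ N.*2) ?leqnSn// {2}/psum big_nat1 addrAC.
Qed.

(** The [N] defects cost [N D mesh^mu], and [N mesh <= t] leaves the power [mu - 1]. The possible
    last cell must be of the same order, hence the exponent [mu - 1] in the bound on [Xi] itself. *)
Lemma rsum_step x mu D D' Xi k t : 0 <= x -> 1 < mu -> 0 <= D -> 0 <= D' -> 0 <= t ->
  germ_le x mu D t Xi ->
  (forall s u, 0 <= s -> s <= u -> u <= t -> `|Xi u s| <= D' * (u - s) `^ (mu - 1)) ->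
  `|rsum T x Xi t k.+1 - rsum T x Xi t k|
     <= (t * D + D') * T `^ (mu - 1) * ((2^-1 : R) `^ (mu - 1)) ^+ k.
Proof.
move=> x0 mu1 D0 D'0 t0 hXi hb.
have mu0 : 0 < mu by lra.
have nu0 : 0 < mu - 1 by lra.
have m0 := mesh_gt0 T0 k.
have m1 := mesh_gt0 T0 k.+1.
rewrite -mulrA -mesh_powR// rsum_stepE//.
set N := gidx T k t.
have ptN : pt T k N <= t by have /andP[] := gidxP T0 k t0.
rewrite [leRHS]mulrDl; apply: (le_trans (ler_normD _ _)); apply: lerD.
  apply: (le_trans (ler_norm_sum _ _ _)).
  apply: (@le_trans _ _ (\sum_(0 <= j < N) D * mesh T k `^ mu)).
    rewrite big_nat [leRHS]big_nat; apply: ler_sum => j /andP[_ jN].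
    have e0 : pt T k.+1 j.*2 = pt T k j by rewrite pt_double.
    have e2 : pt T k.+1 j.*2.+2 = pt T k j.+1 by rewrite -doubleS pt_double.
    have jt : pt T k j.+1 <= t by apply: le_trans ptN; exact: pt_le.
    have v1 : pt T k j <= pt T k.+1 j.*2.+1 by rewrite -e0 pt_le.
    have v2 : pt T k.+1 j.*2.+1 <= pt T k j.+1 by rewrite -e2 pt_le.
    apply: damp_norm_le => //; rewrite normrN.
    apply: (le_trans (hXi _ _ _ (pt_ge0 T0 _ _) v1 v2 jt)).
    by rewrite ptS addrC addKr.
  rewrite big_const_nat subn0 iter_addr addr0 -mulr_natl -(mulr_powRB1 (ltW m0) mu0).
  have -> : N%:R * (D * (mesh T k * mesh T k `^ (mu - 1))) =
    pt T k N * (D * mesh T k `^ (mu - 1)) by rewrite /pt; ring.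
  by rewrite -mulrA ler_wpM2r// mulr_ge0// powR_ge0.
have D'm : 0 <= D' * mesh T k `^ (mu - 1) by rewrite mulr_ge0// powR_ge0.
case: eqP => [_|/eqP hN]; first by rewrite normr0.
have e : gidx T k.+1 t = N.*2.+1.
  by have [e|//] := gidxS T0 k t0; rewrite e eqxx in hN.
have pt1 : pt T k.+1 (gidx T k.+1 t) <= t by have /andP[] := gidxP T0 k.+1 t0.
apply: damp_norm_le => //; rewrite e in pt1 *.
apply: (le_trans (hb _ _ (pt_ge0 T0 _ _) (pt_le T0 _ (leqnSn _)) pt1)).
rewrite ler_wpM2l// ptS addrC addKr.
apply: powR_mono; [exact: ltW|exact: ltW|].
by rewrite (meshS T k); lra.
Qed.

Section converge.
Variables (x mu D D' tau : R) (Xi : R -> R -> R).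
Hypotheses (x0 : 0 <= x) (mu1 : 1 < mu) (D0 : 0 <= D) (D'0 : 0 <= D').
Hypothesis hXi : germ_le x mu D tau Xi.
Hypothesis hb : forall s u, 0 <= s -> s <= u -> u <= tau -> `|Xi u s| <= D' * (u - s) `^ (mu - 1).

Lemma sew_cvg t : 0 <= t -> t <= tau -> rsum T x Xi t @ \oo --> sew T x Xi t.
Proof.
move=> t0 tt.
have [] // := @geometric_cvg R (rsum T x Xi t) ((t * D + D') * T `^ (mu - 1)) (2^-1 `^ (mu - 1)).
  by apply: half_powR_lt1; rewrite subr_gt0.
move=> k; apply: rsum_step => //.
  by move=> s u v s0 su uv vt; apply: hXi => //; apply: le_trans tt.
by move=> s u s0 su ut; apply: hb => //; apply: le_trans tt.
Qed.

(** One block estimate and two defects, all on intervals of length at most [2 (t - s)]: the grid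
    point before [s] is within one mesh, and the mesh is below [t - s]. *)
Definition Csew mu : R := (Cgrid mu + 2) * 2 `^ mu.

(** The constant [D'] controls only the incomplete cells at [s] and [t]; they vanish in the limit,
    so it is absent from the bound. *)
Lemma sew_germ s t : 0 <= s -> s <= t -> t <= tau ->
  `|sew T x Xi t - damp x t s * sew T x Xi s - Xi t s| <= Csew mu * D * (t - s) `^ mu.
Proof.
move=> s0 st tt.
have C1 := Cgrid_ge1 mu1.
have C0 : 0 <= Csew mu by rewrite mulr_ge0 ?powR_ge0// addr_ge0// (le_trans ler01).
have t0 : 0 <= t by apply: le_trans st.
have mu0 : 0 < mu := lt_trans ltr01 mu1.
have nu0 : 0 < mu - 1 by rewrite subr_gt0.
move: st; rewrite le_eqVlt => /orP[/eqP st|st].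
  (* On the diagonal the size bound forces [Xi t t = 0], because the exponent [mu - 1] is
     positive. *)
  rewrite st dampxx mul1r subrr sub0r normrN.
  have := @hb t t t0 (lexx _) tt; rewrite subrr powR0 ?gt_eqF// mulr0 normr_le0 => /eqP ->.
  by rewrite normr0 mulr_ge0 ?powR_ge0// mulr_ge0.
have cv : (fun k => `|rsum T x Xi t k - damp x t s * rsum T x Xi s k - Xi t s|) @ \oo -->
   `|sew T x Xi t - damp x t s * sew T x Xi s - Xi t s|.
  apply: cvg_norm; apply: cvgB; last exact: cvg_cst.
  apply: cvgB; first exact: sew_cvg.
  apply: cvgM; first exact: cvg_cst.
  by apply: sew_cvg => //; apply: le_trans tt; exact: ltW.
have cv2 : (fun k => Csew mu * D * (t - s) `^ mu + 2 * D' * mesh T k `^ (mu - 1)) @ \oo -->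
   Csew mu * D * (t - s) `^ mu + 2 * D' * 0.
  apply: cvgD; first exact: cvg_cst.
  by apply: cvgM; [exact: cvg_cst|exact: mesh_cvg].
rewrite mulr0 addr0 in cv2.
apply: (ler_cvg_to cv cv2).
have [N hN] : exists N, forall k, (N <= k)%N -> mesh T k <= t - s.
  by apply: mesh_small => //; rewrite subr_gt0.
exists N => // k /hN {hN} /= hk.
have m0 := mesh_gt0 T0 k.
have /andP[s1 s2] := gidxP T0 k s0.
have /andP[t1 t2] := gidxP T0 k t0.
rewrite ptS in s2; rewrite ptS in t2.
rewrite rsum_incr//; last exact: ltW.
have ij : (gidx T k s < gidx T k t)%N by rewrite gidx_lt//; lra.
set i := gidx T k s in s1 s2 ij *; set j := gidx T k t in t1 t2 ij *.
have G := @psum_grid x mu D tau Xi k i j x0 mu1 D0 hXi ij (le_trans t1 tt).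
have A1 : `|Xi t (pt T k i) - Xi t (pt T k j) - damp x t (pt T k j) * Xi (pt T k j) (pt T k i)|
     <= D * (t - pt T k i) `^ mu.
  by apply: hXi => //; [exact: pt_ge0|apply: pt_le => //; exact: ltnW].
have A2 : `|Xi t (pt T k i) - Xi t s - damp x t s * Xi s (pt T k i)|
     <= D * (t - pt T k i) `^ mu.
  by apply: hXi => //; [exact: pt_ge0|exact: ltW].
have up v : 0 <= v -> v <= 2 * (t - s) -> v `^ mu <= 2 `^ mu * (t - s) `^ mu.
  move=> v0 v2; rewrite -powRM//; last by rewrite subr_ge0 ltW.
  by apply: powR_mono => //; exact: ltW.
have i0 := pt_ge0 T0 k i.
have L1 : (pt T k j - pt T k i) `^ mu <= 2 `^ mu * (t - s) `^ mu.
  by apply: up; last lra; rewrite subr_ge0 pt_le// ltnW.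
have L2 : (t - pt T k i) `^ mu <= 2 `^ mu * (t - s) `^ mu by apply: up; lra.
have pm v : 0 <= v -> v <= mesh T k -> v `^ (mu - 1) <= mesh T k `^ (mu - 1).
  by move=> v0 vm; apply: powR_mono => //; exact: ltW.
have B1 : `|Xi t (pt T k j)| <= D' * mesh T k `^ (mu - 1).
  apply: (le_trans (hb (pt_ge0 T0 _ _) t1 tt)).
  by rewrite ler_wpM2l// pm// ?subr_ge0//; lra.
have B2 : `|Xi s (pt T k i)| <= D' * mesh T k `^ (mu - 1).
  apply: (le_trans (hb (pt_ge0 T0 _ _) s1 _)); first lra.
  by rewrite ler_wpM2l// pm// ?subr_ge0//; lra.
rewrite -(psum_shift _ _ _ _ _ t (pt T k j)).
set P := psum _ _ _ _ _ _ _ in G *.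
set a := damp x t (pt T k j) in A1 *; set b := damp x t s in A2 *.
(* The interval from grid point [i] to [t] is cut once at grid point [j] and once at [s]; its own
   germ cancels. *)
have -> : a * P - Xi t s = a * (P - Xi (pt T k j) (pt T k i))
  - (Xi t (pt T k i) - Xi t (pt T k j) - a * Xi (pt T k j) (pt T k i))
  + (Xi t (pt T k i) - Xi t s - b * Xi s (pt T k i))
  - Xi t (pt T k j) + b * Xi s (pt T k i) by ring.
have F1 : `|a * (P - Xi (pt T k j) (pt T k i))| <= Cgrid mu * D * (2 `^ mu * (t - s) `^ mu).
  apply: damp_norm_le => //; apply: (le_trans G); rewrite ler_wpM2l// mulr_ge0//.
  exact: le_trans C1.
have F2 := le_trans A1 (ler_wpM2l D0 L2).
have F3 := le_trans A2 (ler_wpM2l D0 L2).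
have F4 : `|b * Xi s (pt T k i)| <= D' * mesh T k `^ (mu - 1).
  by apply: damp_norm_le => //; exact: ltW.
apply: (le_trans (ler_normD _ _)).
apply: (le_trans (lerD (ler_normB _ _) F4)).
apply: (le_trans (lerD (lerD (ler_normD _ _) B1) (lexx _))).
apply: (le_trans (lerD (lerD (lerD (ler_normB _ _) F3) (lexx _)) (lexx _))).
apply: (le_trans (lerD (lerD (lerD (lerD F1 F2) (lexx _)) (lexx _)) (lexx _))).
by rewrite le_eqVlt; apply/orP; left; apply/eqP; rewrite /Csew; ring.
Qed.

End converge.
End sewing.

(** * Convolution paths and Young integrals against them *)

Section conv_paths.
Context {R : realType}.
Implicit Types (x K B M T gamma tau lam : R) (p z : R -> R) (A : R -> R -> R).

Definition dconv A t s x : R := A t x - damp x t s * A s x.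

Lemma dconv_chen A t u s x : dconv A t s x = dconv A t u x + damp x t u * dconv A u s x.
Proof. by rewrite /dconv -(dampM x t u s); ring. Qed.

Definition holder gamma B tau z := forall s t, 0 <= s -> s <= t -> t <= tau ->
  `|z t - z s| <= B * (t - s) `^ gamma.

Definition conv_holder gamma K T A := forall x s t, 0 <= x -> 0 <= s -> s <= t -> t <= T ->
  `|dconv A t s x| <= K * (t - s) `^ gamma.

Definition weighted_holder gamma lam B T z := forall s t, 0 <= s -> s <= t -> t <= T ->
  `|z t - z s| <= B * expR (lam * t) * (t - s) `^ gamma.

Lemma one_damp_ge0 x t s : 0 <= x -> s <= t -> 0 <= 1 - damp x t s.
Proof. by move=> x0 st; rewrite subr_ge0 damp_le1. Qed.

Lemma one_damp_le x t s : 1 - damp x t s <= x * (t - s).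
Proof. by have := expR_ge1Dx (- (x * (t - s))); rewrite /damp; lra. Qed.

(** Interpolation between the bounds 1 and [y = x (t - s)]: [min(1, y) <= y^gamma]. This is where
    the weight [1 + xi^gamma] comes from. *)
Lemma one_damp_powR gamma x t s : 0 < gamma <= 1 -> 0 <= x -> s <= t ->
  1 - damp x t s <= x `^ gamma * (t - s) `^ gamma.
Proof.
move=> /andP[g0 g1] x0 st.
have ts0 : 0 <= t - s by rewrite subr_ge0.
rewrite -powRM//; set y := x * (t - s); have y0 : 0 <= y by rewrite mulr_ge0.
have [y1|y1] := leP y 1.
  apply: (le_trans (one_damp_le _ _ _)); rewrite -/y.
  move: y0; rewrite le_eqVlt => /orP[/eqP <-|y0]; first exact: powR_ge0.
  by apply: ger1_powR => //; rewrite y0.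
apply: (@le_trans _ _ 1); first by rewrite gerBl ltW// damp_gt0.
rewrite -[leLHS](powRr0 y); apply: ler_powR => //; exact: ltW.
Qed.

Section integrator.
Variables (T gamma K : R) (p : R -> R).
Hypotheses (T0 : 0 < T) (g01 : 0 < gamma <= 1) (K0 : 0 <= K).
Hypothesis hp : holder gamma K T p.

Definition wconv (t x : R) : R := sew T x (fun t s => p t - p s) t.

Let g0 : 0 < gamma. Proof. by case/andP: g01. Qed.

(** The exponent [1 + gamma] exceeds 1, but the constant grows with [x]; this serves the existence
    of the limit, not its size. *)
Let germ x : 0 <= x -> germ_le x (1 + gamma) (x * K) T (fun t s => p t - p s).
Proof.
move=> x0 s u t s0 su ut tT.
have -> : p t - p s - (p t - p u) - damp x t u * (p u - p s) = (1 - damp x t u) * (p u - p s).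
  by ring.
rewrite normrM ger0_norm ?one_damp_ge0//.
have g0' := g0.
rewrite powRD ?powRr1; [|by lra|by rewrite gt_eqF//; lra].
rewrite mulrACA; apply: ler_pM => //; first exact: one_damp_ge0.
  apply: (le_trans (one_damp_le _ _ _)); rewrite ler_wpM2l//; lra.
apply: (le_trans (hp s0 su (le_trans ut tT))); rewrite ler_wpM2l//.
apply: powR_mono; [exact: ltW|lra|lra].
Qed.

Lemma wconv_cvg x t : 0 <= x -> 0 <= t -> t <= T ->
  rsum T x (fun t s => p t - p s) t @ \oo --> wconv t x.
Proof.
move=> x0 t0 tT; apply: (@sew_cvg _ T T0 x (1 + gamma) (x * K) K T) => //.
- by rewrite ltrDl.
- by rewrite mulr_ge0.
- exact: germ.
- by move=> s u s0 su uT; rewrite (addrC 1) addrK; exact: hp.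
Qed.

(* The discrete convolution of the increments differs from the plain increment by a convex
   combination of earlier increments: this makes the bound independent of [x]. *)
Lemma psum_increment_le x k i n M : 0 <= x ->
  (forall m, (m <= n)%N -> `|p (pt T k (i + m)) - p (pt T k i)| <= M) ->
  `|psum T x (fun t s => p t - p s) k i (i + n) (pt T k (i + n))
     - (p (pt T k (i + n)) - p (pt T k i))| <= M.
Proof.
move=> x0; elim: n => [|n IH] hM.
  rewrite addn0 /psum big_geq// !subrr normr0.
  by have := hM 0%N (leqnn _); rewrite addn0 subrr normr0.
have {}IH := IH (fun m mn => hM m (leqW mn)).
have hn := hM n (leqnSn _).
rewrite addnS (@psum_cat _ _ _ _ _ _ (i + n)); last by rewrite leq_addr leqnSn.
rewrite {2}/psum big_nat1 dampxx mul1r.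
rewrite -(psum_shift _ _ _ _ _ _ (pt T k (i + n).+1) (pt T k (i + n))).
have q0 := damp_gt0 x (pt T k (i + n).+1) (pt T k (i + n)).
have q1 : damp x (pt T k (i + n).+1) (pt T k (i + n)) <= 1.
  by rewrite damp_le1// pt_le.
set q := damp _ _ _ in q0 q1 *.
set P := psum _ _ _ _ _ _ _ in IH *.
set b := p (pt T k (i + n)) in IH hn *.
set a := p (pt T k i) in IH hn *.
set c := p _.
have -> : q * P + (c - b) - (c - a) = q * (P - (b - a)) - (1 - q) * (b - a) by ring.
apply: (le_trans (ler_normB _ _)).
rewrite !normrM (ger0_norm (ltW q0)) (ger0_norm (x := 1 - q)) ?subr_ge0//.
have : q * `|P - (b - a)| <= q * M by rewrite ler_pM2l.
have : (1 - q) * `|b - a| <= (1 - q) * M by rewrite ler_wpM2l// subr_ge0.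
lra.
Qed.

(** Grid points around [s] and [t] are at distance at most [2 (t - s)], so plain increments of [p]
    are at most [2 K (t - s)^gamma]. The discrete convolution is one such increment plus an error of
    the same size, which makes [4 K]. *)
Lemma wconv_holder : conv_holder gamma (4 * K) T wconv.
Proof.
move=> x s t x0 s0; rewrite le_eqVlt => /orP[/eqP <- sT|st tT].
  by rewrite /dconv dampxx mul1r subrr normr0 !mulr_ge0// powR_ge0.
have t0 : 0 <= t by rewrite (le_trans s0)// ltW.
have sT : s <= T by rewrite ltW// (lt_le_trans st).
set G := fun t s => p t - p s.
have cv : (fun k => rsum T x G t k - damp x t s * rsum T x G s k) @ \oo --> dconv wconv t s x.
  apply: cvgB; first exact: wconv_cvg.
  by apply: cvgM; [exact: cvg_cst|exact: wconv_cvg].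
have [N hN] : exists N, forall k, (N <= k)%N -> mesh T k <= t - s.
  by apply: mesh_small => //; rewrite subr_gt0.
rewrite -[X in `|X|]subr0.
apply: (cvgn_norm_le (N := N) cv) => k /hN hk; rewrite subr0.
rewrite rsum_incr//; last exact: ltW.
have /andP[s1 s2] := gidxP T0 k s0.
have /andP[t1 t2] := gidxP T0 k t0.
rewrite ptS in s2; rewrite ptS in t2.
have ij : (gidx T k s <= gidx T k t)%N by rewrite gidx_le// ltW.
set i := gidx T k s in s1 s2 ij *; set j := gidx T k t in t1 t2 ij *.
have ijE : j = (i + (j - i))%N by rewrite subnKC.
have M0 m : (m <= j - i)%N ->
    `|p (pt T k (i + m)) - p (pt T k i)| <= K * (2 * (t - s) `^ gamma).
  move=> mj; have i0 := pt_ge0 T0 k i.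
  have l1 : pt T k i <= pt T k (i + m) by rewrite pt_le// leq_addr.
  have l2 : pt T k (i + m) <= pt T k j by rewrite pt_le// ijE leq_add2l.
  apply: (le_trans (hp i0 l1 _)); first lra.
  rewrite ler_wpM2l//.
  apply: (@le_trans _ _ ((2 * (t - s)) `^ gamma)).
    by apply: powR_mono; [exact: ltW|rewrite subr_ge0|lra].
  rewrite powRM//; last by rewrite subr_ge0 ltW.
  rewrite ler_wpM2r ?powR_ge0//.
  by case/andP: g01 => _ g1; apply: ler1_powR => //; lra.
have := psum_increment_le x0 M0; rewrite -ijE => h.
rewrite -(psum_shift _ _ _ _ _ _ t (pt T k j)).
apply: damp_norm_le => //.
have h2 := M0 _ (leqnn _); rewrite -ijE in h2.
set P := psum _ _ _ _ _ _ _ in h *.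
have -> : P = (P - (p (pt T k j) - p (pt T k i))) + (p (pt T k j) - p (pt T k i)) by ring.
apply: (le_trans (ler_normD _ _)).
by apply: (le_trans (lerD h h2)); lra.
Qed.

Lemma wconv0 x : wconv 0 x = 0.
Proof.
rewrite /wconv /sew.
have -> : rsum T x (fun t s => p t - p s) 0 = fun=> 0.
  by apply/funext => k; rewrite /rsum gidx0 /psum big_geq.
exact: lim_cst.
Qed.

End integrator.

Section young.
Variables (T gamma K : R) (A : R -> R -> R).
Hypotheses (T0 : 0 < T) (g12 : 1/2 < gamma) (g1 : gamma <= 1) (K0 : 0 <= K).
Hypothesis hA : conv_holder gamma K T A.

Definition ygerm z x t s : R := dconv A t s x * z s.
Definition yconv z t x : R := sew T x (ygerm z x) t.

Let g0 : 0 < gamma. Proof. by move: g12 => ?; lra. Qed.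
Let mu1 : 1 < 2 * gamma. Proof. by move: g12 => ?; lra. Qed.

Lemma yconv0 z x : yconv z 0 x = 0.
Proof.
rewrite /yconv /sew.
have -> : rsum T x (ygerm z x) 0 = fun=> 0.
  by apply/funext => k; rewrite /rsum gidx0 /psum big_geq.
exact: lim_cst.
Qed.

Lemma powR_sqr (a : R) : 0 <= a -> a `^ (2 * gamma) = a `^ gamma * a `^ gamma.
Proof.
move=> a0; rewrite -powRD; first by congr powR; ring.
by have g0' := g0; rewrite gt_eqF//; lra.
Qed.

Section bounds.
Variables (x tau B : R) (z : R -> R).
Hypotheses (x0 : 0 <= x) (tT : tau <= T) (B0 : 0 <= B).
Hypothesis hz : holder gamma B tau z.

Let germ : germ_le x (2 * gamma) (K * B) tau (ygerm z x).
Proof.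
move=> s u t s0 su ut tt.
rewrite /ygerm (dconv_chen A t u s).
have -> : (dconv A t u x + damp x t u * dconv A u s x) * z s - dconv A t u x * z u -
  damp x t u * (dconv A u s x * z s) = - (dconv A t u x * (z u - z s)) by ring.
rewrite normrN normrM powR_sqr ?subr_ge0 ?(le_trans su)// mulrACA.
apply: ler_pM => //.
  apply: (le_trans (hA x0 _ ut (le_trans tt tT))); first exact: le_trans su.
  by rewrite ler_wpM2l//; apply: powR_mono; [exact: ltW|lra|lra].
apply: (le_trans (hz s0 su (le_trans ut tt))).
by rewrite ler_wpM2l//; apply: powR_mono; [exact: ltW|lra|lra].
Qed.

Let zmax t : 0 <= t -> t <= tau -> `|z t| <= `|z 0| + B * T `^ gamma.
Proof.
move=> tp tt; have -> : z t = z 0 + (z t - z 0) by ring.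
apply: (le_trans (ler_normD _ _)); rewrite lerD2l.
apply: (le_trans (hz (lexx 0) tp tt)).
rewrite ler_wpM2l// subr0; apply: powR_mono => //; first exact: ltW.
exact: le_trans tT.
Qed.

(** A germ is of order [gamma], more than the exponent [2 gamma - 1] required; the surplus
    [1 - gamma] goes into the power of [T]. *)
Let D' := K * T `^ (1 - gamma) * (`|z 0| + B * T `^ gamma).

Let size s u : 0 <= s -> s <= u -> u <= tau ->
  `|ygerm z x u s| <= D' * (u - s) `^ (2 * gamma - 1).
Proof.
move=> s0 su ut; rewrite /ygerm normrM.
have uT := le_trans ut tT.
rewrite mulrAC; apply: ler_pM => //; last by apply: zmax => //; apply: le_trans ut.
apply: (le_trans (hA x0 s0 su uT)); rewrite -mulrA ler_wpM2l//.
have g12' := g12; have g1' := g1.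
have -> : (u - s) `^ gamma = (u - s) `^ (1 - gamma) * (u - s) `^ (2 * gamma - 1).
  rewrite -powRD; first by congr powR; ring.
  by apply/implyP => /eqP; lra.
rewrite ler_wpM2r ?powR_ge0//.
apply: powR_mono; lra.
Qed.

Lemma yconv_cvg t : 0 <= t -> t <= tau -> rsum T x (ygerm z x) t @ \oo --> yconv z t x.
Proof.
move=> tp tt; apply: (@sew_cvg _ T T0 x (2 * gamma) (K * B) D' tau) => //.
- by rewrite mulr_ge0.
- by rewrite !mulr_ge0 ?powR_ge0// addr_ge0 ?mulr_ge0// powR_ge0.
Qed.

(** The defect of [ygerm] is a convolutional increment of [A] times an increment of [z]. Both are
    bounded uniformly in [x], so here the sewing constant does not depend on [x]. *)
Lemma yconv_germ s t : 0 <= s -> s <= t -> t <= tau ->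
  `|dconv (yconv z) t s x - dconv A t s x * z s| <= Csew (2 * gamma) * (K * B) * (t - s) `^ (2 * gamma).
Proof.
move=> s0 st tt; apply: (@sew_germ _ T T0 x (2 * gamma) (K * B) D' tau (ygerm z x)) => //.
- by rewrite mulr_ge0.
- by rewrite !mulr_ge0 ?powR_ge0// addr_ge0 ?mulr_ge0// powR_ge0.
Qed.

End bounds.
End young.
End conv_paths.

(** * Exponentially weighted Hölder bounds *)

Section weighted.
Context {R : realType}.
Implicit Types (x K B M T gamma tau lam c : R) (z y : R -> R) (A : R -> R -> R).

Lemma expRN1_le_half : expR (- 1) <= 2^-1 :> R.
Proof.
rewrite expRN lef_pV2 ?posrE ?expR_gt0//.
by have := expR_ge1Dx (1 : R); lra.
Qed.

(* Steps of length [1/lam] lose a factor [e] in the weight, so the contributions of the steps sum up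
   geometrically. *)
Lemma block_bound lam c T y : 0 < lam -> 0 <= c -> y 0 = 0 ->
  (forall s t, 0 <= s -> s <= t -> t <= T -> t - s <= lam^-1 ->
    `|y t| <= `|y s| + c * expR (lam * t)) ->
  forall t, 0 <= t -> t <= T -> `|y t| <= 2 * c * expR (lam * t).
Proof.
move=> l0 c0 y0 hy t t0 tT.
have li0 : 0 < lam^-1 by rewrite invr_gt0.
have [n hn] : exists n : nat, t <= n%:R * lam^-1.
  exists (Num.truncn (t * lam)).+1; rewrite ler_pdivlMr//.
  by have /truncn_itv/andP[_ /ltW] : 0 <= t * lam by rewrite mulr_ge0// ltW.
elim: n t t0 tT hn => [|n IH] t t0 tT hn.
  have -> : t = 0 by apply/le_anti; rewrite t0 andbT -(mul0r lam^-1).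
  by rewrite y0 normr0 mulr_ge0 ?expR_ge0// mulr_ge0.
have e0 : 0 <= c * expR (lam * t) by rewrite mulr_ge0 ?expR_ge0.
have [tl|tl] := leP t lam^-1.
  have := hy 0 t (lexx _) t0 tT; rewrite subr0 y0 normr0 => /(_ tl); lra.
set s := t - lam^-1.
have s0 : 0 <= s by rewrite subr_ge0 ltW.
have st : s <= t by rewrite gerBl ltW.
have sn : s <= n%:R * lam^-1 by move: hn; rewrite -natr1 mulrDl mul1r /s; lra.
have h1 := IH s s0 (le_trans st tT) sn.
have h2 := hy s t s0 st tT; rewrite /s opprB addrC subrK in h2.
have {}h2 := h2 (lexx _); rewrite -/s in h2.
have e : expR (lam * s) = expR (lam * t) * expR (- 1).
  by rewrite -expRD /s; congr expR; field; rewrite gt_eqF.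
have h3 : c * expR (lam * s) <= c * expR (lam * t) / 2.
  by rewrite e mulrA ler_wpM2l// expRN1_le_half.
by move: h1 h2 h3; lra.
Qed.

(** Over a step of length [1/lam] the path moves by at most [B lam^(- gamma)] times the weight. This
    is the source of the small factor in the contraction. *)
Lemma weighted_sup gamma lam B T z : 0 < gamma -> 0 < lam -> 0 <= B -> z 0 = 0 ->
  weighted_holder gamma lam B T z ->
  forall t, 0 <= t -> t <= T -> `|z t| <= 2 * (B * lam^-1 `^ gamma) * expR (lam * t).
Proof.
move=> g0 l0 B0 z0 hz; apply: block_bound => //; first by rewrite mulr_ge0// powR_ge0.
move=> s t s0 st tT tl.
have -> : z t = z s + (z t - z s) by ring.
apply: (le_trans (ler_normD _ _)); rewrite lerD2l.
apply: (le_trans (hz _ _ s0 st tT)).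
rewrite mulrAC ler_wpM2r ?expR_ge0// ler_wpM2l//.
by apply: powR_mono; [exact: ltW|rewrite subr_ge0|].
Qed.

Lemma weighted_holder_restrict gamma lam B T tau z : 0 <= lam -> 0 <= B -> tau <= T ->
  weighted_holder gamma lam B T z -> holder gamma (B * expR (lam * tau)) tau z.
Proof.
move=> l0 B0 tT hz s t s0 st tt.
apply: (le_trans (hz _ _ s0 st (le_trans tt tT))).
by rewrite ler_wpM2r ?powR_ge0// ler_wpM2l// ler_expR ler_wpM2l.
Qed.

Lemma conv_holder_sup gamma K T A : 0 <= gamma -> 0 <= K -> conv_holder gamma K T A ->
  (forall x, A 0 x = 0) ->
  forall x t, 0 <= x -> 0 <= t -> t <= T -> `|A t x| <= K * T `^ gamma.
Proof.
move=> g0 K0 hA A0 x t x0 t0 tT.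
have := hA x 0 t x0 (lexx _) t0 tT; rewrite /dconv A0 mulr0 !subr0 => /le_trans; apply.
by rewrite ler_wpM2l// powR_mono.
Qed.

Section young_weighted.
Variables (T gamma K : R) (A : R -> R -> R).
Hypotheses (T0 : 0 < T) (g12 : 1/2 < gamma) (g1 : gamma <= 1) (K0 : 0 <= K).
Hypothesis hA : conv_holder gamma K T A.

Let g0 : 0 < gamma. Proof. by move: g12 => ?; lra. Qed.

Lemma Csew_ge0 : 0 <= Csew (2 * gamma).
Proof.
rewrite /Csew mulr_ge0 ?powR_ge0// addr_ge0//.
by apply: le_trans (Cgrid_ge1 _); [exact: ler01|move: g12 => ?; lra].
Qed.

(** For integrands that do not vanish at 0, without a small factor: it places [Y] in the solution
    space and handles constant integrands. *)
Lemma yconv_holder B z : 0 <= B -> holder gamma B T z ->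
  conv_holder gamma (K * (`|z 0| + (1 + Csew (2 * gamma)) * B * T `^ gamma)) T (yconv T A z).
Proof.
move=> B0 hz x s t x0 s0 st tT.
have h1 := yconv_germ T0 g12 g1 K0 hA x0 (lexx T) B0 hz s0 st tT.
have h2 := hA x0 s0 st tT.
have sT := le_trans st tT.
have h3 : `|z s| <= `|z 0| + B * T `^ gamma.
  have -> : z s = z 0 + (z s - z 0) by ring.
  apply: (le_trans (ler_normD _ _)); rewrite lerD2l.
  apply: (le_trans (hz _ _ (lexx 0) s0 sT)).
  by rewrite ler_wpM2l// subr0; apply: powR_mono => //; exact: ltW.
have ts : 0 <= t - s by rewrite subr_ge0.
have h4 : (t - s) `^ gamma <= T `^ gamma.
  by apply: powR_mono => //; [exact: ltW|lra].
have p0 := powR_ge0 (t - s) gamma.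
rewrite powR_sqr// in h1.
have -> : dconv (yconv T A z) t s x = (dconv (yconv T A z) t s x - dconv A t s x * z s) +
  dconv A t s x * z s by ring.
apply: (le_trans (ler_normD _ _)).
apply: (le_trans (lerD h1 (lexx _))).
rewrite normrM.
have h5 : `|dconv A t s x| * `|z s| <= K * (t - s) `^ gamma * (`|z 0| + B * T `^ gamma).
  exact: ler_pM.
have C0 := Csew_ge0.
have h6 : Csew (2 * gamma) * (K * B) * ((t - s) `^ gamma * (t - s) `^ gamma) <=
  Csew (2 * gamma) * (K * B) * (T `^ gamma * (t - s) `^ gamma).
  exact: (ler_wpM2l (mulr_ge0 C0 (mulr_ge0 K0 B0)) (ler_wpM2r p0 h4)).
by move: h5 h6; lra.
Qed.

(** In [2 + Csew] the 2 comes from [weighted_sup] and [Csew] from the sewing remainder. Over a long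
    step the increment is bounded by two suprema, each of which carries another factor 2. *)
Definition Cyoung : R := 4 * (2 + Csew (2 * gamma)).

Lemma Cyoung_ge0 : 0 <= Cyoung.
Proof. by rewrite mulr_ge0// addr_ge0// Csew_ge0. Qed.

Section bounds.
Variables (lam B : R) (z : R -> R).
Hypotheses (l1 : 1 <= lam) (B0 : 0 <= B) (z0 : z 0 = 0).
Hypothesis hz : weighted_holder gamma lam B T z.

Let eps := lam^-1 `^ gamma.
Let l0 : 0 < lam. Proof. exact: lt_le_trans l1. Qed.
Let eps0 : 0 <= eps. Proof. exact: powR_ge0. Qed.
Let eps1 : eps <= 1.
Proof.
rewrite /eps -(powRr0 lam^-1); apply: ger_powR; last exact: ltW.
by rewrite invr_gt0 l0 invf_le1.
Qed.

(** Shortness turns the remainder of order [(t - s)^(2 gamma)] into [eps (t - s)^gamma]; the leading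
    term has its [eps] from the supremum of [z]. *)
Lemma young_short x s t : 0 <= x -> 0 <= s -> s <= t -> t <= T -> t - s <= lam^-1 ->
  `|dconv (yconv T A z) t s x| <=
    (2 + Csew (2 * gamma)) * (K * B) * eps * expR (lam * t) * (t - s) `^ gamma.
Proof.
move=> x0 s0 st tT tl.
have t0 := le_trans s0 st.
have hzt := weighted_holder_restrict (ltW l0) B0 tT hz.
have Be0 : 0 <= B * expR (lam * t) by rewrite mulr_ge0// expR_ge0.
have h1 := yconv_germ T0 g12 g1 K0 hA x0 tT Be0 hzt s0 st (lexx _).
have h2 := hA x0 s0 st tT.
have h3 := weighted_sup g0 l0 B0 z0 hz s0 (le_trans st tT).
have ts : 0 <= t - s by rewrite subr_ge0.
have h4 : (t - s) `^ gamma <= eps by apply: powR_mono => //; exact: ltW.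
have p0 := powR_ge0 (t - s) gamma.
have es : expR (lam * s) <= expR (lam * t) by rewrite ler_expR ler_wpM2l// ltW.
rewrite powR_sqr// in h1.
have -> : dconv (yconv T A z) t s x = (dconv (yconv T A z) t s x - dconv A t s x * z s) +
  dconv A t s x * z s by ring.
apply: (le_trans (ler_normD _ _)).
apply: (le_trans (lerD h1 (lexx _))).
rewrite normrM.
have h5 : `|dconv A t s x| * `|z s| <= K * (t - s) `^ gamma * (2 * (B * eps) * expR (lam * t)).
  apply: ler_pM => //; apply: (le_trans h3).
  by rewrite ler_wpM2l// mulr_ge0// mulr_ge0.
have C0 := Csew_ge0.
have h6 : Csew (2 * gamma) * (K * (B * expR (lam * t))) * ((t - s) `^ gamma * (t - s) `^ gamma) <=
  Csew (2 * gamma) * (K * (B * expR (lam * t))) * (eps * (t - s) `^ gamma).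
  exact: (ler_wpM2l (mulr_ge0 C0 (mulr_ge0 K0 Be0)) (ler_wpM2r p0 h4)).
by move: h5 h6; lra.
Qed.

(** The second [eps] is the length of one step to the power [gamma]; damping does not increase the
    value reached before the step. *)
Lemma young_sup x t : 0 <= x -> 0 <= t -> t <= T ->
  `|yconv T A z t x| <= 2 * ((2 + Csew (2 * gamma)) * (K * B) * (eps * eps)) * expR (lam * t).
Proof.
move=> x0.
have C0 := Csew_ge0.
have c0 : 0 <= (2 + Csew (2 * gamma)) * (K * B) * eps by rewrite !mulr_ge0// addr_ge0.
apply: (@block_bound lam _ T (fun t => yconv T A z t x)) => //.
- by rewrite mulrA mulr_ge0.
- exact: yconv0.
move=> s {}t s0 st tT tl.
have h := young_short x0 s0 st tT tl.
have -> : yconv T A z t x = damp x t s * yconv T A z s x + dconv (yconv T A z) t s x.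
  by rewrite /dconv; ring.
apply: (le_trans (ler_normD _ _)); apply: lerD; first exact: damp_norm_le.
apply: (le_trans h).
rewrite [_ * (eps * eps)]mulrA [leRHS]mulrAC ler_wpM2l//; first by rewrite mulr_ge0// expR_ge0.
by apply: powR_mono => //; [exact: ltW|rewrite subr_ge0].
Qed.

(** For [t - s <= 1/lam] the plain increment is the convolutional one minus [(1 - damp)] times a
    value, which costs [x^gamma]. For longer steps two suprema of order [eps^2] are enough, because
    [eps <= (t - s)^gamma]. *)
Lemma young_weighted_incr x s t : 0 <= x -> 0 <= s -> s <= t -> t <= T ->
  `|yconv T A z t x - yconv T A z s x| <=
    Cyoung * (K * B) * eps * expR (lam * t) * (t - s) `^ gamma * (1 + x `^ gamma).
Proof.
move=> x0 s0 st tT.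
have t0 := le_trans s0 st.
have C0 := Csew_ge0.
have c0 : 0 <= (2 + Csew (2 * gamma)) * (K * B) by rewrite !mulr_ge0// addr_ge0.
have h1 := young_sup x0 t0 tT.
have h2 := young_sup x0 s0 (le_trans st tT).
have es : expR (lam * s) <= expR (lam * t) by rewrite ler_expR ler_wpM2l// ltW.
have e0 := expR_ge0 (lam * t).
have ts : 0 <= t - s by rewrite subr_ge0.
have p0 := powR_ge0 (t - s) gamma.
have q0 := powR_ge0 x gamma.
have {}h2 : `|yconv T A z s x| <= 2 * ((2 + Csew (2 * gamma)) * (K * B) * (eps * eps)) * expR (lam * t).
  by apply: (le_trans h2); rewrite ler_wpM2l// mulr_ge0// !mulr_ge0// addr_ge0.
set c := (2 + Csew (2 * gamma)) * (K * B) in c0 h1 h2.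
have -> : Cyoung * (K * B) = 4 * c by rewrite /c /Cyoung; ring.
have ee : eps * eps <= eps by rewrite ler_piMr.
have ce0 : 0 <= c * expR (lam * t) by rewrite mulr_ge0.
have [tl|tl] := leP (t - s) lam^-1; last first.
  apply: (le_trans (ler_normB _ _)).
  have h4 : eps <= (t - s) `^ gamma by apply: powR_mono; rewrite ?ltW ?invr_gt0.
  have h5 : eps * eps <= eps * (t - s) `^ gamma by rewrite ler_wpM2l.
  have h6 : c * expR (lam * t) * (eps * eps) <= c * expR (lam * t) * (eps * (t - s) `^ gamma).
    by rewrite ler_wpM2l.
  have h7 : 0 <= c * expR (lam * t) * (eps * (t - s) `^ gamma) * x `^ gamma.
    exact: (mulr_ge0 (mulr_ge0 ce0 (mulr_ge0 eps0 p0)) q0).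
  by move: h1 h2 h6 h7; lra.
have h3 := young_short x0 s0 st tT tl; rewrite -/c in h3.
have -> : yconv T A z t x - yconv T A z s x = dconv (yconv T A z) t s x
   - (1 - damp x t s) * yconv T A z s x by rewrite /dconv; ring.
apply: (le_trans (ler_normB _ _)).
have h4 : `|(1 - damp x t s) * yconv T A z s x| <=
    x `^ gamma * (t - s) `^ gamma * (2 * (c * eps) * expR (lam * t)).
  rewrite normrM; apply: ler_pM => //.
    by rewrite ger0_norm ?one_damp_ge0//; apply: one_damp_powR => //; rewrite g0 g1.
  apply: (le_trans h2); rewrite ler_wpM2r// ler_wpM2l// ler_wpM2l//.
have h5 : 0 <= c * eps * expR (lam * t) * (t - s) `^ gamma.
  exact: (mulr_ge0 (mulr_ge0 (mulr_ge0 c0 eps0) e0) p0).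
have h6 := mulr_ge0 h5 q0.
by move: h3 h4 h5 h6; lra.
Qed.

End bounds.

(** Since [yconv] is defined by [limn], additivity is obtained where the sums are known to converge,
    hence the Hölder hypotheses. *)
Lemma yconvB B B' z z' x t : 0 <= B -> 0 <= B' -> holder gamma B T z -> holder gamma B' T z' ->
  0 <= x -> 0 <= t -> t <= T ->
  yconv T A (fun u => z u - z' u) t x = yconv T A z t x - yconv T A z' t x.
Proof.
move=> B0 B'0 hz hz' x0 t0 tT.
have c1 := yconv_cvg T0 g12 g1 K0 hA x0 (lexx T) B0 hz t0 tT.
have c2 := yconv_cvg T0 g12 g1 K0 hA x0 (lexx T) B'0 hz' t0 tT.
apply/cvg_lim => //.
have -> : rsum T x (ygerm A (fun u => z u - z' u) x) t =
    (fun k => rsum T x (ygerm A z x) t k - rsum T x (ygerm A z' x) t k).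
  apply/funext => k; rewrite /rsum -psumB; congr (psum _ _ _ _ _ _ _).
  by apply/funext => v; apply/funext => u; rewrite /ygerm mulrBr.
exact: cvgB.
Qed.

Lemma yconv_ext z z' x t : 0 <= t -> t <= T ->
  (forall u, 0 <= u -> u <= T -> z u = z' u) -> yconv T A z t x = yconv T A z' t x.
Proof.
move=> t0 tT e; rewrite /yconv /sew.
suff -> : rsum T x (ygerm A z x) t = rsum T x (ygerm A z' x) t by [].
apply/funext => k; rewrite /rsum /psum big_nat [RHS]big_nat; apply: eq_bigr => j /andP[_ jt].
rewrite /ygerm e//; first exact: pt_ge0.
have jj := pt_le T0 k (ltnW jt).
have /andP[h _] := gidxP T0 k t0.
by rewrite (le_trans jj)// (le_trans h).
Qed.

End young_weighted.
End weighted.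

(* The integral of a nonnegative function is a supremum over the simple functions below it. *)
Lemma ge0_le_integral_sup d (T : measurableType d) (R : realType) (mu : measure T R)
    (D : set T) (f g : T -> \bar R) :
  (forall x, D x -> (0 <= f x)%E) -> (forall x, D x -> (f x <= g x)%E) ->
  (\int[mu]_(x in D) f x <= \int[mu]_(x in D) g x)%E.
Proof.
move=> f0 fg.
have g0 x : D x -> (0 <= g x)%E by move=> Dx; apply: le_trans (f0 _ Dx) (fg _ Dx).
rewrite !ge0_integralE//; apply: le_ereal_sup => _ [h hf <-]; exists h => // x.
apply: (le_trans (hf x)); rewrite /patch; case: ifP => //.
by move=> /set_mem /fg.
Qed.

(** * The space of integrable densities *)

Section row_norm.
Context {R : realType}.

Lemma coord_le_norm k (v : 'rV[R]_k) j : `|v 0 j| <= `|v|.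
Proof.
rewrite [leRHS]mx_normrE.
exact: (le_bigmax _ (fun i => `|v i.1 i.2|) (0, j)).
Qed.

Lemma norm_le_coord k (v : 'rV[R]_k) c : 0 <= c -> (forall j, `|v 0 j| <= c) -> `|v| <= c.
Proof.
move=> c0 h; rewrite [leLHS]mx_normrE; apply: bigmax_le => // -[i j] _ /=.
by rewrite ord1.
Qed.

Lemma measurable_row_norm d (T : measurableType d) (D : set T) k (g : T -> 'rV[R]_k) :
  (forall j, measurable_fun D (fun w => g w 0 j)) -> measurable_fun D (fun w => `|g w|).
Proof.
move=> h.
rewrite (_ : (fun w => `|g w|) = (fun w => \big[Num.max/0]_j `|g w 0 j|)).
  elim: (index_enum _) => [|j s IH].
    rewrite (_ : (fun w => _) = cst 0); first exact: measurable_cst.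
    by apply/funext => w; rewrite big_nil.
  rewrite (_ : (fun w => _) = (fun w => Num.max `|g w 0 j| (\big[Num.max/0]_(i <- s) `|g w 0 i|))).
    by apply: measurable_maxr => //; apply: measurableT_comp => //; exact: h.
  by apply/funext => w; rewrite big_cons.
apply/funext => w; apply/le_anti/andP; split.
  by apply: norm_le_coord => [|j]; [exact: bigmax_ge_id|exact: le_bigmax].
by apply: bigmax_le => // j _; exact: coord_le_norm.
Qed.
End row_norm.

Section weights.
Context {R : realType}.
Variables (phi : R -> R) (gamma : R).
Local Notation Pos := (`]0%R, +oo[%classic : set R).
Local Notation NN := (`[0%R, +oo[%classic : set R).
Local Notation mu := (@lebesgue_measure R).

Definition mrow k (g : R -> 'rV[R]_k) := forall j, measurable_fun NN (fun xi => g xi 0 j).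

Lemma NphiE k (g : R -> 'rV[R]_k) :
  Nphi phi gamma g = (\int[mu]_(xi in NN) (`|phi xi| * (1 + xi `^ gamma) * `|g xi|)%:E)%E.
Proof. by []. Qed.

Lemma weight_ge0 (xi : R) : 0 <= `|phi xi| * (1 + xi `^ gamma).
Proof. by rewrite mulr_ge0// addr_ge0// powR_ge0. Qed.

Lemma Nphi_ge0 k (g : R -> 'rV[R]_k) : (0 <= Nphi phi gamma g)%E.
Proof. by apply: integral_ge0 => xi _; rewrite lee_fin mulr_ge0// weight_ge0. Qed.

Lemma Nphi_mono k l (g : R -> 'rV[R]_k) (g' : R -> 'rV[R]_l) :
  (forall xi, 0 <= xi -> `|g xi| <= `|g' xi|) -> (Nphi phi gamma g <= Nphi phi gamma g')%E.
Proof.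
move=> h; apply: ge0_le_integral_sup => xi /=; rewrite in_itv/= andbT => xi0.
  by rewrite lee_fin mulr_ge0// weight_ge0.
by rewrite lee_fin ler_wpM2l// ?weight_ge0// h.
Qed.

Lemma Nphi_ext k (g g' : R -> 'rV[R]_k) :
  (forall xi, 0 <= xi -> g xi = g' xi) -> Nphi phi gamma g = Nphi phi gamma g'.
Proof. by move=> h; apply/le_anti/andP; split; apply: Nphi_mono => xi xi0; rewrite h. Qed.

Hypothesis mphi : measurable_fun Pos phi.

Let mNN : measurable NN. Proof. exact: measurable_itv. Qed.

Lemma measurable_phi : measurable_fun NN phi.
Proof. by apply/measurable_fun_itv_obnd_cbndP. Qed.

Lemma measurable_weight : measurable_fun NN (fun xi => `|phi xi| * (1 + xi `^ gamma)).
Proof.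
apply: measurable_funM; first by apply: measurableT_comp => //; exact: measurable_phi.
apply: measurable_funD; first exact: measurable_cst.
by apply: measurable_funTS; exact: measurable_powR.
Qed.

Lemma measurable_weighted_norm k (g : R -> 'rV[R]_k) : mrow g ->
  measurable_fun NN (fun xi => (`|phi xi| * (1 + xi `^ gamma) * `|g xi|)%:E).
Proof.
move=> mg; apply/measurable_EFinP; apply: measurable_funM; first exact: measurable_weight.
exact: measurable_row_norm.
Qed.

Lemma Nphi_triangle k l1 l2 (g1 : R -> 'rV[R]_l1) (g2 : R -> 'rV[R]_l2) (h : R -> 'rV[R]_k) :
  mrow g1 -> mrow g2 -> (forall xi, 0 <= xi -> `|h xi| <= `|g1 xi| + `|g2 xi|) ->
  (Nphi phi gamma h <= Nphi phi gamma g1 + Nphi phi gamma g2)%E.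
Proof.
move=> m1 m2 hh; rewrite !NphiE -ge0_integralD//=.
- apply: ge0_le_integral_sup => xi /=; rewrite in_itv/= andbT => xi0.
    by rewrite lee_fin mulr_ge0// weight_ge0.
  by rewrite -EFinD lee_fin -mulrDr ler_wpM2l// ?weight_ge0// hh.
- by move=> xi _; rewrite lee_fin mulr_ge0// weight_ge0.
- exact: measurable_weighted_norm.
- by move=> xi _; rewrite lee_fin mulr_ge0// weight_ge0.
- exact: measurable_weighted_norm.
Qed.

Hypothesis fphi : (\int[mu]_(xi in Pos) (`|phi xi| * (1 + xi `^ gamma))%:E < +oo)%E.

Definition Mphi : R := fine (\int[mu]_(xi in NN) (`|phi xi| * (1 + xi `^ gamma))%:E)%E.

(** The hypothesis on [phi] and [phi_int] use the open half-line, [Nphi] the closed one; the point 0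
    has measure zero. *)
Let integral_Pos (f : R -> R) : measurable_fun NN f ->
  (\int[mu]_(xi in Pos) (f xi)%:E = \int[mu]_(xi in NN) (f xi)%:E)%E.
Proof.
move=> mf; apply: integral_itv_obnd_cbnd.
by apply/emeasurable_fun_itv_obnd_cbndP; apply/measurable_EFinP.
Qed.

Lemma MphiE : (\int[mu]_(xi in NN) (`|phi xi| * (1 + xi `^ gamma))%:E = Mphi%:E)%E.
Proof.
rewrite /Mphi fineK// ge0_fin_numE; last first.
  by apply: integral_ge0 => xi _; rewrite lee_fin weight_ge0.
by rewrite -integral_Pos//; exact: measurable_weight.
Qed.

Lemma Mphi_ge0 : 0 <= Mphi.
Proof.
by rewrite fine_ge0//; apply: integral_ge0 => xi _; rewrite lee_fin weight_ge0.
Qed.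

Lemma integral_weight_scale C : 0 <= C ->
  (\int[mu]_(xi in NN) (C * (`|phi xi| * (1 + xi `^ gamma)))%:E = (C * Mphi)%:E)%E.
Proof.
move=> C0; rewrite EFinM -MphiE -ge0_integralZl_EFin//.
- by move=> xi _; rewrite lee_fin weight_ge0.
- by apply/measurable_EFinP; exact: measurable_weight.
Qed.

Lemma Nphi_bound k (g : R -> 'rV[R]_k) C : 0 <= C ->
  (forall xi, 0 <= xi -> `|g xi| <= C) -> (Nphi phi gamma g <= (C * Mphi)%:E)%E.
Proof.
move=> C0 h; rewrite -integral_weight_scale//.
apply: ge0_le_integral_sup => xi /=; rewrite in_itv/= andbT => xi0.
  by rewrite lee_fin mulr_ge0// weight_ge0.
by rewrite lee_fin mulrC ler_wpM2r// ?weight_ge0// h.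
Qed.

Lemma inL_bound k (g : R -> 'rV[R]_k) C : mrow g ->
  (forall xi, 0 <= xi -> `|g xi| <= C) -> inL phi gamma g.
Proof.
move=> mg h; split => //.
have C0 : 0 <= C by have := h 0 (lexx _); apply: le_trans.
by apply: (le_lt_trans (Nphi_bound C0 h)); rewrite ltry.
Qed.

(** The growth allowed in [xi] is that of plain increments; [Mphi] already contains this factor. *)
Lemma phi_int_bound k (y : R -> 'rV[R]_k) j C : 0 <= C -> mrow y ->
  (forall xi, 0 <= xi -> `|y xi 0 j| <= C * (1 + xi `^ gamma)) ->
  `|phi_int phi y 0 j| <= C * Mphi.
Proof.
move=> C0 my h; rewrite mxE.
have mP : measurable_fun NN (fun xi => phi xi * y xi 0 j).
  by apply: measurable_funM; [exact: measurable_phi|exact: my].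
rewrite integral_Pos//.
have hle : (`|\int[mu]_(xi in NN) (phi xi * y xi 0 j)%:E| <= (C * Mphi)%:E)%E.
  apply: (le_trans (le_abse_integral _ _ _)) => //; first by apply/measurable_EFinP.
  rewrite -integral_weight_scale//.
  apply: ge0_le_integral_sup => xi /=; rewrite in_itv/= andbT => xi0; first by rewrite lee_fin.
  rewrite lee_fin normrM mulrCA ler_wpM2l//; exact: h.
have hfin : (\int[mu]_(xi in NN) (phi xi * y xi 0 j)%:E)%E \is a fin_num.
  by rewrite -abse_fin_num ge0_fin_numE// (le_lt_trans hle)// ltry.
by rewrite -lee_fin -fine_abse// fineK// abse_fin_num.
Qed.

Lemma phi_int_integrable k (y : R -> 'rV[R]_k) j : inL phi gamma y ->
  mu.-integrable Pos (fun xi => (phi xi * y xi 0 j)%:E).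
Proof.
move=> [my fy].
have sPN : Pos `<=` NN by move=> xi /=; rewrite !in_itv/= !andbT; exact: ltW.
apply: (@integrableS _ (measurableTypeR R) R mu NN Pos) => //.
apply/integrableP; split.
  by apply/measurable_EFinP; apply: measurable_funM; [exact: measurable_phi|exact: my].
apply: le_lt_trans fy; apply: ge0_le_integral_sup => xi /=; rewrite in_itv/= andbT => xi0.
  by rewrite lee_fin.
rewrite lee_fin normrM; apply: ler_pM => //; last exact: coord_le_norm.
by rewrite ler_peMr// lerDl powR_ge0.
Qed.

Lemma phi_intB k (y y' : R -> 'rV[R]_k) : inL phi gamma y -> inL phi gamma y' ->
  phi_int phi (fun xi => y xi - y' xi) = phi_int phi y - phi_int phi y'.
Proof.
move=> Ly Ly'; apply/rowP => j; rewrite !mxE.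
have i1 := phi_int_integrable j Ly; have i2 := phi_int_integrable j Ly'.
have mP : measurable Pos by exact: measurable_itv.
rewrite -fineB; [|exact: integrable_fin_num i1|exact: integrable_fin_num i2].
rewrite -integralB//; congr fine; apply: eq_integral => xi _ /=.
by rewrite !mxE mulrBr EFinB.
Qed.

(** As [1 + xi^gamma >= 1], the weighted norm dominates the integral against [phi]; the feedback
    term therefore depends only on the class of [y]. *)
Lemma Leq_phi_int k (y y' : R -> 'rV[R]_k) : inL phi gamma y -> inL phi gamma y' ->
  Leq phi gamma y y' -> phi_int phi y = phi_int phi y'.
Proof.
move=> Ly Ly' e; apply/subr0_eq; rewrite -phi_intB//.
have mPN : mrow (fun xi => y xi - y' xi).
  move=> j; rewrite (_ : (fun _ => _) = (fun xi => y xi 0 j - y' xi 0 j)); last first.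
    by apply/funext => xi; rewrite !mxE.
  by apply: measurable_funB; [apply: Ly.1|apply: Ly'.1].
apply/rowP => j; rewrite [RHS]mxE mxE.
have mP : measurable_fun NN (fun xi => phi xi * (y xi - y' xi) 0 j).
  by apply: measurable_funM; [exact: measurable_phi|exact: mPN].
rewrite integral_Pos//.
suff -> : (\int[mu]_(xi in NN) (phi xi * (y xi - y' xi) 0 j)%:E = 0)%E by [].
apply/eqP; rewrite -abse_eq0 eq_le abse_ge0 andbT -e.
apply: (le_trans (le_abse_integral _ _ _)) => //; first by apply/measurable_EFinP.
apply: ge0_le_integral_sup => xi /=; rewrite in_itv/= andbT => xi0; first by rewrite lee_fin.
rewrite lee_fin normrM; apply: ler_pM => //; last exact: coord_le_norm.
by rewrite ler_peMr// lerDl powR_ge0.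
Qed.

(** The factor [1 - damp] is not small uniformly in [xi], and the power [xi^gamma] is already spent
    in the weight. Its weighted integral still tends to 0 with [dl], by dominated convergence and
    without a rate; continuity in the weighted norm rests on this. *)
Definition damp_mod (dl : R) : \bar R :=
  (\int[mu]_(xi in NN) (`|phi xi| * (1 + xi `^ gamma) * (1 - damp xi dl 0))%:E)%E.

Lemma damp_mod_small e : 0 < e -> exists2 dl : R, 0 < dl & (damp_mod dl < e%:E)%E.
Proof.
move=> e0.
pose f (n : nat) xi := (`|phi xi| * (1 + xi `^ gamma) * (1 - damp xi (n.+1%:R)^-1 0))%:E.
have mw := measurable_weight.
have cv : (fun n => \int[mu]_(xi in NN) f n xi)%E @ \oo --> (\int[mu]_(xi in NN) cst 0%E xi)%E.
  apply: (@dominated_cvg _ (measurableTypeR R) R mu NN mNN f (cst 0%E) (fun xi => (`|phi xi| * (1 + xi `^ gamma))%:E)) => //.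
  - move=> n; apply/measurable_EFinP; apply: measurable_funM => //.
    apply: measurable_funB; first exact: measurable_cst.
    apply: measurableT_comp; first exact: measurable_expR.
    apply: measurable_funN; apply: measurable_funM; last exact: measurable_cst.
    exact: measurable_id.
  - move=> xi; rewrite /= in_itv/= andbT => xi0; rewrite /f.
    apply/cvg_EFin; first by near=> n.
    rewrite -[X in _ --> X](mulr0 (`|phi xi| * (1 + xi `^ gamma))).
    apply: cvgM; first exact: cvg_cst.
    apply: (@squeeze_cvgr _ _ _ _ (cst 0) (fun n => xi * (n.+1%:R)^-1)).
    + near=> n; have i0 : 0 <= (n.+1%:R)^-1 :> R by rewrite invr_ge0.
      rewrite /= one_damp_ge0//=.
      by have := one_damp_le xi (n.+1%:R)^-1 0; rewrite subr0.
    + exact: cvg_cst.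
    + rewrite -[X in _ --> X](mulr0 xi); apply: cvgM; first exact: cvg_cst.
      exact: cvg_harmonic.
  - apply/integrableP; split; first by apply/measurable_EFinP.
    rewrite (_ : (fun xi => _) = (fun xi => (`|phi xi| * (1 + xi `^ gamma))%:E)).
      by rewrite MphiE ltry.
    by apply/funext => xi /=; rewrite ger0_norm// weight_ge0.
  - move=> n xi; rewrite /= in_itv/= andbT => xi0; rewrite lee_fin.
    have d0 : 0 <= 1 - damp xi (n.+1%:R)^-1 0 by apply: one_damp_ge0; rewrite ?invr_ge0.
    rewrite ger0_norm ?mulr_ge0 ?weight_ge0//; last by rewrite addr_ge0// powR_ge0.
    by rewrite ler_piMr ?weight_ge0// gerBl ltW// damp_gt0.
rewrite integral0 in cv.
have /fine_cvgP[[N1 _ h1] /cvgrPdist_lt/(_ e e0)[N2 _ h2]] := cv.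
exists ((maxn N1 N2).+1%:R^-1); first by rewrite invr_gt0.
have {}h1 := h1 (maxn N1 N2) (leq_maxl _ _).
have {h2} := h2 (maxn N1 N2) (leq_maxr _ _).
rewrite /= sub0r normrN => h2.
suff -> : damp_mod (maxn N1 N2).+1%:R^-1 =
    (fine (\int[mu]_(xi in NN) f (maxn N1 N2) xi))%:E.
  by rewrite lte_fin; apply: le_lt_trans h2; exact: ler_norm.
by rewrite fineK.
Unshelve. all: by end_near.
Qed.

End weights.

(** * The fixed point *)

Section lipschitz.
Context {R : realType} {k : nat}.
Implicit Types (f : 'rV[R]_k -> R) (x y d : 'rV[R]_k) (a : 'I_k).

Local Notation e a := (delta_mx 0 a : 'rV[R]_k).

Lemma quotient_line f x v (tau : R) :
  (fun h => h^-1 *: (((fun s => f (x + s *: v)) \o shift tau) (h *: (1 : R)) - f (x + tau *: v))) =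
  (fun h => h^-1 *: ((f \o shift (x + tau *: v)) (h *: v) - f (x + tau *: v))).
Proof.
apply/funext => h /=; congr (_ *: (f _ - _)).
by rewrite scalerDl [h *: 1]mulr1 addrCA addrA addrC.
Qed.

Lemma is_derive_line f x v (tau : R) : derivable f (x + tau *: v) v ->
  is_derive tau 1 (fun s => f (x + s *: v)) ('D_v f (x + tau *: v)).
Proof.
move=> df; split; first by rewrite /derivable quotient_line.
by rewrite /derive quotient_line.
Qed.

Lemma line_lipschitz f v M : (forall x, derivable f x v) -> (forall x, `|'D_v f x| <= M) ->
  forall x (h : R), `|f (x + h *: v) - f x| <= M * `|h|.
Proof.
move=> df hM x h.
have der (s : R) : is_derive s (1 : R) (fun s => f (x + s *: v)) ('D_v f (x + s *: v)).
  exact: is_derive_line.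
have cont (u w : R) : {within `[u, w], continuous (fun s => f (x + s *: v))}.
  apply: continuous_subspaceT => s.
  apply: differentiable_continuous; apply/derivable1_diffP.
  by have [] := der s.
have key u w : u < w -> `|f (x + w *: v) - f (x + u *: v)| <= M * `|w - u|.
  move=> uw; have [c _ ->] := MVT uw (fun s _ => der s) (cont u w).
  by rewrite normrM ler_wpM2r.
have x0 : f x = f (x + (0 : R) *: v) by rewrite scale0r addr0.
have [h0|h0|->] := ltgtP h 0.
- by rewrite x0 distrC (le_trans (key _ _ h0))// sub0r normrN.
- by rewrite x0 (le_trans (key _ _ h0))// subr0.
- by rewrite -x0 subrr !normr0 mulr0.
Qed.

(** Only derivatives along the axes are given, so the segment is replaced by a path that changes one
    coordinate at a time, which costs the factor [k]. *)
Lemma partial_lipschitz f M : 0 <= M ->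
  (forall a x, derivable f x (e a)) -> (forall a x, `|'D_(e a) f x| <= M) ->
  forall x y, `|f x - f y| <= k%:R * M * `|x - y|.
Proof.
move=> M0 df hM x y.
pose d := x - y.
suff H (s : seq 'I_k) : `|f (y + \sum_(a <- s) d 0 a *: e a) - f y| <= (size s)%:R * M * `|d|.
  have := H (index_enum 'I_k); rewrite -row_sum_delta /d [y + _]addrC subrK.
  by rewrite /index_enum -enumT size_enum_ord.
elim: s => [|a s IH].
  by rewrite big_nil addr0 subrr normr0 !mul0r.
rewrite big_cons addrCA [X in f X - _]addrC.
set z := y + _ in IH *.
have -> : f (z + d 0 a *: e a) - f y = (f (z + d 0 a *: e a) - f z) + (f z - f y) by ring.
apply: (le_trans (ler_normD _ _)).
have h1 := line_lipschitz (df a) (hM a) z (d 0 a).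
have h2 : M * `|d 0 a| <= M * `|d| by rewrite ler_wpM2l// coord_le_norm.
by rewrite /= -natr1; move: h1 h2 IH; lra.
Qed.

Lemma derive_shift f d x v : derivable f (x + d) v ->
  derivable (fun z => f (z + d)) x v /\ 'D_v (fun z => f (z + d)) x = 'D_v f (x + d).
Proof.
have e : (fun h => h^-1 *: (((fun z => f (z + d)) \o shift x) (h *: v) - f (x + d))) =
   (fun h => h^-1 *: ((f \o shift (x + d)) (h *: v) - f (x + d))).
  by apply/funext => h /=; rewrite addrA.
by rewrite /derivable /derive e.
Qed.

Lemma fin_bound (I : finType) (P : I -> R -> Prop) :
  (forall i c c', P i c -> c <= c' -> P i c') -> (forall i, exists c, P i c) ->
  exists2 c, 0 <= c & forall i, P i c.
Proof.
move=> mono /choice[g hg]; exists (\sum_i `|g i|); first exact: sumr_ge0.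
move=> i; apply: mono (hg i) _; rewrite (bigD1 i)//=.
by apply: (le_trans (ler_norm _)); rewrite lerDl sumr_ge0.
Qed.

(** With [d = x - y], the map [z |-> f (z + d) - f z] has partial derivatives of size [|d|], by the
    second derivatives of [f]. Its variation from [y'] to [y] gives the product term; replacing
    [y' + d] by [x'] gives the linear one. *)
Lemma C2b_four_point f : C2b f -> exists2 L, 0 <= L &
  (forall x y, `|f x - f y| <= L * `|x - y|) /\
  (forall x y x' y', `|f x - f y - (f x' - f y')| <=
     L * `|(x - y) - (x' - y')| + L * `|x - y| * `|y - y'|).
Proof.
move=> [_ [_ C2]].
have [M1 M10 h1] : exists2 M, 0 <= M & forall a x, `|'D_(e a) f x| <= M.
  apply: fin_bound => [a c c' h cc x|a]; first exact: le_trans cc.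
  by have [_ [_ []]] := C2 a.
have [M2 M20 h2] : exists2 M, 0 <= M &
    forall p : 'I_k * 'I_k, forall x, `|'D_(e p.2) (fun z => 'D_(e p.1) f z) x| <= M.
  apply: fin_bound => [p c c' h cc x|[a b]]; first exact: le_trans cc.
  by have [_ [_ [_ /(_ b)[_ []]]]] := C2 a.
have lip : forall x y, `|f x - f y| <= k%:R * M1 * `|x - y|.
  by apply: partial_lipschitz => // a; have [] := C2 a.
have lip1 a : forall x y, `|'D_(e a) f x - 'D_(e a) f y| <= k%:R * M2 * `|x - y|.
  apply: (@partial_lipschitz (fun z => 'D_(e a) f z)) => // [b|b x].
    by have [_ [_ [_ /(_ b)[]]]] := C2 a.
  exact: (h2 (a, b)).
have lip2 d : forall x y, `|(f (x + d) - f x) - (f (y + d) - f y)| <=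
    k%:R * (k%:R * M2 * `|d|) * `|x - y|.
  have der a x : is_derive x (e a) (fun z => f (z + d) - f z) ('D_(e a) f (x + d) - 'D_(e a) f x).
    have dfa : forall x, derivable f x (e a) by have [] := C2 a.
    have [d1 d2] := derive_shift (dfa (x + d)).
    apply: is_deriveB; first by rewrite -d2; apply: DeriveDef.
    exact: DeriveDef.
  apply: (@partial_lipschitz (fun z => f (z + d) - f z)) => [|a x|a x].
  - by rewrite !mulr_ge0.
  - by have [] := der a x.
  - have [_ ->] := der a x.
    by apply: (le_trans (lip1 _ _ _)); rewrite [x + d]addrC addrK.
exists (k%:R * M1 + k%:R * (k%:R * M2)); first by rewrite addr_ge0// !mulr_ge0.
have k0 : 0 <= k%:R * (k%:R * M2) by rewrite !mulr_ge0.
have k1 : 0 <= k%:R * M1 by rewrite !mulr_ge0.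
split=> [x y|x y x' y'].
  apply: (le_trans (lip _ _)); rewrite ler_wpM2r// lerDl//.
have l2 := lip2 (x - y) y y'.
have l1 := lip (y' + (x - y)) (y' + (x' - y')).
rewrite [y + _]addrC subrK in l2.
rewrite [y' + (x' - y')]addrC subrK in l1.
have e1 : y' + (x - y) - x' = (x - y) - (x' - y') by apply/rowP => j; rewrite !mxE; ring.
rewrite e1 in l1.
have -> : f x - f y - (f x' - f y') =
  (f x - f y - (f (y' + (x - y)) - f y')) + (f (y' + (x - y)) - f x') by ring.
apply: (le_trans (ler_normD _ _)); apply: (le_trans (lerD l2 l1)).
have p1 := mulr_ge0 k0 (normr_ge0 (x - y - (x' - y'))).
have p2 := mulr_ge0 (mulr_ge0 k1 (normr_ge0 (x - y))) (normr_ge0 (y - y')).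
by move: p1 p2; lra.
Qed.

End lipschitz.

(** * Picard iteration for an abstract Volterra operator *)

Section picard.
Context {R : realType}.
Implicit Types (gamma lam B : R).

Lemma subrACA (E : zmodType) (x y z w : E) : x - y - (z - w) = x - z - (y - w).
Proof. by rewrite !opprB !addrA [x - y + w]addrAC [x - z + w]addrAC addrAC. Qed.

(** The codomain is general because rows (solutions) and matrices (integrands) both occur. With
    [lam = 0] it is the plain Hölder condition. *)
Definition whold (E : normedZmodType R) T gamma lam B (a : R -> E) :=
  forall s t, 0 <= s -> s <= t -> t <= T -> `|a t - a s| <= B * expR (lam * t) * (t - s) `^ gamma.

Lemma whold_mono (E : normedZmodType R) T gamma lam lam' B B' (a : R -> E) :
  0 <= B -> lam <= lam' -> B <= B' -> whold T gamma lam B a -> whold T gamma lam' B' a.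
Proof.
move=> B0 ll BB h s t s0 st tT; apply: (le_trans (h s t s0 st tT)).
rewrite ler_wpM2r ?powR_ge0//; apply: ler_pM => //.
by rewrite ler_expR ler_wpM2r// (le_trans s0).
Qed.

Lemma whold_restrict (E : normedZmodType R) T gamma lam B (a : R -> E) :
  0 <= B -> 0 <= lam -> whold T gamma lam B a -> whold T gamma 0 (B * expR (lam * T)) a.
Proof.
move=> B0 l0 h s t s0 st tT; apply: (le_trans (h s t s0 st tT)).
by rewrite mul0r expR0 mulr1 ler_wpM2r ?powR_ge0// ler_wpM2l// ler_expR ler_wpM2l.
Qed.

Lemma whold_add (E : normedZmodType R) T gamma lam B B' (a b : R -> E) :
  whold T gamma lam B a -> whold T gamma lam B' b ->
  whold T gamma lam (B + B') (fun t => a t + b t).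
Proof.
move=> ha hb s t s0 st tT; rewrite opprD addrACA.
apply: (le_trans (ler_normD _ _)); rewrite !mulrDl.
by apply: lerD; [exact: ha|exact: hb].
Qed.

Lemma whold_sub (E : normedZmodType R) T gamma lam B B' (a b : R -> E) :
  whold T gamma lam B a -> whold T gamma lam B' b ->
  whold T gamma lam (B + B') (fun t => a t - b t).
Proof.
move=> ha hb; apply: whold_add => // s t s0 st tT.
by rewrite -opprD normrN; exact: hb.
Qed.

Lemma whold_ext (E : normedZmodType R) T gamma lam B (a b : R -> E) :
  (forall t, 0 <= t -> t <= T -> a t = b t) -> whold T gamma lam B a -> whold T gamma lam B b.
Proof.
move=> e h s t s0 st tT; rewrite -!e ?(le_trans s0 st) ?(le_trans st tT)//.
exact: h.
Qed.

Lemma whold_cst (E : normedZmodType R) T gamma lam B (c : E) :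
  0 <= B -> whold T gamma lam B (fun=> c).
Proof. by move=> B0 s t _ _ _; rewrite subrr normr0 !mulr_ge0 ?expR_ge0 ?powR_ge0. Qed.

Lemma whold_sup (E : normedZmodType R) T gamma lam B (a : R -> E) :
  0 < gamma -> 0 < lam -> 0 <= B -> a 0 = 0 -> whold T gamma lam B a ->
  forall t, 0 <= t -> t <= T -> `|a t| <= 2 * (B * lam^-1 `^ gamma) * expR (lam * t).
Proof.
move=> g0 l0 B0 a0 ha t t0 tT; rewrite -[ `|a t|]normr_id.
apply: (@block_bound _ lam _ T (fun t => `|a t|)) => //.
- by rewrite mulr_ge0// powR_ge0.
- by rewrite a0 normr0.
move=> s {t0 tT}t s0 st tT tl; rewrite !normr_id.
have -> : a t = a s + (a t - a s) by rewrite addrC subrK.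
apply: (le_trans (ler_normD _ _)); rewrite lerD2l.
apply: (le_trans (ha _ _ s0 st tT)).
rewrite mulrAC ler_wpM2r ?expR_ge0// ler_wpM2l//.
by apply: powR_mono; [exact: ltW|rewrite subr_ge0|].
Qed.

Lemma small_weight gamma (dl : R) : 0 < gamma -> 0 < dl ->
  exists lam : R, [/\ 1 <= lam, lam^-1 `^ gamma <= dl & lam^-1 `^ gamma <= 1].
Proof.
move=> g0 d0.
have e0 : 0 < Num.min dl 1 by rewrite lt_min d0 ltr01.
have /cvgrPdist_le/(_ _ e0)[N _ /(_ N (leqnn _))] := mesh_cvg (ltr01 : 0 < (1 : R)) g0.
rewrite sub0r normrN /mesh div1r (ger0_norm (powR_ge0 _ _)) le_min => /andP[h1 h2].
by exists (2 ^+ N); rewrite h1 h2; split => //; rewrite exprn_ege1// ler1n.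
Qed.

Lemma geometric_le0 (x C : R) : (forall n, x <= C * 2^-1 ^+ n) -> x <= 0.
Proof.
move=> h.
have q : `|2^-1 : R| < 1 by rewrite ger0_norm ?invr_ge0// invf_lt1// ltr1n.
have cv : geometric C (2^-1 : R) @ \oo --> (0 : R) by exact: cvg_geometric.
by apply: (ler_cvg_to (cvg_cst x) cv); exists 0%N => // n _; apply: h.
Qed.

Variables (n m : nat) (T gamma L C : R).
Variables (V : (R -> 'M[R]_(n, m)) -> R -> 'rV[R]_m) (sigma : 'rV[R]_m -> 'M[R]_(n, m)).
Variable a0 : 'rV[R]_m.
Hypotheses (T0 : 0 < T) (g0 : 0 < gamma) (L0 : 0 <= L) (C0 : 0 <= C).
Local Notation W := (whold T gamma).
Hypothesis V0 : forall z, V z 0 = 0.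
Hypothesis Vcontract : forall lam B z, 1 <= lam -> 0 <= B -> z 0 = 0 ->
  W lam B z -> W lam (C * lam^-1 `^ gamma * B) (V z).
Hypothesis Vcst : forall c, exists2 B, 0 <= B & W 0 B (V (fun=> c)).
Hypothesis VB : forall lam lam' B B' z z', 0 <= lam -> 0 <= lam' -> 0 <= B -> 0 <= B' ->
  W lam B z -> W lam' B' z' -> forall t, 0 <= t -> t <= T ->
  V (fun u => z u - z' u) t = V z t - V z' t.
Hypothesis sigma_lip : forall x y, `|sigma x - sigma y| <= L * `|x - y|.
Hypothesis sigma_four : forall x y x' y', `|sigma x - sigma y - (sigma x' - sigma y')| <=
     L * `|(x - y) - (x' - y')| + L * `|x - y| * `|y - y'|.

(** All that is used of [V] is that it vanishes at 0, gains [lam^(- gamma)] on integrands vanishing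
    at 0, maps constants to Hölder paths and respects differences. *)
Definition Gam (a : R -> 'rV[R]_m) (t : R) := a0 + V (fun u => sigma (a u)) t.

Lemma sigma_whold lam B a : W lam B a -> W lam (L * B) (fun u => sigma (a u)).
Proof.
move=> h s t s0 st tT; apply: (le_trans (sigma_lip _ _)).
by rewrite -!mulrA ler_wpM2l// mulrA h.
Qed.

(** The four-point inequality is applied at times [t] and [s]. Its product term is [|a t - b t|], at
    most [2 B] times the weight, times an increment of [b], at most [M (t - s)^gamma]; hence
    [1 + 2 M]. Equal initial values make the integrand vanish at 0. *)
Lemma Gam_diff lam B M a b : 1 <= lam -> lam^-1 `^ gamma <= 1 -> 0 <= B -> 0 <= M ->
  W lam B (fun t => a t - b t) -> W 0 M a -> W 0 M b -> a 0 = b 0 ->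
  W lam (C * lam^-1 `^ gamma * (L * (1 + 2 * M) * B)) (fun t => Gam a t - Gam b t).
Proof.
move=> l1 e1 B0 M0 hd ha hb ab.
have l0 : 0 < lam by apply: lt_le_trans l1.
have LM : 0 <= L * M by rewrite mulr_ge0.
apply: (@whold_ext _ _ _ _ _ (V (fun u => sigma (a u) - sigma (b u)))).
  move=> t t0 tT; rewrite (VB (lexx 0) (lexx 0) LM LM (sigma_whold ha) (sigma_whold hb))//.
  by rewrite /Gam opprD addrACA subrr add0r.
apply: Vcontract => //.
- by rewrite !mulr_ge0// addr_ge0// mulr_ge0.
- by rewrite ab subrr.
move=> s t s0 st tT.
have t0 := le_trans s0 st.
apply: (le_trans (sigma_four _ _ _ _)).
have h1 := hd s t s0 st tT.
have h2 : `|b t - b s| <= M * (t - s) `^ gamma.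
  by have := hb s t s0 st tT; rewrite mul0r expR0 mulr1.
have h3 := whold_sup g0 l0 B0 (_ : (fun t => a t - b t) 0 = 0) hd t0 tT.
rewrite /= ab subrr in h3; have {}h3 := h3 erefl.
have e0 := expR_ge0 (lam * t).
have p0 := powR_ge0 (t - s) gamma.
have h4 : `|a t - b t| <= 2 * B * expR (lam * t).
  apply: (le_trans h3); rewrite ler_wpM2r// ler_wpM2l// ler_piMr//.
have h5 : `|a t - b t| * `|b t - b s| <= 2 * B * expR (lam * t) * (M * (t - s) `^ gamma).
  exact: ler_pM.
have := ler_wpM2l L0 h1; have := ler_wpM2l L0 h5.
by move: (L0) => ?; lra.
Qed.

(** Growth is linear, by the Lipschitz bound alone. Subtracting [sigma a0] makes the integrand
    vanish at 0, so its part is below [B] for large [lam]; the constant contributes at most [B],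
    which makes the radius [2 B]. *)
Lemma Gam_growth : exists lam M, [/\ 0 <= lam, 0 <= M &
  forall a, a 0 = a0 -> W lam M a -> W lam M (Gam a)].
Proof.
have [B B0 hB] := Vcst (sigma a0).
have CL0 : 0 <= C * L by rewrite mulr_ge0.
have CL1 : 0 < 2 * (C * L + 1) by rewrite mulr_gt0// ltr_wpDl.
have d0 : 0 < (2 * (C * L + 1))^-1 by rewrite invr_gt0.
have [lam [l1 hl _]] := small_weight g0 d0.
have l0 : 0 <= lam by apply: le_trans l1.
exists lam, (2 * B); split => //; first by rewrite mulr_ge0.
move=> a aa ha.
have ha' : W lam (L * (2 * B)) (fun u => sigma (a u) - sigma a0).
  move=> s t s0 st tT; rewrite opprB addrA subrK.
  by have := sigma_whold ha s0 st tT.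
have hV := Vcontract l1 (mulr_ge0 L0 (mulr_ge0 (ler0n _ 2) B0)) (_ : (fun u => sigma (a u) - sigma a0) 0 = 0) ha'.
rewrite /= aa subrr in hV; have {}hV := hV erefl.
have hV' := whold_add hV (whold_mono B0 l0 (lexx _) hB).
move=> s t s0 st tT; rewrite /Gam opprD addrACA subrr add0r.
have e t' : 0 <= t' -> t' <= T -> V (fun u => sigma (a u)) t' =
    V (fun u => sigma (a u) - sigma a0) t' + V (fun=> sigma a0) t'.
  move=> t0' tT'.
  have hc : W 0 0 (fun=> sigma a0) by apply: whold_cst.
  have LB : 0 <= L * (2 * B) by rewrite !mulr_ge0.
  by rewrite (VB l0 (lexx 0) LB (lexx 0) (sigma_whold ha) hc)// subrK.
rewrite !e ?(le_trans s0 st) ?(le_trans st tT)//.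
apply: (le_trans (hV' s t s0 st tT)).
rewrite ler_wpM2r ?powR_ge0// ler_wpM2r ?expR_ge0//.
have : C * lam^-1 `^ gamma * (L * (2 * B)) <= B; last by lra.
have -> : C * lam^-1 `^ gamma * (L * (2 * B)) = B * (2 * (C * L) * lam^-1 `^ gamma) by ring.
rewrite ler_piMr//.
apply: (@le_trans _ _ (2 * (C * L) * (2 * (C * L + 1))^-1)).
  by rewrite ler_wpM2l// mulr_ge0.
by rewrite ler_pdivrMr//; lra.
Qed.

(** The ball is unweighted and [lam] is chosen after its radius, since the contraction constant
    grows with [M]. *)
Lemma Gam_half M : 0 <= M -> exists lam, [/\ 1 <= lam &
  forall B a b, 0 <= B -> W lam B (fun t => a t - b t) -> W 0 M a -> W 0 M b -> a 0 = b 0 ->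
    W lam (B / 2) (fun t => Gam a t - Gam b t)].
Proof.
move=> M0.
have LM : 0 <= L * (1 + 2 * M) by rewrite mulr_ge0// addr_ge0// mulr_ge0.
have q0 : 0 <= C * (L * (1 + 2 * M)) by rewrite mulr_ge0.
have CL1 : 0 < 2 * (C * (L * (1 + 2 * M)) + 1) by rewrite mulr_gt0// ltr_wpDl.
have d0 : 0 < (2 * (C * (L * (1 + 2 * M)) + 1))^-1 by rewrite invr_gt0.
have [lam [l1 hl hl1]] := small_weight g0 d0.
exists lam; split => // B a b B0 hd ha hb ab.
apply: whold_mono (Gam_diff l1 hl1 B0 M0 hd ha hb ab) => //.
  by rewrite !mulr_ge0 ?powR_ge0// addr_ge0// mulr_ge0.
have -> : C * lam^-1 `^ gamma * (L * (1 + 2 * M) * B) =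
  B * (C * (L * (1 + 2 * M)) * lam^-1 `^ gamma) by ring.
rewrite ler_wpM2l//.
apply: (@le_trans _ _ (C * (L * (1 + 2 * M)) * (2 * (C * (L * (1 + 2 * M)) + 1))^-1)).
  by rewrite ler_wpM2l.
by rewrite ler_pdivrMr//; lra.
Qed.

Lemma Gam0 a : Gam a 0 = a0.
Proof. by rewrite /Gam V0 addr0. Qed.

(** The radius is arbitrary, so any two Hölder solutions fit in one ball; the trivial bound [2 M] on
    their difference is then halved indefinitely. *)
Lemma picard_unique M a b : 0 <= M -> W 0 M a -> W 0 M b ->
  (forall t, 0 <= t -> t <= T -> a t = Gam a t) ->
  (forall t, 0 <= t -> t <= T -> b t = Gam b t) ->
  forall t, 0 <= t -> t <= T -> a t = b t.
Proof.
move=> M0 ha hb ea eb.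
have ab0 : a 0 = b 0 by rewrite ea ?eb ?Gam0// ltW.
have [lam [l1 half]] := Gam_half M0.
have l0 : 0 < lam by apply: lt_le_trans l1.
have h k : W lam ((2 * M) * 2^-1 ^+ k) (fun t => a t - b t).
  elim: k => [|k IH].
    rewrite expr0 mulr1; apply: (whold_mono (lam := 0) (B := M + M)); rewrite ?addr_ge0//.
    - exact: ltW.
    - lra.
    - exact: whold_sub.
  apply: (@whold_ext _ _ _ _ _ (fun t => Gam a t - Gam b t)).
    by move=> t t0 tT; rewrite -ea// -eb.
  rewrite exprSr mulrA; apply: half => //.
  by rewrite !mulr_ge0// exprn_ge0// invr_ge0.
move=> t t0 tT; apply/subr0_eq/eqP; rewrite -normr_le0.
apply: (@geometric_le0 _ (2 * (2 * M * lam^-1 `^ gamma) * expR (lam * t))) => k.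
have B0 : 0 <= 2 * M * 2^-1 ^+ k by rewrite !mulr_ge0// exprn_ge0// invr_ge0.
have h3 := whold_sup g0 l0 B0 (_ : (fun t => a t - b t) 0 = 0) (h k) t0 tT.
rewrite /= ab0 subrr in h3; apply: (le_trans (h3 erefl)).
by rewrite le_eqVlt; apply/orP; left; apply/eqP; ring.
Qed.

Lemma row_cvg (u : nat -> 'rV[R]_m) (l : 'rV[R]_m) (c : R) (x : 'rV[R]_m) (N : nat) :
  0 <= c -> (forall j, (fun k => u k 0 j) @ \oo --> l 0 j) ->
  (forall k, (N <= k)%N -> `|u k - x| <= c) -> `|l - x| <= c.
Proof.
move=> c0 hu h; apply: norm_le_coord => // j; rewrite !mxE.
apply: (cvgn_norm_le (N := N) (hu j)) => k Nk.
by have := coord_le_norm (u k - x) j; rewrite !mxE => /le_trans; apply; exact: h.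
Qed.

Lemma picard_exists : exists a M, [/\ 0 <= M, W 0 M a &
  forall t, 0 <= t -> t <= T -> a t = Gam a t].
Proof.
have [lam1 [M1 [l10 M10 grow]]] := Gam_growth.
pose u k := iter k Gam (fun=> a0).
have u0 k : u k 0 = a0 by case: k => // k; rewrite /u iterS Gam0.
have hu k : W lam1 M1 (u k).
  elim: k => [|k IH]; first exact: whold_cst.
  exact: (grow (u k) (u0 k) IH).
(* The weight [lam1] only keeps the iterates in one ball. The contraction uses another weight, so
   the ball is first rewritten without one. *)
pose M := M1 * expR (lam1 * T).
have M0 : 0 <= M by rewrite mulr_ge0// expR_ge0.
have hM k : W 0 M (u k) by apply: whold_restrict.
have [lam [l1 half]] := Gam_half M0.
have l0 : 0 < lam by apply: lt_le_trans l1.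
have B0 k : 0 <= 2 * M * 2^-1 ^+ k by rewrite !mulr_ge0// exprn_ge0// invr_ge0.
have hd k : W lam (2 * M * 2^-1 ^+ k) (fun t => u k.+1 t - u k t).
  elim: k => [|k IH].
    rewrite expr0 mulr1; apply: (whold_mono (lam := 0) (B := M + M)); rewrite ?addr_ge0//.
    - exact: ltW.
    - lra.
    - exact: whold_sub.
  rewrite exprSr mulrA.
  have := half _ (u k.+1) (u k) (B0 k) IH (hM _) (hM _).
  by rewrite !u0 => /(_ erefl); rewrite /u !iterS.
have hdd k l : W lam (2 * (2 * M * 2^-1 ^+ k)) (fun t => u (l + k)%N t - u k t).
  have : W lam (2 * (2 * M * 2^-1 ^+ k) * (1 - 2^-1 ^+ l)) (fun t => u (l + k)%N t - u k t).
    elim: l => [|l IH].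
      apply: (@whold_ext _ _ _ _ _ (fun=> 0)); last by apply: whold_cst; rewrite expr0 subrr mulr0.
      by move=> t _ _; rewrite add0n subrr.
    have -> : 2 * (2 * M * 2^-1 ^+ k) * (1 - 2^-1 ^+ l.+1) =
       2 * (2 * M * 2^-1 ^+ k) * (1 - 2^-1 ^+ l) + 2 * M * 2^-1 ^+ (l + k).
      by rewrite exprS exprD; field.
    apply: (@whold_ext _ _ _ _ _ (fun t => (u (l + k)%N t - u k t) + (u (l + k).+1 t - u (l + k)%N t))).
      by move=> t _ _; rewrite addrC subrKA.
    exact: whold_add.
  have q0 : 0 <= 2^-1 ^+ l :> R by rewrite exprn_ge0// invr_ge0.
  have q1 : 2^-1 ^+ l <= 1 :> R by rewrite exprn_ile1 ?invr_ge0// invf_le1// ler1n.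
  have B2 : 0 <= 2 * (2 * M * 2^-1 ^+ k) by rewrite mulr_ge0.
  apply: whold_mono => //; first by rewrite mulr_ge0// subr_ge0.
  by rewrite ler_piMr// gerBl.
have hsup k l t : 0 <= t -> t <= T -> `|u (l + k)%N t - u k t| <=
    2 * (2 * (2 * M) * lam^-1 `^ gamma) * expR (lam * T) * 2^-1 ^+ k.
  move=> t0 tT.
  have B2 : 0 <= 2 * (2 * M * 2^-1 ^+ k) by rewrite mulr_ge0.
  have h3 := whold_sup g0 l0 B2 (_ : (fun t => u (l + k)%N t - u k t) 0 = 0) (hdd k l) t0 tT.
  rewrite /= !u0 subrr in h3; apply: (le_trans (h3 erefl)).
  have -> : 2 * (2 * (2 * M) * lam^-1 `^ gamma) * expR (lam * T) * 2^-1 ^+ k =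
    2 * (2 * (2 * M * 2^-1 ^+ k) * lam^-1 `^ gamma) * expR (lam * T) by ring.
  have p0 := mulr_ge0 (ler0n R 2) (mulr_ge0 B2 (powR_ge0 lam^-1 gamma)).
  by apply: (ler_wpM2l p0); rewrite ler_expR; apply: ler_wpM2l => //; exact: ltW.
pose a t : 'rV[R]_m := \row_j limn (fun k => u k t 0 j).
have cvu t : 0 <= t -> t <= T -> forall j, (fun k => u k t 0 j) @ \oo --> a t 0 j.
  move=> t0 tT j; rewrite mxE.
  have q1 : 0 <= (2^-1 : R) < 1 by rewrite invr_ge0 ler0n/= invf_lt1// ltr1n.
  have [] // := @geometric_cvg R (fun k => u k t 0 j)
     (2 * (2 * (2 * M) * lam^-1 `^ gamma) * expR (lam * T)) (2^-1) q1.
  move=> k; have := coord_le_norm (u k.+1 t - u k t) j; rewrite !mxE => /le_trans; apply.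
  exact: (hsup k 1%N).
have hlim (N : nat) (c : R) (x : 'rV[R]_m) s t : 0 <= c -> 0 <= s -> s <= t -> t <= T ->
    (forall k, (N <= k)%N -> `|(u k t - u k s) - x| <= c) -> `|(a t - a s) - x| <= c.
  move=> c0 s0 st tT h; apply: (@row_cvg (fun k => u k t - u k s) _ _ _ N) => // j.
  have -> : (a t - a s) 0 j = a t 0 j - a s 0 j by rewrite !mxE.
  rewrite (_ : (fun k => _) = (fun k => u k t 0 j - u k s 0 j)); last first.
    by apply/funext => k; rewrite !mxE.
  by apply: cvgB; apply: cvu; rewrite ?(le_trans s0 st) ?(le_trans st tT).
have ha : W 0 M a.
  move=> s t s0 st tT; rewrite -[X in `|X|]subr0; apply: (hlim 0%N) => //.
    by rewrite !mulr_ge0 ?powR_ge0 ?expR_ge0.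
  by move=> k _; rewrite subr0; apply: hM.
(* Hölder bounds pass to pointwise limits, so the distance from [a] to the iterates is controlled in
   the weighted norm, and [half] then compares [Gam a] with them. *)
have hda k : W lam (2 * (2 * M * 2^-1 ^+ k)) (fun t => a t - u k t).
  move=> s t s0 st tT.
  have -> : a t - u k t - (a s - u k s) = (a t - a s) - (u k t - u k s).
    exact: subrACA.
  apply: (hlim k) => //; first by rewrite !mulr_ge0 ?powR_ge0 ?expR_ge0.
  move=> l kl; rewrite -(subnK kl).
  have -> : u (l - k + k)%N t - u (l - k + k)%N s - (u k t - u k s) =
     (u (l - k + k)%N t - u k t) - (u (l - k + k)%N s - u k s).
    exact: subrACA.
  exact: hdd.
have aa0 : a 0 = a0.
  apply/rowP => j; apply: (cvg_unique _ (cvu 0 (lexx _) (ltW T0) j)) => //.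
  rewrite (_ : (fun k => _) = (fun=> a0 0 j)); first exact: cvg_cst.
  by apply/funext => k; rewrite u0.
exists a, M; split => // t t0 tT.
apply/subr0_eq/eqP; rewrite -normr_le0.
pose K := 2 * (2 * (2 * M) * lam^-1 `^ gamma) * expR (lam * t).
have sup k : `|a t - u k t| <= K * 2^-1 ^+ k.
  have B2 : 0 <= 2 * (2 * M * 2^-1 ^+ k) by rewrite mulr_ge0.
  have h3 := whold_sup g0 l0 B2 (_ : (fun t => a t - u k t) 0 = 0) (hda k) t0 tT.
  rewrite /= u0 aa0 subrr in h3; apply: (le_trans (h3 erefl)).
  by rewrite le_eqVlt; apply/orP; left; apply/eqP; rewrite /K; ring.
have sup' k : `|Gam a t - u k.+1 t| <= K * 2^-1 ^+ k.
  have B2 : 0 <= 2 * (2 * M * 2^-1 ^+ k) by rewrite mulr_ge0.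
  have hG := half _ a (u k) B2 (hda k) ha (hM k) (etrans aa0 (esym (u0 k))).
  have B3 : 0 <= 2 * (2 * M * 2^-1 ^+ k) / 2 by rewrite divr_ge0.
  have h3 := whold_sup g0 l0 B3 (_ : (fun t => Gam a t - Gam (u k) t) 0 = 0) hG t0 tT.
  rewrite /= !Gam0 subrr in h3; apply: (le_trans (h3 erefl)).
  have -> : 2 * (2 * (2 * M * 2^-1 ^+ k) / 2 * lam^-1 `^ gamma) * expR (lam * t) =
    K * 2^-1 ^+ k / 2 by rewrite /K; field.
  have : 0 <= K * 2^-1 ^+ k by apply: le_trans (sup k).
  lra.
apply: (@geometric_le0 _ (2 * K)) => k.
have -> : a t - Gam a t = (a t - u k.+1 t) - (Gam a t - u k.+1 t) by rewrite opprB addrA subrK.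
apply: (le_trans (ler_normB _ _)); apply: (le_trans (lerD (sup _) (sup' _))).
have : 0 <= K * 2^-1 ^+ k by apply: le_trans (sup k).
by rewrite exprS; lra.
Qed.

End picard.

(** * Uniqueness of the sewing and the Volterra operator *)

Section rows.
Context {R : realType}.
Variables (phi : R -> R) (gamma T : R).
Local Notation Pos := (`]0%R, +oo[%classic : set R).
Local Notation NN := (`[0%R, +oo[%classic : set R).
Local Notation mu := (@lebesgue_measure R).
Hypotheses (T0 : 0 < T) (g12 : 1 / 2 < gamma) (g1 : gamma <= 1).
Hypothesis mphi : measurable_fun Pos phi.
Hypothesis fphi : (\int[mu]_(xi in Pos) (`|phi xi| * (1 + xi `^ gamma))%:E < +oo)%E.
Local Notation N := (Nphi phi gamma).
Local Notation M0 := (Mphi phi gamma).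

Let g0 : 0 < gamma. Proof. by move: g12 => ?; lra. Qed.

Lemma mrowB k (g g' : R -> 'rV[R]_k) : mrow g -> mrow g' -> mrow (fun xi => g xi - g' xi).
Proof.
move=> mg mg' j; rewrite (_ : (fun _ => _) = (fun xi => g xi 0 j - g' xi 0 j)).
  by apply: measurable_funB; [exact: mg|exact: mg'].
by apply/funext => xi; rewrite !mxE.
Qed.

Lemma measurable_damp (t s : R) : measurable_fun NN (fun xi => damp xi t s).
Proof.
apply: measurableT_comp; first exact: measurable_expR.
apply: measurable_funN; apply: measurable_funM; last exact: measurable_cst.
exact: measurable_id.
Qed.

Lemma mrow_damp k (g : R -> 'rV[R]_k) t s : mrow g -> mrow (fun xi => damp xi t s *: g xi).
Proof.
move=> mg j; rewrite (_ : (fun _ => _) = (fun xi => damp xi t s * g xi 0 j)).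
  by apply: measurable_funM; [exact: measurable_damp|exact: mg].
by apply/funext => xi; rewrite !mxE.
Qed.

Lemma dtilde1E k (Y : R -> R -> 'rV[R]_k) t s xi :
  dtilde1 Y t s xi = Y t xi - damp xi t s *: Y s xi.
Proof. by []. Qed.

Lemma dtilde2E k (B : R -> R -> R -> 'rV[R]_k) t u s xi :
  dtilde2 B t u s xi = B t s xi - B t u xi - damp xi t u *: B u s xi.
Proof. by []. Qed.

Lemma mrow_dtilde1 k (Y : R -> R -> 'rV[R]_k) t s : mrow (Y t) -> mrow (Y s) -> mrow (dtilde1 Y t s).
Proof. by move=> h1 h2; apply: mrowB => //; exact: mrow_damp. Qed.

Lemma dtilde2_dtilde1 k (Y : R -> R -> 'rV[R]_k) t u s xi :
  dtilde2 (fun t s => dtilde1 Y t s) t u s xi = 0.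
Proof.
rewrite dtilde2E !dtilde1E scalerBr scalerA dampM.
by apply/rowP => j; rewrite !mxE; ring.
Qed.

Lemma N0 k (g : R -> 'rV[R]_k) : (forall xi, 0 <= xi -> g xi = 0) -> N g = 0%E.
Proof.
move=> h; apply/le_anti; rewrite Nphi_ge0 andbT.
apply: (@le_trans _ _ ((0 * M0)%:E)); last by rewrite mul0r.
by apply: Nphi_bound => // xi xi0; rewrite h// normr0.
Qed.

Lemma powR_small (c e : R) : 0 <= c -> 0 < e -> exists2 dl : R, 0 < dl & c * dl `^ gamma <= e.
Proof.
move=> c0 e0.
have ec : 0 < e / (c + 1) by rewrite divr_gt0// ltr_wpDl.
have /cvgrPdist_le/(_ _ ec)[n _ /(_ n (leqnn _))] := mesh_cvg (ltr01 : 0 < (1 : R)) g0.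
rewrite sub0r normrN (ger0_norm (powR_ge0 _ _)) => h.
exists (mesh 1 n); first exact: mesh_gt0.
apply: (le_trans (ler_wpM2l c0 h)).
have c1 : 0 < c + 1 by rewrite ltr_wpDl.
by rewrite mulrA ler_pdivrMr//; lra.
Qed.

Lemma damp_diff_le (xi a b a' b' : R) : 0 <= xi -> b <= a -> b' <= a' ->
  `|damp xi a b - damp xi a' b'| <= 1 - damp xi `|(a - b) - (a' - b')| 0.
Proof.
move=> xi0.
wlog h : a b a' b' / a - b <= a' - b'.
  move=> H ba ba'; have [h|h] := leP (a - b) (a' - b'); first exact: H.
  by rewrite distrC [ `|(_ - _) - _|]distrC; apply: H => //; exact: ltW.
move=> ba ba'.
rewrite distrC ler0_norm ?subr_le0//; last first.
  by rewrite ler_expR lerN2 ler_wpM2l.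
rewrite [ `|_ - (_ - _)|]distrC (ger0_norm (x := a' - b' - _)) ?subr_ge0//.
have -> : damp xi a' b' = damp xi (a' - b' - (a - b)) 0 * damp xi a b.
  by rewrite /damp -expRD; congr expR; ring.
rewrite opprB -[X in X - _]mul1r -mulrBl ler_piMr//.
  by apply: one_damp_ge0 => //; rewrite subr_ge0.
exact: damp_le1.
Qed.

Lemma damp_mono (xi dl dl' : R) : 0 <= xi -> dl <= dl' -> 1 - damp xi dl 0 <= 1 - damp xi dl' 0.
Proof.
move=> xi0 h; rewrite lerD2l lerN2 ler_expR lerN2 ler_wpM2l//; lra.
Qed.

(** A single [dl] serves both the Hölder part and the part that is small only after integration. It
    is doubled in [damp] because [t - s] moves by up to [2 dl] when both times move by [dl]. *)
Lemma Nphi_small (c M e : R) : 0 <= c -> 0 <= M -> 0 < e -> exists2 dl : R, 0 < dl &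
  forall k (g : R -> 'rV[R]_k),
    (forall xi, 0 <= xi -> `|g xi| <= c * dl `^ gamma + M * (1 - damp xi (2 * dl) 0)) ->
    (N g < e%:E)%E.
Proof.
move=> c0 M00 e0.
have M1 : 0 < M + 1 by rewrite ltr_wpDl.
have e2 : 0 < e / 2 / (M + 1) by rewrite !divr_gt0.
have [d1 d10 h1] := damp_mod_small mphi fphi e2.
have e4 : 0 < e / 4 by rewrite divr_gt0.
have [d2 d20 h2] := powR_small (mulr_ge0 c0 (Mphi_ge0 phi gamma)) e4.
have d0 : 0 < Num.min (d1 / 2) d2 by rewrite lt_min d20 andbT divr_gt0.
exists (Num.min (d1 / 2) d2) => // k g hg.
set dl := Num.min _ _ in d0 hg *.
have l1 : 2 * dl <= d1.
  by have h : dl <= d1 / 2 by [rewrite ge_min lexx]; lra.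
have l2 : dl <= d2 by rewrite ge_min lexx orbT.
have mw := measurable_weight gamma mphi.
have wd xi : 0 <= xi -> 0 <= 1 - damp xi d1 0 by move=> xi0; apply: one_damp_ge0 => //; exact: ltW.
have cd : 0 <= c * d2 `^ gamma by rewrite mulr_ge0// powR_ge0.
have md : measurable_fun NN (fun xi => `|phi xi| * (1 + xi `^ gamma) * (1 - damp xi d1 0)).
  apply: measurable_funM => //; apply: measurable_funB; first exact: measurable_cst.
  exact: measurable_damp.
apply: (@le_lt_trans _ _ (\int[mu]_(xi in NN)
   ((c * d2 `^ gamma * (`|phi xi| * (1 + xi `^ gamma)))%:E +
    M%:E * (`|phi xi| * (1 + xi `^ gamma) * (1 - damp xi d1 0))%:E))%E).
  apply: ge0_le_integral_sup => xi /=; rewrite in_itv/= andbT => xi0.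
    by rewrite lee_fin mulr_ge0// weight_ge0.
  rewrite -EFinM -EFinD lee_fin.
  apply: (le_trans (ler_wpM2l (weight_ge0 phi gamma xi) (hg _ xi0))).
  have i1 : c * dl `^ gamma <= c * d2 `^ gamma.
    by rewrite ler_wpM2l//; apply: powR_mono => //; exact: ltW.
  have i2 : M * (1 - damp xi (2 * dl) 0) <= M * (1 - damp xi d1 0).
    by rewrite ler_wpM2l// damp_mono.
  apply: (le_trans (ler_wpM2l (weight_ge0 phi gamma xi) (lerD i1 i2))).
  by rewrite le_eqVlt; apply/orP; left; apply/eqP; ring.
have mNN : measurable NN by exact: measurable_itv.
rewrite ge0_integralD//=; last 4 first.
- by move=> xi _; rewrite lee_fin mulr_ge0// weight_ge0.
- by apply/measurable_EFinP; apply: measurable_funM => //; exact: measurable_cst.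
- move=> xi; rewrite in_itv/= andbT => xi0.
  by rewrite lee_fin !mulr_ge0 ?weight_ge0 ?wd// addr_ge0// powR_ge0.
- by apply/measurable_EFinP; apply: measurable_funM => //; exact: measurable_cst.
rewrite integral_weight_scale// ge0_integralZl_EFin//; last 2 first.
- move=> xi; rewrite /= in_itv/= andbT => xi0.
  by rewrite lee_fin !mulr_ge0 ?wd// addr_ge0// powR_ge0.
- exact/measurable_EFinP.
have h3 : (M%:E * damp_mod phi gamma d1 <= (e / 2)%:E)%E.
  apply: (@le_trans _ _ (M%:E * (e / 2 / (M + 1))%:E)%E).
    by apply: lee_wpmul2l; [rewrite lee_fin|exact: ltW].
  by rewrite -EFinM lee_fin mulrA ler_pdivrMr//; lra.
have h4 : c * d2 `^ gamma * M0 <= e / 4 by move: h2; rewrite mulrAC.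
apply: (le_lt_trans (leeD (_ : ((c * d2 `^ gamma * M0)%:E <= (e / 4)%:E)%E) h3)).
  by rewrite lee_fin.
by rewrite -EFinD lte_fin; lra.
Qed.

Section rowpath.
Variables (k : nat) (Y : R -> R -> 'rV[R]_k) (C M : R).
Hypotheses (C0 : 0 <= C) (M00 : 0 <= M).
Hypothesis mY : forall t, 0 <= t -> t <= T -> mrow (Y t).
Hypothesis hY : forall t xi, 0 <= t -> t <= T -> 0 <= xi -> `|Y t xi| <= M.
Hypothesis dY : forall s t xi, 0 <= s -> s <= t -> t <= T -> 0 <= xi ->
  `|dtilde1 Y t s xi| <= C * (t - s) `^ gamma.

Lemma rowpath_incr (s t xi dl : R) : 0 <= s <= T -> 0 <= t <= T -> `|t - s| <= dl -> 0 <= xi ->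
  `|Y t xi - Y s xi| <= C * dl `^ gamma + M * (1 - damp xi dl 0).
Proof.
wlog st : s t / s <= t.
  move=> H hs ht; have [h|h] := leP s t; first exact: H.
  by rewrite distrC [ `|Y _ _ - _|]distrC; apply: H => //; exact: ltW.
move=> /andP[s0 sT] /andP[t0 tT]; rewrite ger0_norm ?subr_ge0// => ts xi0.
have -> : Y t xi - Y s xi = dtilde1 Y t s xi - (1 - damp xi t s) *: Y s xi.
  by rewrite dtilde1E scalerBl scale1r opprB addrA subrK.
apply: (le_trans (ler_normB _ _)); apply: lerD.
  apply: (le_trans (dY s0 st tT xi0)); rewrite ler_wpM2l//.
  by apply: powR_mono => //; [exact: ltW|rewrite subr_ge0].
rewrite normrZ ger0_norm ?one_damp_ge0// mulrC.
apply: ler_pM => //; [exact: one_damp_ge0|exact: hY|].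
have -> : damp xi t s = damp xi (t - s) 0 by rewrite /damp subr0.
exact: damp_mono.
Qed.

Lemma rowpath_inC1 : inC1 phi gamma T Y.
Proof.
split=> [s /andP[s0 sT]|s hs e e0].
  by apply: (inL_bound mphi fphi (C := M)) => [|xi xi0]; [exact: mY|exact: hY].
have [dl dl0 h] := Nphi_small C0 M00 e0.
exists dl => // s' hs' ss; apply: h => xi xi0.
apply: (le_trans (rowpath_incr hs' hs (ltW ss) xi0)); rewrite lerD2l ler_wpM2l//.
apply: damp_mono => //; lra.
Qed.

Lemma rowpath_hoelder2 : Defs.hoelder2 phi gamma T gamma (fun t s => dtilde1 Y t s).
Proof.
exists (C * M0) => t s s0 st tT; rewrite mulrAC; apply: Nphi_bound => //.
  by rewrite mulr_ge0// powR_ge0.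
by move=> xi xi0; apply: dY => //; exact: ltW.
Qed.

Lemma rowpath_inC1gamma : inC1gamma phi gamma T Y.
Proof.
split; first exact: rowpath_inC1.
split; last exact: rowpath_hoelder2.
exists (M * M0) => s /andP[s0 sT]; apply: Nphi_bound => // xi xi0; exact: hY.
Qed.

Lemma rowpath_inC2gamma : inC2gamma phi gamma T (fun t s => dtilde1 Y t s).
Proof.
split; last exact: rowpath_hoelder2.
split=> [t s [s0 [st tT]]|t s [s0 [st tT]] e e0].
  apply: (inL_bound mphi fphi (C := C * (t - s) `^ gamma)) => [|xi xi0].
    by apply: mrow_dtilde1; apply: mY => //; [exact: le_trans st|exact: le_trans tT].
  exact: dY.
have [dl dl0 h] := Nphi_small (mulr_ge0 (ler0n R 2) C0) (mulr_ge0 (ler0n R 3) M00) e0.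
exists dl => // t' s' [s'0 [s't' t'T]] tt ss; apply: h => xi xi0.
have t0 := le_trans s0 st; have t'0 := le_trans s'0 s't'.
have sT := le_trans st tT; have s'T := le_trans s't' t'T.
have -> : dtilde1 Y t s xi - dtilde1 Y t' s' xi = (Y t xi - Y t' xi)
   - ((damp xi t s - damp xi t' s') *: Y s xi + damp xi t' s' *: (Y s xi - Y s' xi)).
  by rewrite !dtilde1E scalerBl scalerBr subrKA subrACA.
apply: (le_trans (ler_normB _ _)).
apply: (le_trans (lerD (lexx _) (ler_normD _ _))).
have i1 : `|Y t xi - Y t' xi| <= C * dl `^ gamma + M * (1 - damp xi dl 0).
  by apply: rowpath_incr; rewrite ?t'0 ?t0// ltW.
have i2 : `|Y s xi - Y s' xi| <= C * dl `^ gamma + M * (1 - damp xi dl 0).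
  by apply: rowpath_incr; rewrite ?s'0 ?s0// ltW.
have i3 : `|damp xi t' s' *: (Y s xi - Y s' xi)| <= C * dl `^ gamma + M * (1 - damp xi dl 0).
  rewrite normrZ (ger0_norm (ltW (damp_gt0 _ _ _))); apply: le_trans i2.
  by rewrite ler_piMl// damp_le1.
have i4 : `|(damp xi t s - damp xi t' s') *: Y s xi| <= M * (1 - damp xi (2 * dl) 0).
  rewrite normrZ mulrC; apply: ler_pM => //; first exact: hY.
  apply: (le_trans (damp_diff_le xi0 st s't')); apply: damp_mono => //.
  rewrite subrACA; apply: (le_trans (ler_normB _ _)); lra.
have i5 : M * (1 - damp xi dl 0) <= M * (1 - damp xi (2 * dl) 0).
  by rewrite ler_wpM2l// damp_mono//; lra.
by move: i1 i3 i4 i5; lra.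
Qed.

End rowpath.

(* Halving [k] times and using the exponent [mu' > 1], the norm of [Q t s] is at most
   [C (t - s)^mu' 2^(k(1 - mu'))]. *)
Lemma sewing_unique k (mu' : R) (Q : R -> R -> R -> 'rV[R]_k) : 1 < mu' ->
  (forall t s, 0 <= s -> s <= t -> t <= T -> mrow (Q t s)) ->
  Defs.hoelder2 phi gamma T mu' Q ->
  (forall t u s, 0 <= s -> s <= u -> u <= t -> t <= T -> N (dtilde2 Q t u s) = 0%E) ->
  forall t s, 0 <= s -> s < t -> t <= T -> N (Q t s) = 0%E.
Proof.
move=> mu1 mQ [C hC] dQ.
have chen t u s : 0 <= s -> s <= u -> u <= t -> t <= T -> (N (Q t s) <= N (Q t u) + N (Q u s))%E.
  move=> s0 su ut tT; have st := le_trans su ut; have u0 := le_trans s0 su.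
  have uT := le_trans ut tT.
  have m1 : mrow (dtilde2 Q t u s).
    apply: mrowB; last by apply: mrow_damp; exact: mQ.
    by apply: mrowB; exact: mQ.
  apply: (@le_trans _ _ (N (dtilde2 Q t u s) + N (fun xi => (Q t s xi - dtilde2 Q t u s xi)%R))%E).
    apply: Nphi_triangle => //; first by apply: mrowB => //; exact: mQ.
    move=> xi xi0; rewrite -{1}[Q t s xi](subrK (dtilde2 Q t u s xi)) addrC.
    exact: ler_normD.
  rewrite dQ// add0e; apply: Nphi_triangle => //; [exact: mQ|exact: mQ|].
  move=> xi xi0.
  have -> : Q t s xi - dtilde2 Q t u s xi = Q t u xi + damp xi t u *: Q u s xi.
    by rewrite dtilde2E; apply/rowP => j; rewrite !mxE; ring.
  apply: (le_trans (ler_normD _ _)); rewrite lerD2l normrZ (ger0_norm (ltW (damp_gt0 _ _ _))).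
  by rewrite ler_piMl// damp_le1.
have it j : forall t s, 0 <= s -> s < t -> t <= T ->
    (N (Q t s) <= (2 ^+ j * (C * ((t - s) / 2 ^+ j) `^ mu'))%:E)%E.
  elim: j => [|j IH] t s s0 st tT; first by rewrite expr0 mul1r divr1; exact: hC.
  have h1 : s < (s + t) / 2 by lra.
  have h2 : (s + t) / 2 < t by lra.
  apply: (le_trans (chen t ((s + t) / 2) s s0 (ltW h1) (ltW h2) tT)).
  apply: (le_trans (leeD (IH _ _ _ h2 tT) (IH _ _ s0 h1 _))); [lra|lra|].
  rewrite -EFinD lee_fin.
  have p2 : 2 ^+ j != 0 :> R by rewrite expf_neq0.
  have -> : (t - (s + t) / 2) / 2 ^+ j = (t - s) / 2 ^+ j.+1 by rewrite exprS; field.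
  have -> : ((s + t) / 2 - s) / 2 ^+ j = (t - s) / 2 ^+ j.+1 by rewrite exprS; field.
  by rewrite exprS; lra.
move=> t s s0 st tT; apply/le_anti; rewrite Nphi_ge0 andbT.
have ts : 0 <= t - s by rewrite subr_ge0 ltW.
have fin : N (Q t s) \is a fin_num.
  by rewrite ge0_fin_numE ?Nphi_ge0// (le_lt_trans (it 0%N _ _ s0 st tT))// ltry.
rewrite -(fineK fin) lee_fin.
have cv : geometric (C * (t - s) `^ mu') (2^-1 `^ (mu' - 1)) @ \oo --> (0 : R).
  apply: cvg_geometric; have /half_powR_lt1/andP[q0 q1] : 0 < mu' - 1 by lra.
  by rewrite ger0_norm.
apply: (ler_cvg_to (cvg_cst (fine (N (Q t s)))) cv); exists 0%N => // j _ /=.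
have := it j t s s0 st tT; rewrite -(fineK fin) lee_fin => /le_trans; apply.
have i0 : 0 <= 2^-1 :> R by rewrite invr_ge0.
have -> : (t - s) / 2 ^+ j = (t - s) * 2^-1 ^+ j by rewrite exprVn.
rewrite (powRM _ ts (exprn_ge0 j i0)) powR_exprn// /geometric /=.
have -> : (2^-1 : R) `^ mu' = 2^-1 * 2^-1 `^ (mu' - 1).
  by rewrite mulr_powRB1//; lra.
rewrite exprMn_comm; last exact: mulrC.
rewrite exprVn le_eqVlt; apply/orP; left; apply/eqP; field.
by rewrite expf_neq0.
Qed.

End rows.

Section matrix_norm.
Context {R : realType} {n m : nat}.

Lemma mx_coord_le_norm (v : 'M[R]_(n, m)) i j : `|v i j| <= `|v|.
Proof. by rewrite [leRHS]mx_normrE; exact: (le_bigmax _ (fun i => `|v i.1 i.2|) (i, j)). Qed.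

Lemma mx_norm_le_coord (v : 'M[R]_(n, m)) c : 0 <= c -> (forall i j, `|v i j| <= c) -> `|v| <= c.
Proof. by move=> c0 h; rewrite [leLHS]mx_normrE; apply: bigmax_le => // -[i j] _ /=. Qed.

Lemma sum_norm_le (F : 'I_n -> R) c : (forall i, `|F i| <= c) -> `|\sum_i F i| <= n%:R * c.
Proof.
move=> h; apply: (le_trans (ler_norm_sum _ _ _)).
apply: (@le_trans _ _ (\sum_(i < n) c)); first exact: ler_sum.
by rewrite sumr_const card_ord mulr_natl.
Qed.

Lemma C2b_matrix (sigma : 'rV[R]_m -> 'M[R]_(n, m)) : (forall i j, C2b (fun x => sigma x i j)) ->
  exists2 L, 0 <= L & (forall x y, `|sigma x - sigma y| <= L * `|x - y|) /\
  (forall x y x' y', `|sigma x - sigma y - (sigma x' - sigma y')| <=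
     L * `|(x - y) - (x' - y')| + L * `|x - y| * `|y - y'|).
Proof.
move=> hs.
have [L L0 h] : exists2 L, 0 <= L & forall p : 'I_n * 'I_m,
    (forall x y, `|sigma x p.1 p.2 - sigma y p.1 p.2| <= L * `|x - y|) /\
    (forall x y x' y', `|sigma x p.1 p.2 - sigma y p.1 p.2 - (sigma x' p.1 p.2 - sigma y' p.1 p.2)|
      <= L * `|(x - y) - (x' - y')| + L * `|x - y| * `|y - y'|).
  apply: fin_bound => [p c c' [h1 h2] cc|[i j]].
    split=> [x y|x y x' y']; first by apply: (le_trans (h1 x y)); rewrite ler_wpM2r.
    apply: (le_trans (h2 x y x' y')); apply: lerD; first by rewrite ler_wpM2r.
    by rewrite -!mulrA ler_wpM2r// mulr_ge0.
  by have [L _ h] := C2b_four_point (hs i j); exists L.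
exists L => //; split=> [x y|x y x' y'].
  by apply: mx_norm_le_coord => [|i j]; [rewrite mulr_ge0|rewrite !mxE; exact: (h (i, j)).1].
apply: mx_norm_le_coord => [|i j]; first by rewrite addr_ge0 ?mulr_ge0.
by rewrite !mxE; exact: (h (i, j)).2.
Qed.

End matrix_norm.

(** * Young convolutional integrals of matrix paths and their Volterra operator *)

Section deterministic.
Context {R : realType}.
Variables (phi : R -> R) (gamma T K : R) (n : nat) (A : 'I_n -> R -> R -> R).
Local Notation Pos := (`]0%R, +oo[%classic : set R).
Local Notation NN := (`[0%R, +oo[%classic : set R).
Local Notation mu := (@lebesgue_measure R).
Hypotheses (T0 : 0 < T) (g12 : 1 / 2 < gamma) (g1 : gamma <= 1) (K0 : 0 <= K).
Hypothesis mphi : measurable_fun Pos phi.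
Hypothesis fphi : (\int[mu]_(xi in Pos) (`|phi xi| * (1 + xi `^ gamma))%:E < +oo)%E.
Hypothesis hA : forall i, conv_holder gamma K T (A i).
Hypothesis A0 : forall i x, A i 0 x = 0.
Hypothesis mA : forall i t, 0 <= t -> t <= T -> measurable_fun NN (A i t).
Local Notation M0 := (Mphi phi gamma).

Let g0 : 0 < gamma. Proof. by move: g12 => ?; lra. Qed.
Let M00 : 0 <= M0. Proof. exact: Mphi_ge0. Qed.

Definition arow (t x : R) : 'rV[R]_n := \row_i A i t x.
Definition xrow (t s x : R) : 'rV[R]_n := \row_i dconv (A i) t s x.

Lemma xrowE t s : xrow t s = dtilde1 arow t s.
Proof. by apply/funext => x; rewrite dtilde1E; apply/rowP => i; rewrite !mxE. Qed.

Lemma xrow_inC2gamma : inC2gamma phi gamma T xrow.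
Proof.
rewrite (_ : xrow = (fun t s => dtilde1 arow t s)); last first.
  by apply/funext => t; apply/funext => s; exact: xrowE.
apply: (@rowpath_inC2gamma _ phi gamma T g12 mphi fphi n arow K (K * T `^ gamma)) => //.
- by rewrite mulr_ge0// powR_ge0.
- move=> t t0 tT j; rewrite (_ : (fun _ => _) = A j t); first exact: mA.
  by apply/funext => x; rewrite mxE.
- move=> t x t0 tT x0; apply: norm_le_coord => [|j]; first by rewrite mulr_ge0// powR_ge0.
  by rewrite mxE; apply: (conv_holder_sup (ltW g0) K0 (hA j)).
- move=> s t x s0 st tT x0; apply: norm_le_coord => [|j]; first by rewrite mulr_ge0// powR_ge0.
  by rewrite -xrowE mxE; exact: hA.
Qed.

Lemma xrow_chen t u s : Leq phi gamma (dtilde2 xrow t u s) (fun _ => 0).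
Proof.
apply: N0 => // x x0; rewrite subr0 dtilde2E !xrowE.
exact: dtilde2_dtilde1.
Qed.

Section volterra.
Variable m : nat.
Implicit Types (z : R -> 'M[R]_(n, m)).
Local Notation W := (whold T gamma).

Definition yrow z (t x : R) : 'rV[R]_m := \row_j \sum_i yconv T (A i) (fun u => z u i j) t x.
Definition volt z (t : R) : 'rV[R]_m := phi_int phi (yrow z t).

Lemma measurable_yconv i (y : R -> R) B t : 0 <= B -> holder gamma B T y -> 0 <= t -> t <= T ->
  measurable_fun NN (yconv T (A i) y t).
Proof.
move=> B0 hy t0 tT.
apply: (measurable_fun_cvg (h := fun k x => rsum T x (ygerm (A i) y x) t k)); last first.
  move=> x; rewrite /= in_itv/= andbT => x0.
  exact: (yconv_cvg T0 g12 g1 K0 (hA i) x0 (lexx T) B0 hy).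
move=> k; rewrite /rsum /psum.
rewrite (_ : (fun x => _) = (fun x => \sum_(j < gidx T k t) damp x t (pt T k j.+1) *
    ygerm (A i) y x (pt T k j.+1) (pt T k j))); last by apply/funext => x; rewrite big_mkord.
apply: measurable_sum => j.
have /andP[ht _] := gidxP T0 k t0.
have j1 : pt T k j.+1 <= T by apply: le_trans tT; apply: le_trans ht; exact: pt_le.
have j0 : pt T k j <= T by apply: le_trans j1; exact: pt_le.
apply: measurable_funM; first exact: measurable_damp.
apply: measurable_funM; last exact: measurable_cst.
apply: measurable_funB; first by apply: mA => //; exact: pt_ge0.
apply: measurable_funM; first exact: measurable_damp.
by apply: mA => //; exact: pt_ge0.
Qed.

Lemma whold0_coord B z i j : W 0 B z -> holder gamma B T (fun u => z u i j).
Proof.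
move=> h s t s0 st tT; have := h s t s0 st tT; rewrite mul0r expR0 mulr1; apply: le_trans.
by have := mx_coord_le_norm (z t - z s) i j; rewrite !mxE.
Qed.

Lemma dtilde1_yrow z t s x j :
  dtilde1 (yrow z) t s x 0 j = \sum_i dconv (yconv T (A i) (fun u => z u i j)) t s x.
Proof. by rewrite dtilde1E !mxE mulr_sumr -sumrB. Qed.

Lemma mrow_yrow B z t : 0 <= B -> W 0 B z -> 0 <= t -> t <= T -> mrow (yrow z t).
Proof.
move=> B0 hz t0 tT j.
rewrite (_ : (fun _ => _) = (fun x => \sum_i yconv T (A i) (fun u => z u i j) t x)); last first.
  by apply/funext => x; rewrite mxE.
apply: measurable_sum => i.
by apply: (measurable_yconv i B0 _ t0 tT); exact: whold0_coord.
Qed.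

Lemma yrow_bound B z : 0 <= B -> W 0 B z -> exists C M, [/\ 0 <= C, 0 <= M,
  (forall t x, 0 <= t -> t <= T -> 0 <= x -> `|yrow z t x| <= M) &
  (forall s t x, 0 <= s -> s <= t -> t <= T -> 0 <= x ->
     `|dtilde1 (yrow z) t s x| <= C * (t - s) `^ gamma)].
Proof.
move=> B0 hz.
pose C1 := K * (`|z 0| + (1 + Csew (2 * gamma)) * B * T `^ gamma).
have Cs := Csew_ge0 g12.
have C10 : 0 <= C1.
  rewrite mulr_ge0// addr_ge0// mulr_ge0 ?powR_ge0// mulr_ge0// addr_ge0//.
have hy i j : conv_holder gamma C1 T (yconv T (A i) (fun u => z u i j)).
  move=> x s t x0 s0 st tT.
  apply: (le_trans (yconv_holder T0 g12 g1 K0 (hA i) B0 (whold0_coord i j hz) x0 s0 st tT)).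
  rewrite ler_wpM2r ?powR_ge0// ler_wpM2l// lerD2r; exact: mx_coord_le_norm.
clearbody C1.
exists (n%:R * C1), (n%:R * (C1 * T `^ gamma)); split.
- by rewrite mulr_ge0.
- by rewrite !mulr_ge0// powR_ge0.
- move=> t x t0 tT x0; apply: norm_le_coord => [|j]; first by rewrite !mulr_ge0// powR_ge0.
  rewrite mxE; apply: sum_norm_le => i.
  apply: (conv_holder_sup (ltW g0) C10 (hy i j)) => // x'; exact: yconv0.
- move=> s t x s0 st tT x0; apply: norm_le_coord => [|j]; first by rewrite !mulr_ge0// powR_ge0.
  by rewrite dtilde1_yrow -mulrA; apply: sum_norm_le => i; exact: hy.
Qed.

Lemma yrow0 z x : yrow z 0 x = 0.
Proof. by apply/rowP => j; rewrite !mxE big1// => i _; exact: yconv0. Qed.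

Lemma yrow_inL B z t : 0 <= B -> W 0 B z -> 0 <= t -> t <= T -> inL phi gamma (yrow z t).
Proof.
move=> B0 hz t0 tT; have [C [M [_ _ h _]]] := yrow_bound B0 hz.
by apply: (inL_bound mphi fphi (C := M)) => [|x x0]; [exact: mrow_yrow hz t0 tT|exact: h].
Qed.

Lemma yrow_inC1gamma B z : 0 <= B -> W 0 B z -> inC1gamma phi gamma T (yrow z).
Proof.
move=> B0 hz; have [C [M [C0 M1 h1 h2]]] := yrow_bound B0 hz.
apply: (@rowpath_inC1gamma _ phi gamma T g12 mphi fphi m (yrow z) C M) => //.
by move=> t t0 tT; exact: mrow_yrow hz t0 tT.
Qed.

Lemma volt0 z : volt z 0 = 0.
Proof.
apply/rowP => j; rewrite !mxE.
rewrite integral0_eq// => x _.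
by rewrite yrow0 mxE mulr0.
Qed.

Lemma voltB B z s t : 0 <= B -> W 0 B z -> 0 <= s -> s <= t -> t <= T ->
  volt z t - volt z s = phi_int phi (fun x => yrow z t x - yrow z s x).
Proof.
move=> B0 hz s0 st tT.
have Lt := yrow_inL B0 hz (le_trans s0 st) tT.
by rewrite (phi_intB mphi Lt (yrow_inL B0 hz s0 (le_trans st tT))).
Qed.

(** The bound of [young_weighted_incr] is a multiple of [1 + x^gamma] whose time factor does not
    depend on [x], so integration against [phi] keeps the weight and the gain. *)
Lemma volt_weighted lam B z : 1 <= lam -> 0 <= B -> z 0 = 0 -> W lam B z ->
  W lam ((n%:R * (Cyoung gamma * K) * M0) * lam^-1 `^ gamma * B) (volt z).
Proof.
move=> l1 B0 z0 hz s t s0 st tT.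
have l0 : 0 <= lam by apply: le_trans l1.
have Be : 0 <= B * expR (lam * T) by rewrite mulr_ge0// expR_ge0.
have hz0 := whold_restrict B0 l0 hz.
have Cy := Cyoung_ge0 g12.
rewrite (voltB Be hz0 s0 st tT).
pose c := Cyoung gamma * (K * B) * lam^-1 `^ gamma * expR (lam * t) * (t - s) `^ gamma.
have c0 : 0 <= c.
  rewrite /c; apply: mulr_ge0; last exact: powR_ge0.
  apply: mulr_ge0; last exact: expR_ge0.
  by apply: mulr_ge0; [exact: (mulr_ge0 Cy (mulr_ge0 K0 B0))|exact: powR_ge0].
have -> : n%:R * (Cyoung gamma * K) * M0 * lam^-1 `^ gamma * B * expR (lam * t) * (t - s) `^ gamma
  = n%:R * c * M0 by rewrite /c; ring.
have nc0 := mulr_ge0 (ler0n R n) c0.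
apply: norm_le_coord => [|j]; first exact: (mulr_ge0 nc0 M00).
apply: (phi_int_bound mphi fphi nc0).
  by apply: mrowB; apply: (mrow_yrow Be hz0); rewrite ?(le_trans s0 st) ?(le_trans st tT).
move=> x x0; rewrite !mxE -sumrB -mulrA; apply: sum_norm_le => i.
apply: (young_weighted_incr T0 g12 g1 K0 (hA i) l1 B0 _ _ x0 s0 st tT); first by rewrite z0 mxE.
move=> s' t' s'0 st' tT'; have := hz s' t' s'0 st' tT'; apply: le_trans.
by have := mx_coord_le_norm (z t' - z s') i j; rewrite !mxE.
Qed.

Lemma volt_holder B z : 0 <= B -> W 0 B z -> exists2 B', 0 <= B' & W 0 B' (volt z).
Proof.
move=> B0 hz; have [C [M [C0 M1 h1 h2]]] := yrow_bound B0 hz.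
exists ((C + M) * M0); first by rewrite mulr_ge0// addr_ge0.
move=> s t s0 st tT; rewrite mul0r expR0 mulr1 (voltB B0 hz s0 st tT).
have p0 := powR_ge0 (t - s) gamma.
rewrite mulrAC.
have c0 : 0 <= (C + M) * (t - s) `^ gamma by rewrite mulr_ge0// addr_ge0.
apply: norm_le_coord => [|j]; first by rewrite mulr_ge0.
apply: (phi_int_bound mphi fphi) => //.
  by apply: mrowB; apply: (mrow_yrow B0 hz); rewrite ?(le_trans s0 st) ?(le_trans st tT).
move=> x x0; apply: (le_trans (coord_le_norm _ _)).
have -> : yrow z t x - yrow z s x = dtilde1 (yrow z) t s x - (1 - damp x t s) *: yrow z s x.
  by rewrite dtilde1E scalerBl scale1r opprB addrA subrK.
apply: (le_trans (ler_normB _ _)).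
have i1 := h2 s t x s0 st tT x0.
have i2 : `|(1 - damp x t s) *: yrow z s x| <= x `^ gamma * (t - s) `^ gamma * M.
  rewrite normrZ ger0_norm ?one_damp_ge0//; apply: ler_pM => //; first exact: one_damp_ge0.
    by apply: one_damp_powR => //; rewrite g0 g1.
  by apply: h1 => //; exact: le_trans tT.
have q0 := powR_ge0 x gamma.
have i3 := mulr_ge0 M1 p0; have i4 := mulr_ge0 (mulr_ge0 C0 p0) q0.
by move: i1 i2 i3 i4; lra.
Qed.

Lemma yrow_sub B B' z z' t x : 0 <= B -> 0 <= B' -> W 0 B z -> W 0 B' z' ->
  0 <= x -> 0 <= t -> t <= T ->
  yrow (fun u => z u - z' u) t x = yrow z t x - yrow z' t x.
Proof.
move=> B0 B'0 hz hz' x0 t0 tT; apply/rowP => j; rewrite !mxE -sumrB; apply: eq_bigr => i _.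
rewrite -(yconvB T0 g12 g1 K0 (hA i) B0 B'0 (whold0_coord i j hz) (whold0_coord i j hz') x0 t0 tT).
by congr yconv; apply/funext => u; rewrite !mxE.
Qed.

Lemma yrow_ext z z' t x : 0 <= t -> t <= T ->
  (forall u, 0 <= u -> u <= T -> z u = z' u) -> yrow z t x = yrow z' t x.
Proof.
move=> t0 tT e; apply/rowP => j; rewrite !mxE; apply: eq_bigr => i _.
by apply: yconv_ext => // u u0 uT; rewrite e.
Qed.

Lemma volt_sub lam lam' B B' z z' : 0 <= lam -> 0 <= lam' -> 0 <= B -> 0 <= B' ->
  W lam B z -> W lam' B' z' -> forall t, 0 <= t -> t <= T ->
  volt (fun u => z u - z' u) t = volt z t - volt z' t.
Proof.
move=> l0 l'0 B0 B'0 hz hz' t t0 tT.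
have {hz}hz := whold_restrict B0 l0 hz.
have {hz'}hz' := whold_restrict B'0 l'0 hz'.
have Be : 0 <= B * expR (lam * T) by rewrite mulr_ge0// expR_ge0.
have Be' : 0 <= B' * expR (lam' * T) by rewrite mulr_ge0// expR_ge0.
rewrite /volt -(phi_intB mphi (yrow_inL Be hz t0 tT) (yrow_inL Be' hz' t0 tT)).
apply/rowP => j; rewrite !mxE; congr fine; apply: eq_integral => x.
move=> /set_mem; rewrite /= in_itv/= andbT => x0.
by rewrite (yrow_sub Be Be' hz hz')//; exact: ltW.
Qed.

(** The remainder is the sewing error, of exponent [2 gamma]. That its [dtilde2] equals [h] is an
    identity, because [dtilde2] kills both [xrow] and [dtilde1 (yrow z)]. *)
Lemma yrow_conv_young B z : 0 <= B -> W 0 B z ->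
  conv_young phi gamma T xrow z (fun t s => dtilde1 (yrow z) t s).
Proof.
move=> B0 hz; have [C [M [C0 M1 h1 h2]]] := yrow_bound B0 hz.
have hzij i j := whold0_coord i j hz.
have Cs := Csew_ge0 g12.
split.
  exists B => i j s t /andP[s0 sT] /andP[t0 tT].
  have [st|ts] := leP s t.
    by rewrite (ger0_norm (x := t - s)) ?subr_ge0//; exact: hzij.
  rewrite distrC (distrC t) (ger0_norm (x := s - t)) ?subr_ge0 ?(ltW ts)//.
  by apply: (hzij i j) => //; exact: ltW.
exists (2 * gamma); split; first by move: g12 => ?; lra.
have hxz t u s x : 0 <= x -> 0 <= s -> s <= u -> u <= t -> t <= T ->
    `|xrow t u x *m (z u - z s)| <= n%:R * (K * B) * (t - s) `^ (2 * gamma).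
  move=> x0 s0 su ut tT; have u0 := le_trans s0 su.
  apply: norm_le_coord => [|j]; first by rewrite mulr_ge0 ?powR_ge0// mulr_ge0// mulr_ge0.
  rewrite mxE -mulrA; apply: sum_norm_le => i.
  rewrite !mxE normrM powR_sqr//; last by rewrite subr_ge0 (le_trans su).
  rewrite mulrACA; apply: ler_pM => //.
    apply: (le_trans (hA i x0 u0 ut tT)); rewrite ler_wpM2l//.
    by apply: powR_mono; [exact: ltW|rewrite subr_ge0|lra].
  apply: (le_trans (hzij i j s u s0 su (le_trans ut tT))); rewrite ler_wpM2l//.
  by apply: powR_mono; [exact: ltW|rewrite subr_ge0|lra].
split.
  exists (n%:R * (K * B) * M0) => t u s s0 su ut st tT.
  rewrite mulrAC; apply: Nphi_bound => //; first by rewrite mulr_ge0 ?powR_ge0// mulr_ge0// mulr_ge0.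
  by move=> x x0; exact: hxz.
have nCs := mulr_ge0 (ler0n R n) (mulr_ge0 Cs (mulr_ge0 K0 B0)).
have lam_le t s x : 0 <= x -> 0 <= s -> s <= t -> t <= T ->
   `|dtilde1 (yrow z) t s x - xrow t s x *m z s| <=
     n%:R * (Csew (2 * gamma) * (K * B)) * (t - s) `^ (2 * gamma).
  move=> x0 s0 st tT; apply: norm_le_coord => [|j].
    exact: (mulr_ge0 nCs (powR_ge0 _ _)).
  have -> : (dtilde1 (yrow z) t s x - xrow t s x *m z s) 0 j =
    dtilde1 (yrow z) t s x 0 j - \sum_i dconv (A i) t s x * z s i j.
    rewrite mxE; congr (_ + _); rewrite mxE; congr (- _).
    by rewrite mxE; apply: eq_bigr => i _; rewrite mxE.
  rewrite dtilde1_yrow -sumrB -mulrA; apply: sum_norm_le => i.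
  exact: (yconv_germ T0 g12 g1 K0 (hA i) x0 (lexx T) B0 (hzij i j) s0 st tT).
have mxz t s : 0 <= s -> s <= t -> t <= T -> mrow (fun x => xrow t s x *m z s).
  move=> s0 st tT j; have t0 := le_trans s0 st; have sT := le_trans st tT.
  rewrite (_ : (fun _ => _) = (fun x => \sum_i dconv (A i) t s x * z s i j)); last first.
    by apply/funext => x; rewrite mxE; apply: eq_bigr => i _; rewrite mxE.
  apply: measurable_sum => i; apply: measurable_funM; last exact: measurable_cst.
  apply: measurable_funB; first exact: mA.
  by apply: measurable_funM; [exact: measurable_damp|exact: mA].
split.
  move=> t s [s0 [st tT]].
  apply: (inL_bound mphi fphi (C := n%:R * (Csew (2 * gamma) * (K * B)) * (t - s) `^ (2 * gamma))).
    apply: mrowB; last exact: mxz.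
    by apply: mrow_dtilde1; apply: (mrow_yrow B0 hz); rewrite ?(le_trans s0 st) ?(le_trans st tT).
  by move=> x x0; exact: lam_le.
split.
  exists (n%:R * (Csew (2 * gamma) * (K * B)) * M0) => t s s0 st tT.
  rewrite mulrAC; apply: Nphi_bound => //; first exact: (mulr_ge0 nCs (powR_ge0 _ _)).
  by move=> x x0; apply: lam_le => //; exact: ltW.
move=> t u s s0 su ut tT; apply: N0 => // x x0.
have e : dtilde2 xrow t u s x = 0 by rewrite dtilde2E !xrowE; exact: dtilde2_dtilde1.
have e' := @dtilde2_dtilde1 R m (yrow z) t u s x.
rewrite dtilde2E in e; rewrite dtilde2E in e'.
rewrite dtilde2E.
set Y1 := dtilde1 (yrow z) t s x in e' *; set Y2 := dtilde1 (yrow z) t u x in e' *.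
set Y3 := dtilde1 (yrow z) u s x in e' *.
have -> : xrow t s x = xrow t u x + damp x t u *: xrow u s x.
  by apply/eqP; rewrite -subr_eq0 opprD addrA e.
have -> : Y1 = Y2 + damp x t u *: Y3 by apply/eqP; rewrite -subr_eq0 opprD addrA e'.
rewrite mulmxDl mulmxBr -scalemxAl scalerBr.
by apply/rowP => j; rewrite !mxE; ring.
Qed.

End volterra.
End deterministic.

(** * Existence and uniqueness for the pathwise equation *)

Section solve.
Context {R : realType}.
Variables (phi : R -> R) (gamma T K : R) (n m : nat) (A : 'I_n -> R -> R -> R).
Local Notation Pos := (`]0%R, +oo[%classic : set R).
Local Notation NN := (`[0%R, +oo[%classic : set R).
Local Notation mu := (@lebesgue_measure R).
Hypotheses (T0 : 0 < T) (g12 : 1 / 2 < gamma) (g1 : gamma <= 1) (K0 : 0 <= K).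
Hypothesis mphi : measurable_fun Pos phi.
Hypothesis fphi : (\int[mu]_(xi in Pos) (`|phi xi| * (1 + xi `^ gamma))%:E < +oo)%E.
Hypothesis hA : forall i, conv_holder gamma K T (A i).
Hypothesis mA : forall i t, 0 <= t -> t <= T -> measurable_fun NN (A i t).
Local Notation N := (Nphi phi gamma).
Local Notation W := (whold T gamma).

Let g0 : 0 < gamma. Proof. by move: g12 => ?; lra. Qed.

Lemma hoelder2_exponent k (mu1 mu2 : R) (B : R -> R -> R -> 'rV[R]_k) : mu2 <= mu1 ->
  Defs.hoelder2 phi gamma T mu1 B -> Defs.hoelder2 phi gamma T mu2 B.
Proof.
move=> m12 [C hC]; exists (`|C| * T `^ (mu1 - mu2)) => t s s0 st tT.
have ts : 0 < t - s by rewrite subr_gt0.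
apply: (le_trans (hC t s s0 st tT)); rewrite lee_fin.
have -> : (t - s) `^ mu1 = (t - s) `^ (mu1 - mu2) * (t - s) `^ mu2.
  by rewrite -powRD ?subrK//; apply/implyP => _; rewrite gt_eqF.
rewrite mulrA ler_wpM2r ?powR_ge0//.
apply: (@le_trans _ _ (`|C| * (t - s) `^ (mu1 - mu2))).
  by rewrite ler_wpM2r ?powR_ge0// ler_norm.
by rewrite ler_wpM2l//; apply: powR_mono; lra.
Qed.

Lemma inL_mrow k (g : R -> 'rV[R]_k) : inL phi gamma g -> mrow g.
Proof. by case. Qed.

(** The products with [z s] cancel between the two remainders, so their difference is [dtilde1] of
    [Y' - Y]: it lies in the kernel of [dtilde2] and has an exponent above 1. Uniqueness of the
    sewing makes it null, and starting from time 0 this carries the null initial value to all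
    [t]. *)
Lemma conv_young_unique (z : R -> 'M[R]_(n, m)) B (Y' : R -> R -> 'rV[R]_m) :
  0 <= B -> W 0 B z -> inC1 phi gamma T Y' -> Leq phi gamma (Y' 0) (fun _ => 0) ->
  conv_young phi gamma T (xrow A) z (fun t s xi => dtilde1 Y' t s xi) ->
  forall t, 0 <= t -> t <= T -> Leq phi gamma (Y' t) (yrow T A z t).
Proof.
move=> B0 hz [LY' _] Y'0 [_ [mu1 [mu11 [_ [LLam [hLam dLam]]]]]].
have [_ [mu2 [mu21 [_ [LLam2 [hLam2 dLam2]]]]]] :=
  yrow_conv_young T0 g12 g1 K0 mphi fphi hA mA B0 hz.
set Y := yrow T A z in LLam2 hLam2 dLam2 *.
set L1 : R -> R -> R -> 'rV[R]_m := (fun t s xi => dtilde1 Y' t s xi - xrow A t s xi *m z s) in LLam hLam dLam.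
set L2 : R -> R -> R -> 'rV[R]_m := (fun t s xi => dtilde1 Y t s xi - xrow A t s xi *m z s) in LLam2 hLam2 dLam2.
pose Q t s xi : 'rV[R]_m := L1 t s xi - L2 t s xi.
have QE t s xi : Q t s xi = dtilde1 Y' t s xi - dtilde1 Y t s xi.
  by rewrite /Q /L1 /L2 opprB addrA subrK.
have mY' t : 0 <= t -> t <= T -> mrow (Y' t).
  by move=> t0 tT; apply: inL_mrow; apply: LY'; rewrite t0.
have mY t : 0 <= t -> t <= T -> mrow (Y t).
  by move=> t0 tT; exact: (mrow_yrow T0 g12 g1 K0 hA mA B0 hz).
have mL1 t s : 0 <= s -> s <= t -> t <= T -> mrow (L1 t s).
  by move=> s0 st tT; apply: inL_mrow; apply: LLam.
have mL2 t s : 0 <= s -> s <= t -> t <= T -> mrow (L2 t s).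
  by move=> s0 st tT; apply: inL_mrow; apply: LLam2.
have mu3 : 1 < Num.min mu1 mu2 by rewrite lt_min mu11.
have mQ t s : 0 <= s -> s <= t -> t <= T -> mrow (Q t s).
  by move=> s0 st tT; apply: mrowB; [exact: mL1|exact: mL2].
have hQ : Defs.hoelder2 phi gamma T (Num.min mu1 mu2) Q.
  have le1 : Num.min mu1 mu2 <= mu1 by rewrite ge_min lexx.
  have le2 : Num.min mu1 mu2 <= mu2 by rewrite ge_min lexx orbT.
  have [C1 h1] := hoelder2_exponent le1 hLam.
  have [C2 h2] := hoelder2_exponent le2 hLam2.
  exists (C1 + C2) => t s s0 st tT.
  apply: (@le_trans _ _ (N (L1 t s) + N (L2 t s))%E).
    apply: (@Nphi_triangle R phi gamma mphi m m m (L1 t s) (L2 t s) (Q t s)); [exact: (mL1 _ _ s0 (ltW st) tT)|exact: (mL2 _ _ s0 (ltW st) tT)|].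
    by move=> xi _; exact: ler_normB.
  by rewrite mulrDl EFinD; apply: leeD; [exact: h1|exact: h2].
have dQ t u s : 0 <= s -> s <= u -> u <= t -> t <= T -> N (dtilde2 Q t u s) = 0%E.
  move=> s0 su ut tT; apply: N0 => // xi xi0.
  have e1 := @dtilde2_dtilde1 R m Y' t u s xi; have e2 := @dtilde2_dtilde1 R m Y t u s xi.
  rewrite dtilde2E in e1; rewrite dtilde2E in e2.
  rewrite dtilde2E !QE -[RHS](subrr 0) -{1}e1 -e2.
  by apply/rowP => j; rewrite !mxE; ring.
have QN := sewing_unique mphi mu3 mQ hQ dQ.
move=> t; rewrite le_eqVlt => /orP[/eqP <- _|t0 tT].
  rewrite /Leq -[RHS]Y'0; apply: Nphi_ext => xi _.
  by rewrite /Y yrow0.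
have t00 := ltW t0.
apply/le_anti; rewrite Nphi_ge0 andbT.
apply: (@le_trans _ _ (N (Q t 0%R) + N (Y' 0%R))%E); last first.
  rewrite QN// add0e -Y'0; apply: Nphi_mono => xi _; by rewrite subr0.
apply: (@Nphi_triangle R phi gamma mphi m m m (Q t 0) (Y' 0)); [exact: mQ|by apply: mY' => //; exact: ltW|].
move=> xi xi0.
have -> : Y' t xi - Y t xi = Q t 0 xi + damp xi t 0 *: Y' 0 xi.
  have Yz : Y 0 xi = 0 by exact: yrow0.
  by rewrite QE !dtilde1E Yz scaler0 subr0 addrAC subrK.
apply: (le_trans (ler_normD _ _)); rewrite lerD2l normrZ (ger0_norm (ltW (damp_gt0 _ _ _))).
by rewrite ler_piMl// damp_le1.
Qed.

Lemma hoelder_mx_whold (z : R -> 'M[R]_(n, m)) : hoelder_mx gamma T z -> exists2 B, 0 <= B & W 0 B z.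
Proof.
move=> [C hC]; exists `|C| => // s t s0 st tT; rewrite mul0r expR0 mulr1.
apply: mx_norm_le_coord => [|i j]; first by rewrite mulr_ge0// powR_ge0.
rewrite !mxE; apply: (le_trans (hC i j s t _ _)).
- by rewrite s0 (le_trans st).
- by rewrite tT (le_trans s0).
- by rewrite (ger0_norm (x := t - s)) ?subr_ge0// ler_wpM2r ?powR_ge0// ler_norm.
Qed.

(** The fixed-point equation is known on [[0, T]] only, so the integrand of the equation agrees
    there, and there alone, with [sigma (a u)]. *)
Lemma conv_young_ext (z z' : R -> 'M[R]_(n, m)) (J : R -> R -> R -> 'rV[R]_m) :
  (forall u, 0 <= u -> u <= T -> z u = z' u) ->
  conv_young phi gamma T (xrow A) z J -> conv_young phi gamma T (xrow A) z' J.
Proof.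
move=> e [[B hB] [mu' [mu1 [[C hC] [hL [[D hD] hd]]]]]].
split.
  by exists B => i j s t hs ht; move: (hs) (ht) => /andP[? ?] /andP[? ?]; rewrite -!e//; exact: hB.
exists mu'; split; first exact: mu1.
split.
  exists C => t u s s0 su ut st tT.
  rewrite -!e ?(le_trans s0 su) ?(le_trans ut tT) ?(le_trans su (le_trans ut tT))//.
  exact: hC.
split.
  move=> t s hts; have := hL t s hts; have [s0 [st tT]] := hts.
  by rewrite e// (le_trans st).
split.
  exists D => t s s0 st tT; rewrite -e// ?(le_trans (ltW st))//.
  exact: hD.
move=> t u s s0 su ut tT.
have h := hd t u s s0 su ut tT.
have u0 := le_trans s0 su; have uT := le_trans ut tT; have sT := le_trans su uT.
rewrite /Leq /dtilde2 in h *.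
by rewrite -!e.
Qed.

Theorem rde_solution (sigma : 'rV[R]_m -> 'M[R]_(n, m)) (a0 : 'rV[R]_m) :
  (forall i j, C2b (fun x => sigma x i j)) ->
  exists Y : R -> R -> 'rV[R]_m, solves_rde phi gamma T (xrow A) sigma a0 Y /\
    forall Y', solves_rde phi gamma T (xrow A) sigma a0 Y' ->
    forall t, 0 <= t <= T -> Leq phi gamma (Y' t) (Y t).
Proof.
move=> hs; have [L L0 [lip four]] := C2b_matrix hs.
pose V := volt phi T A (m := m).
pose C := n%:R * (Cyoung gamma * K) * Mphi phi gamma.
have C0 : 0 <= C.
  exact: (mulr_ge0 (mulr_ge0 (ler0n R n) (mulr_ge0 (Cyoung_ge0 g12) K0)) (Mphi_ge0 _ _)).
have V0 z : V z 0 = 0 by exact: volt0.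
have Vc lam B z : 1 <= lam -> 0 <= B -> z 0 = 0 -> W lam B z ->
    W lam (C * lam^-1 `^ gamma * B) (V z).
  exact: (volt_weighted T0 g12 g1 K0 mphi fphi hA mA).
have Vcst c : exists2 B, 0 <= B & W 0 B (V (fun=> c)).
  by apply: (volt_holder T0 g12 g1 K0 mphi fphi hA mA (lexx 0)); exact: whold_cst.
have VB := volt_sub T0 g12 g1 K0 mphi fphi hA mA (m := m).
have [a [M [M0 ha ea]]] := picard_exists a0 T0 g0 L0 C0 V0 Vc Vcst VB lip four.
have uniq := picard_unique (a0 := a0) T0 g0 L0 C0 V0 Vc VB lip four.
have LM : 0 <= L * M by rewrite mulr_ge0.
have hz : W 0 (L * M) (fun u => sigma (a u)) := sigma_whold L0 lip ha.
exists (yrow T A (fun u => sigma (a u))); split.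
  split; first exact: (yrow_inC1gamma T0 g12 g1 K0 mphi fphi hA mA LM hz).
  split; first by apply: N0 => // xi _; rewrite yrow0 subr0.
  have cy := yrow_conv_young T0 g12 g1 K0 mphi fphi hA mA LM hz.
  set z := fun s => sigma _.
  have ez u : 0 <= u -> u <= T -> sigma (a u) = z u by move=> u0 uT; rewrite /z [in LHS]ea.
  exact: (conv_young_ext ez cy).
move=> Y' [[iC1 _] [Y'0 cy]] t /andP[t0 tT].
(* The relation [conv_young] makes the integrand of [Y'] Hölder and determines the integral, so [Y']
   is [yrow] of its own integrand up to [Leq]. Hence [a'] is a fixed point, in some ball that
   depends on [Y']. *)
pose a' u := a0 + phi_int phi (Y' u).
have [B B0 hz'] := hoelder_mx_whold cy.1.
have eY := conv_young_unique B0 hz' iC1 Y'0 cy.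
have ea' u : 0 <= u -> u <= T -> a' u = Gam V sigma a0 a' u.
  move=> u0 uT; rewrite /a' /Gam; congr (_ + _).
  apply: (Leq_phi_int mphi (gamma := gamma)); first by apply: iC1.1; rewrite u0.
    exact: (yrow_inL T0 g12 g1 K0 mphi fphi hA mA B0 hz').
  exact: eY.
have [B' B'0 hV] := volt_holder T0 g12 g1 K0 mphi fphi hA mA B0 hz'.
have ha' : W 0 B' a'.
  apply: (@whold_ext _ _ _ _ _ _ (Gam V sigma a0 a')); first by move=> u u0 uT; rewrite -ea'.
  by move=> s u s0 su uT; rewrite /Gam opprD addrACA subrr add0r; exact: hV.
have haM : W 0 (M + B') a by apply: whold_mono ha => //; rewrite lerDl.
have ha'M : W 0 (M + B') a' by apply: whold_mono ha' => //; rewrite lerDr.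
have aa := uniq _ _ _ (addr_ge0 M0 B'0) haM ha'M ea ea'.
rewrite /Leq -[RHS](eY t t0 tT); apply: Nphi_ext => xi _; congr (_ - _).
by apply: yrow_ext => // u u0 uT; rewrite aa.
Qed.

End solve.

(** * Gaussian moments and Hölder versions *)

Section density.
Context d (T : measurableType d) (R : realType).
Variables (mu nu : {measure set T -> \bar R}) (g : T -> R).
Hypotheses (mg : measurable_fun setT g) (g0 : forall x, 0 <= g x).
Hypothesis nuE : forall A, measurable A -> nu A = (\int[mu]_(x in A) (g x)%:E)%E.
Import HBNNSimple.

(** Each simple function below [f] has the same integral against [nu] and against the density, and
    the right side bounds all of these. *)
Lemma integral_density_le (f : T -> R) : (forall x, 0 <= f x) ->
  (\int[nu]_x (f x)%:E <= \int[mu]_x (f x * g x)%:E)%E.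
Proof.
move=> f0; rewrite ge0_integralTE; last by move=> x; rewrite lee_fin.
apply: ge_ereal_sup => _ [h hf <-].
apply: (@le_trans _ _ (\int[mu]_x (h x * g x)%:E)%E); last first.
  apply: ge0_le_integral_sup => x _; rewrite lee_fin ?mulr_ge0//.
  by rewrite ler_wpM2r// -lee_fin; exact: hf.
have fin : finite_set (range h) by [].
rewrite sintegralE fsbig_finite//.
have hE x : ((h x * g x)%:E = \sum_(y <- fset_set (range h))
    (y%:E * (g x * \1_(h @^-1` [set y]) x)%:E))%E.
  rewrite [in LHS]fimfunE fsbig_finite//= sumEFin big_distrl/=; congr EFin.
  by apply: eq_bigr => y _; ring.
under eq_integral do rewrite hE.
have mgi y : measurable_fun setT (fun x => (g x * \1_(h @^-1` [set y]) x)%:E).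
  by apply/measurable_EFinP; apply: measurable_funM => //; exact: measurable_indic.
have gi0 y x : (0 <= (g x * \1_(h @^-1` [set y]) x)%:E)%E.
  by rewrite lee_fin mulr_ge0// indicE.
rewrite ge0_integral_sum//; last 2 first.
- by move=> y; apply: emeasurable_funM => //; exact: measurable_cst.
- move=> y x _; have := nnfun_muleindic_ge0 h y x.
  by rewrite -!EFinM !lee_fin => h0; rewrite mulrCA mulr_ge0.
rewrite le_eqVlt; apply/orP; left; apply/eqP.
rewrite big_seq [RHS]big_seq; apply: eq_bigr => y.
rewrite in_fset_set// => /set_mem[x0 _ <-].
rewrite ge0_integralZl_EFin//; congr (_ * _)%E.
rewrite nuE// integral_mkcond; apply: eq_integral => x _.
rewrite /patch indicE; case: ifP => _; first by rewrite mulr1.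
by rewrite mulr0.
Qed.
End density.

Section gaussian.
Context {R : realType}.
Local Notation mu := (@lebesgue_measure R).

(** This is [u <= exp(u)] at [u = y / (k + 1)], raised to the power [k + 1]. *)
Lemma powX_le_expR (y : R) k : 0 <= y -> y ^+ k.+1 <= k.+1%:R ^+ k.+1 * expR y.
Proof.
move=> y0; have k0 : 0 < k.+1%:R :> R by [].
have e : y / k.+1%:R <= expR (y / k.+1%:R).
  by apply: le_trans (expR_ge1Dx _); rewrite lerDr.
have h : (y / k.+1%:R) ^+ k.+1 <= expR y.
  have -> : expR y = expR (y / k.+1%:R) ^+ k.+1.
    by rewrite -expRM_natl; congr expR; rewrite mulrC divfK// gt_eqF.
  by apply: lerXn2r; rewrite ?nnegrE ?expR_ge0// divr_ge0// ltW.
by rewrite mulrC -ler_pdivrMr ?exprn_gt0// -expr_div_n.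
Qed.

Definition Cmoment k : R := (4 * k.+1%:R) ^+ k.+1 * Num.sqrt 2.

Lemma Cmoment_ge0 k : 0 <= Cmoment k.
Proof. by rewrite mulr_ge0 ?sqrtr_ge0// exprn_ge0// mulr_ge0. Qed.

(** With [y = x^2 / (4 s^2)] the exponential is [exp(- y) exp(- y)]. One factor absorbs the
    polynomial, the other is the density of variance [2 s^2] up to [sqrt 2], so the moment bound
    needs only that a density has mass one. *)
Lemma normal_pdf_moment (s x : R) k : 0 < s ->
  (x ^+ 2) ^+ k.+1 * normal_pdf 0 s x <= Cmoment k * (s ^+ 2) ^+ k.+1 * normal_pdf 0 (Num.sqrt 2 * s) x.
Proof.
move=> s0; have q0 : 0 < Num.sqrt 2 :> R by rewrite sqrtr_gt0.
have qs0 : Num.sqrt 2 * s != 0 by rewrite mulf_neq0// gt_eqF.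
have s20 : 0 < s ^+ 2 by rewrite exprn_gt0.
rewrite !normal_pdfE ?gt_eqF ?mulr_gt0//=.
have pk : normal_peak (Num.sqrt 2 * s) = normal_peak s / Num.sqrt 2.
  rewrite /normal_peak exprMn sqr_sqrtr//.
  have -> : 2 * s ^+ 2 * pi *+ 2 = 2 * (s ^+ 2 * pi *+ 2) :> R by rewrite !mulr2n; ring.
  by rewrite sqrtrM// invfM mulrC.
have p0 := normal_peak_ge0 s.
have nf : normal_fun 0 (Num.sqrt 2 * s) x = expR (- x ^+ 2 / ((2 * s ^+ 2) *+ 2)).
  by rewrite /normal_fun subr0 [(_ * s) ^+ 2]exprMn sqr_sqrtr.
rewrite pk nf {nf} /normal_fun subr0.
set y := x ^+ 2 / (s ^+ 2 * 4).
have y0 : 0 <= y by rewrite divr_ge0 ?sqr_ge0// mulr_ge0// ltW.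
have -> : - x ^+ 2 / (s ^+ 2 *+ 2) = - y - y.
  by rewrite /y; field; exact: lt0r_neq0.
have -> : - x ^+ 2 / ((2 * s ^+ 2) *+ 2) = - y.
  by rewrite /y; field; exact: lt0r_neq0.
have -> : x ^+ 2 = 4 * s ^+ 2 * y by rewrite /y; field; exact: lt0r_neq0.
have h := powX_le_expR k y0.
rewrite expRD exprMn.
have -> : (4 * s ^+ 2) ^+ k.+1 * y ^+ k.+1 * (normal_peak s * (expR (- y) * expR (- y))) =
  ((4 * s ^+ 2) ^+ k.+1 * normal_peak s * expR (- y)) * (y ^+ k.+1 * expR (- y)) by ring.
have -> : Cmoment k * (s ^+ 2) ^+ k.+1 * (normal_peak s / Num.sqrt 2 * expR (- y)) =
  ((4 * s ^+ 2) ^+ k.+1 * normal_peak s * expR (- y)) * (k.+1%:R ^+ k.+1).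
  by rewrite /Cmoment !exprMn; field; exact: lt0r_neq0.
rewrite ler_wpM2l//.
  by rewrite !mulr_ge0 ?expR_ge0// exprn_ge0// mulr_ge0// ltW.
by rewrite expRN ler_pdivrMr ?expR_gt0.
Qed.

Lemma gaussian_moment d (Om : measurableType d) (P : probability Om R) (Y : Om -> R) v k :
  0 <= v -> centered_gaussian P Y v ->
  (\int[P]_w ((Y w ^+ 2) ^+ k.+1)%:E <= (Cmoment k * v ^+ k.+1)%:E)%E.
Proof.
move=> v0 [mY hY].
pose f (x : R) := ((x ^+ 2) ^+ k.+1)%:E.
have mf : measurable_fun setT f.
  by apply/measurable_EFinP; do 2 apply: measurable_funX; exact: measurable_id.
have f0 x : (0 <= f x)%E by rewrite lee_fin exprn_ge0// sqr_ge0.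
have mY' : measurable_fun setT (Y : Om -> measurableTypeR R) := mY.
pose Ym : {RV P >-> measurableTypeR R} :=
  @mfun_Sub _ _ Om (measurableTypeR R) Y (mem_set mY').
have -> : (\int[P]_w ((Y w ^+ 2) ^+ k.+1)%:E = \int[distribution P Ym]_x f x)%E.
  by rewrite ge0_integral_distribution.
have [v00|vn0] := eqVneq v 0.
  rewrite (@eq_measure_integral _ (measurableTypeR R) R setT (@dirac _ (measurableTypeR R) 0 R)).
    by rewrite integral_dirac// diracT mul1e /f expr0n/= expr0n/= lee_fin
      mulr_ge0 ?Cmoment_ge0// exprn_ge0.
  by move=> A mA _; have hYA := hY A mA; rewrite v00 eqxx in hYA.
have vgt : 0 < v by rewrite lt_neqAle eq_sym vn0.
set s := Num.sqrt v.
have s0 : 0 < s by rewrite sqrtr_gt0.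
rewrite (@eq_measure_integral _ (measurableTypeR R) R setT (normal_prob 0 s)); last first.
  by move=> A mA _; have hYA := hY A mA; rewrite (negbTE vn0) in hYA.
apply: (le_trans (@integral_density_le _ _ _ mu (normal_prob 0 s) (normal_pdf 0 s) _ _ _ _ _)).
- exact: measurable_normal_pdf.
- exact: normal_pdf_ge0.
- by [].
- by move=> x; rewrite exprn_ge0// sqr_ge0.
have mn : measurable_fun setT (fun x => (normal_pdf 0 (Num.sqrt 2 * s) x)%:E).
  by apply/measurable_EFinP; exact: measurable_normal_pdf.
have C0 : 0 <= Cmoment k * v ^+ k.+1 by rewrite mulr_ge0 ?Cmoment_ge0// exprn_ge0.
apply: (@le_trans _ _ (\int[mu]_x ((Cmoment k * v ^+ k.+1)%:E * (normal_pdf 0 (Num.sqrt 2 * s) x)%:E))%E).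
  apply: ge0_le_integral_sup => x _.
    by rewrite lee_fin mulr_ge0 ?normal_pdf_ge0// exprn_ge0// sqr_ge0.
  by rewrite -EFinM lee_fin -[v in leRHS]sqr_sqrtr//; exact: normal_pdf_moment.
rewrite ge0_integralZl_EFin//; last by move=> x _; rewrite lee_fin normal_pdf_ge0.
by rewrite integral_normal_pdf mule1.
Qed.

End gaussian.

(** * Dyadic chaining *)

Section chaining.
Context {R : realType}.
Variables (T gamma K : R) (x : R -> R).
Hypotheses (T0 : 0 < T) (g0 : 0 < gamma) (K0 : 0 <= K).
Local Notation q := ((2^-1 : R) `^ gamma).
Hypothesis hx : forall l j, (j < 2 ^ l)%N -> `|x (pt T l j.+1) - x (pt T l j)| <= K * q ^+ l.

(** Only values on the dyadic grids enter, so nothing is asked of [x] between grid points. *)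
Definition dyadic_lim (t : R) : R := limn (fun l => x (pt T l (gidx T l t))).

Lemma dyadic_lim_cvg t : 0 <= t -> t <= T ->
  (fun l => x (pt T l (gidx T l t))) @ \oo --> dyadic_lim t /\
  forall l, `|dyadic_lim t - x (pt T l (gidx T l t))| <= K * q ^+ l / (1 - q).
Proof.
move=> t0 tT; apply: geometric_cvg; first exact: half_powR_lt1.
have /andP[q0 q1] := half_powR_lt1 g0.
move=> l; have hl : (gidx T l.+1 t <= 2 ^ l.+1)%N by apply: gidx_max; rewrite ?t0.
have [e|e] := gidxS T0 l t0; rewrite e.
  by rewrite pt_double subrr normr0 mulr_ge0// exprn_ge0.
rewrite -(pt_double T l (gidx T l t)).
apply: (le_trans (hx _)); first by rewrite e in hl.
by rewrite ler_wpM2l// exprS ler_piMl ?exprn_ge0// ltW.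
Qed.

(** At the level whose mesh is comparable with [t - s], the last grid points of [s] and [t] are
    equal or adjacent. [C1] collects this increment and two tails; [(2 / T)^gamma] comes from
    [2^(- l) <= 2 (t - s) / T]. *)
Lemma dyadic_lim_holder : exists2 C, 0 <= C & forall s t, 0 <= s -> s <= t -> t <= T ->
  `|dyadic_lim t - dyadic_lim s| <= C * (t - s) `^ gamma.
Proof.
have /andP[q0 q1] := half_powR_lt1 g0.
have q10 : 0 < 1 - q by rewrite subr_gt0.
pose C1 := K + 2 * (K / (1 - q)).
have C10 : 0 <= C1 by rewrite addr_ge0// mulr_ge0// divr_ge0// ltW.
exists (C1 * (2 / T) `^ gamma); first by rewrite mulr_ge0 ?powR_ge0.
move=> s t s0; rewrite le_eqVlt => /orP[/eqP <- _|st tT].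
  by rewrite !subrr normr0 !mulr_ge0 ?powR_ge0.
have t0 : 0 <= t by apply: le_trans (ltW st).
have sT : s <= T by apply: le_trans (ltW st) tT.
have [l /andP[l1 l2]] : exists l, mesh T l.+1 < t - s <= mesh T l.
  by apply: dyadic_level => //; apply/andP; split; lra.
have [_ /(_ l) ht] := dyadic_lim_cvg t0 tT.
have [_ /(_ l) hs] := dyadic_lim_cvg s0 sT.
have hts : `|x (pt T l (gidx T l t)) - x (pt T l (gidx T l s))| <= K * q ^+ l.
  have /andP[s1 s2] := gidxP T0 l s0.
  have /andP[t1 t2] := gidxP T0 l t0.
  have i1 : (gidx T l s <= gidx T l t)%N by apply: gidx_le => //; exact: ltW.
  have i2 : (gidx T l t < (gidx T l s).+2)%N.
    by rewrite gidx_lt// ptS; lra.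
  move: i1; rewrite leq_eqVlt => /orP[/eqP ->|i1].
    by rewrite subrr normr0 mulr_ge0// exprn_ge0.
  have e : gidx T l t = (gidx T l s).+1 by apply/eqP; rewrite eqn_leq -ltnS i2.
  rewrite e; apply: hx; apply: leq_trans i1 _.
  by apply: gidx_max => //; rewrite t0.
have -> : dyadic_lim t - dyadic_lim s = (dyadic_lim t - x (pt T l (gidx T l t)))
  + (x (pt T l (gidx T l t)) - x (pt T l (gidx T l s)))
  - (dyadic_lim s - x (pt T l (gidx T l s))) by ring.
apply: (le_trans (ler_normB _ _)).
apply: (le_trans (lerD (ler_normD _ _) (lexx _))).
apply: (le_trans (lerD (lerD ht hts) hs)).
have -> : K * q ^+ l / (1 - q) + K * q ^+ l + K * q ^+ l / (1 - q) = C1 * q ^+ l.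
  by rewrite /C1; field; rewrite gt_eqF.
rewrite -mulrA ler_wpM2l// -powRM; [|by rewrite divr_ge0// ltW|by rewrite subr_ge0 ltW].
rewrite -powR_exprn ?invr_ge0//; apply: powR_mono; [exact: ltW|by rewrite exprn_ge0 ?invr_ge0|].
have := ltW l1; rewrite /mesh exprS => l1'.
rewrite mulrAC ler_pdivlMr// mulrC.
have -> : T * 2^-1 ^+ l = 2 * (T / (2 * 2 ^+ l)).
  by rewrite exprVn; field; rewrite expf_neq0.
by rewrite ler_wpM2l.
Qed.
End chaining.

(** * Bounds in the square mean *)

Section L2.
Context d (Om : measurableType d) (R : realType) (P : {measure set Om -> \bar R}).
Implicit Types (f g : Om -> R) (a b c : R).

Definition L2le f b := measurable_fun setT f /\ (\int[P]_w (f w ^+ 2)%:E <= (b ^+ 2)%:E)%E.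

Lemma measurable_sqr f : measurable_fun setT f -> measurable_fun setT (fun w => (f w ^+ 2)%:E).
Proof. by move=> mf; apply/measurable_EFinP; exact: measurable_funX. Qed.

Lemma L2le_mono f a b : 0 <= a -> a <= b -> L2le f a -> L2le f b.
Proof.
move=> a0 ab [mf h]; split => //; apply: (le_trans h).
by rewrite lee_fin lerXn2r// nnegrE// (le_trans a0).
Qed.

Lemma L2le0 b : L2le (fun=> 0) b.
Proof.
split; first exact: measurable_cst.
by rewrite integral0_eq ?lee_fin ?sqr_ge0// => w _; rewrite expr0n.
Qed.

Lemma L2le_scale f b c : L2le f b -> L2le (fun w => c * f w) (`|c| * b).
Proof.
move=> [mf h]; split; first by apply: measurable_funM => //; exact: measurable_cst.
have e w : (((c * f w) ^+ 2)%:E = (c ^+ 2)%:E * (f w ^+ 2)%:E)%E by rewrite exprMn -EFinM.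
under eq_integral do rewrite e.
rewrite ge0_integralZl_EFin ?sqr_ge0//; last 2 first.
- by move=> w _; rewrite lee_fin sqr_ge0.
- exact: measurable_sqr.
have -> : ((`|c| * b) ^+ 2)%:E = ((c ^+ 2)%:E * (b ^+ 2)%:E)%E.
  by rewrite exprMn real_normK ?num_real// -EFinM.
by apply: lee_wpmul2l => //; rewrite lee_fin sqr_ge0.
Qed.

(** Minkowski by a weighted Young inequality: [2 f g <= (b/a) f^2 + (a/b) g^2]. These weights give
    exactly [(a + b)^2], and they require both bounds to be positive. *)
Lemma L2le_add f g a b : 0 < a -> 0 < b -> L2le f a -> L2le g b ->
  L2le (fun w => f w + g w) (a + b).
Proof.
move=> a0 b0 [mf hf] [mg hg]; split; first exact: measurable_funD.
have ba : 0 <= 1 + b / a by rewrite addr_ge0// divr_ge0// ltW.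
have ab : 0 <= 1 + a / b by rewrite addr_ge0// divr_ge0// ltW.
apply: (@le_trans _ _ (\int[P]_w ((1 + b / a)%:E * (f w ^+ 2)%:E + (1 + a / b)%:E * (g w ^+ 2)%:E))%E).
  apply: ge0_le_integral_sup => w _; first by rewrite lee_fin sqr_ge0.
  rewrite -!EFinM -EFinD lee_fin.
  have h : 0 <= (b * f w - a * g w) ^+ 2 / (a * b).
    by rewrite divr_ge0 ?sqr_ge0// mulr_ge0// ltW.
  have e : (1 + b / a) * f w ^+ 2 + (1 + a / b) * g w ^+ 2 - (f w + g w) ^+ 2 =
    (b * f w - a * g w) ^+ 2 / (a * b).
    by field; rewrite !gt_eqF.
  by rewrite -subr_ge0 e.
have f0 w : [set: Om] w -> (0 <= (f w ^+ 2)%:E)%E by rewrite lee_fin sqr_ge0.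
have g0 w : [set: Om] w -> (0 <= (g w ^+ 2)%:E)%E by rewrite lee_fin sqr_ge0.
have mf2 := measurable_sqr mf; have mg2 := measurable_sqr mg.
rewrite ge0_integralD//; last 4 first.
- by move=> w _; rewrite -EFinM lee_fin mulr_ge0// sqr_ge0.
- by apply: emeasurable_funM => //; exact: measurable_cst.
- by move=> w _; rewrite -EFinM lee_fin mulr_ge0// sqr_ge0.
- by apply: emeasurable_funM => //; exact: measurable_cst.
rewrite !ge0_integralZl_EFin//.
apply: (@le_trans _ _ ((1 + b / a)%:E * (a ^+ 2)%:E + (1 + a / b)%:E * (b ^+ 2)%:E)%E).
  by apply: leeD; apply: lee_wpmul2l => //; rewrite lee_fin.
rewrite -!EFinM -EFinD lee_fin le_eqVlt; apply/orP; left; apply/eqP.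
by field; rewrite !gt_eqF.
Qed.

(** The factor is [n + 1] and not [n] so that the bound of the empty sum is positive, as [L2le_add]
    requires. *)
Lemma L2le_sum (F : nat -> Om -> R) b n : 0 < b -> (forall j, (j < n)%N -> L2le (F j) b) ->
  L2le (fun w => \sum_(0 <= j < n) F j w) (n.+1%:R * b).
Proof.
move=> b0; elim: n => [|n IH] h.
  rewrite (_ : (fun w => _) = (fun=> 0)); first exact: L2le0.
  by apply/funext => w; rewrite big_geq.
rewrite (_ : (fun w => _) = (fun w => \sum_(0 <= j < n) F j w + F n w)); last first.
  by apply/funext => w; rewrite big_nat_recr.
have -> : n.+2%:R * b = n.+1%:R * b + b by rewrite -natr1; ring.
apply: L2le_add => //; first by rewrite mulr_gt0.
  by apply: IH => j jn; apply: h; rewrite (ltn_trans jn).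
exact: h.
Qed.

Lemma limn_einf_le (u : nat -> \bar R) (c : \bar R) N :
  (forall n, (N <= n)%N -> (u n <= c)%E) -> (limn_einf u <= c)%E.
Proof.
move=> h; rewrite limn_einf_lim.
apply: lime_le; first exact: is_cvg_einfs.
exists 0%N => // n _ /=.
apply: (@le_trans _ _ (u (maxn n N))); last by apply: h; rewrite leq_maxr.
by apply: ereal_inf_lbound; exists (maxn n N) => //=; rewrite leq_maxl.
Qed.

Lemma L2le_fatou (F : nat -> Om -> R) f b N : (forall n, measurable_fun setT (F n)) ->
  (forall w, (fun n => F n w) @ \oo --> f w) ->
  (forall n, (N <= n)%N -> L2le (F n) b) -> L2le f b.
Proof.
move=> mF cF h; have mf : measurable_fun setT f by apply: (measurable_fun_cvg mF) => w _; exact: cF.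
split => //.
have := fatou P measurableT (f := fun n w => (F n w ^+ 2)%:E) (fun n => measurable_sqr (mF n))
  (fun n w _ => _).
move=> /(_ _)/wrap[|fat]; first by move=> *; rewrite lee_fin sqr_ge0.
have e : (\int[P]_w (f w ^+ 2)%:E = \int[P]_w limn_einf (fun n => (F n w ^+ 2)%:E))%E.
  apply: eq_integral => w _.
  have cv : (fun n => (F n w ^+ 2)%:E) @ \oo --> (f w ^+ 2)%:E.
    apply/cvg_EFin; first by near=> n.
    by rewrite /=; apply: cvgM; exact: cF.
  by rewrite is_cvg_limn_einfE; [apply/esym/cvg_lim|apply/cvg_ex; eexists; exact: cv].
rewrite e; apply: (le_trans fat); apply: (limn_einf_le (N := N)) => n Nn.
by have [_] := h n Nn.
Unshelve. all: by end_near.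
Qed.

Lemma L2le0_ae f : L2le f 0 -> {ae P, forall w, f w = 0}.
Proof.
move=> [mf h].
have h0 : (\int[P]_w `|(f w ^+ 2)%:E| = 0)%E.
  apply/le_anti/andP; split; last by apply: integral_ge0.
  move: h; rewrite expr0n/=; apply: le_trans.
  by rewrite le_eqVlt; apply/orP; left; apply/eqP; apply: eq_integral => w _; rewrite /= ger0_norm ?sqr_ge0.
have /ae_eq_integral_abs : measurable_fun setT (fun w => (f w ^+ 2)%:E) by exact: measurable_sqr.
move=> /(_ P measurableT)[/(_ h0)H _].
apply: filterS H => w /(_ I) [] /eqP.
by rewrite sqrf_eq0 => /eqP.
Qed.

Lemma L2le_geometric (F : nat -> Om -> R) f C q : 0 < C -> 0 < q < 1 ->
  (forall n, measurable_fun setT (F n)) ->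
  (forall w, (fun n => F n w) @ \oo --> f w) ->
  (forall n, L2le (fun w => F n.+1 w - F n w) (C * q ^+ n)) ->
  forall n, L2le (fun w => f w - F n w) (C * q ^+ n * (1 + (1 - q)^-1)).
Proof.
move=> C0 /andP[q0 q1] mF cF h n.
have q10 : 0 < 1 - q by rewrite subr_gt0.
have b0 k : 0 < C * q ^+ k by rewrite mulr_gt0// exprn_gt0.
have step m : L2le (fun w => F (m + n)%N w - F n w) (C * q ^+ n * (1 + (1 - q ^+ m) / (1 - q))).
  elim: m => [|m IH].
    rewrite (_ : (fun w => _) = (fun=> 0)); first exact: L2le0.
    by apply/funext => w; rewrite add0n subrr.
  rewrite (_ : (fun w => _) = (fun w => (F (m + n)%N w - F n w) + (F (m + n).+1 w - F (m + n)%N w))).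
    have -> : C * q ^+ n * (1 + (1 - q ^+ m.+1) / (1 - q)) =
        C * q ^+ n * (1 + (1 - q ^+ m) / (1 - q)) + C * q ^+ (m + n).
      by rewrite exprS exprD; field; rewrite gt_eqF.
    apply: L2le_add => //; rewrite mulr_gt0// ltr_wpDr// divr_ge0 ?subr_ge0 ?exprn_ile1 ?ltW//.
  by apply/funext => w; rewrite addSn; ring.
apply: (@L2le_fatou (fun m w => F (m + n)%N w - F n w) _ _ 0).
- by move=> m; exact: measurable_funB.
- move=> w; apply: cvgB; last exact: cvg_cst.
  by rewrite (cvg_shiftn n (fun m => F m w)); exact: cF.
move=> m _; apply: L2le_mono (step m).
  by rewrite ltW// mulr_gt0// ltr_wpDr// divr_ge0 ?subr_ge0 ?exprn_ile1 ?ltW.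
rewrite ler_wpM2l ?(ltW (b0 n))// lerD2l ler_piMl ?invr_ge0 ?(ltW q10)//.
by rewrite gerBl exprn_ge0// ltW.
Qed.

End L2.

(** * Hölder versions from moment bounds *)

Section kolmogorov.
Context d (Om : measurableType d) (R : realType) (P : probability Om R).
Variables (X : R -> Om -> R) (T H gamma : R) (C : nat -> R).
Hypotheses (T0 : 0 < T) (g0 : 0 < gamma) (gH : gamma < H).
Hypothesis mX : forall t, measurable_fun setT (X t).
Hypothesis C0 : forall k, 0 <= C k.
Hypothesis mom : forall k s t,
  (\int[P]_w (((X t w - X s w) ^+ 2) ^+ k.+1)%:E <= (C k * (`|t - s| `^ (2 * H)) ^+ k.+1)%:E)%E.

Let H0 : 0 < H. Proof. exact: lt_trans gH. Qed.
Let q : R := 2^-1 `^ gamma.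
Let r : R := 2 `^ gamma.

Let r0 : 0 < r. Proof. by rewrite powR_gt0. Qed.

Let rq : r * q = 1.
Proof. by rewrite /r /q -powRM ?invr_ge0// divff// powR1. Qed.

Section exponent.
Variable k : nat.
Hypothesis hk : 1 <= k.+1%:R * (H - gamma).

(** Increments of level [l], scaled by [2^(gamma l)] and raised to the power [2 (k + 1)]. Their
    total [U] has finite mean, hence is finite almost surely and bounds every single term; this
    replaces a Borel-Cantelli argument. *)
Let u l w : R := \sum_(0 <= j < 2 ^ l)
  ((r ^+ l * (X (pt T l j.+1) w - X (pt T l j) w)) ^+ 2) ^+ k.+1.
Let U w : \bar R := (\sum_(l <oo) (u l w)%:E)%E.
Let D : R := C k * (T `^ (2 * H)) ^+ k.+1.

Let D0 : 0 <= D. Proof. by rewrite mulr_ge0// exprn_ge0// powR_ge0. Qed.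

Let u_ge0 l w : 0 <= u l w.
Proof. by apply: sumr_ge0 => j _; rewrite exprn_ge0// sqr_ge0. Qed.

Let mu_ l : measurable_fun setT (u l).
Proof.
apply: measurable_sum => j; do 2 apply: measurable_funX.
by apply: measurable_funM; [exact: measurable_cst|exact: measurable_funB].
Qed.

(** The factor 2 counts the cells, which double with the level; the choice of [k] makes the scaled
    moments shrink at least by 4. *)
Let ratio : 2 * (r ^+ 2 * 2^-1 `^ (2 * H)) ^+ k.+1 <= 2^-1.
Proof.
have -> : r ^+ 2 * 2^-1 `^ (2 * H) = 2^-1 `^ (2 * (H - gamma)).
  have e : 2^-1 `^ (2 * H) = 2^-1 `^ (2 * (H - gamma)) * q ^+ 2 :> R.
    rewrite /q -powR_mulrn ?powR_ge0// -powRrM -powRD; first by congr powR; ring.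
    by apply/implyP => _; rewrite invr_eq0 pnatr_eq0.
  by rewrite e mulrCA -exprMn rq expr1n mulr1.
rewrite -powR_mulrn ?powR_ge0// -powRrM.
have : (2^-1 : R) `^ (2 * (H - gamma) * k.+1%:R) <= 2^-1 `^ 2.
  apply: ger_powR; last by move: hk => ?; lra.
  by rewrite invr_gt0 ltr0n/= invf_le1// ler1n.
by rewrite powR_mulrn ?invr_ge0// expr2; lra.
Qed.

Let int_u l : (\int[P]_w (u l w)%:E <= (D * 2^-1 ^+ l)%:E)%E.
Proof.
under eq_integral do rewrite -sumEFin.
rewrite ge0_integral_sum//; last 2 first.
- move=> j; apply/measurable_EFinP; do 2 apply: measurable_funX.
  by apply: measurable_funM; [exact: measurable_cst|exact: measurable_funB].
- by move=> j w _; rewrite lee_fin exprn_ge0// sqr_ge0.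
have term j : (\int[P]_w (((r ^+ l * (X (pt T l j.+1) w - X (pt T l j) w)) ^+ 2) ^+ k.+1)%:E <=
   (D * ((r ^+ 2 * 2^-1 `^ (2 * H)) ^+ k.+1) ^+ l)%:E)%E.
  have e w : ((((r ^+ l * (X (pt T l j.+1) w - X (pt T l j) w)) ^+ 2) ^+ k.+1)%:E =
    (((r ^+ l) ^+ 2) ^+ k.+1)%:E * (((X (pt T l j.+1) w - X (pt T l j) w) ^+ 2) ^+ k.+1)%:E)%E.
    by rewrite [(_ * _) ^+ 2]exprMn [(_ * _) ^+ k.+1]exprMn -EFinM.
  under eq_integral do rewrite e.
  rewrite ge0_integralZl_EFin//; last 3 first.
  - by move=> w _; rewrite lee_fin exprn_ge0// sqr_ge0.
  - apply/measurable_EFinP; do 2 apply: measurable_funX; exact: measurable_funB.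
  - by rewrite exprn_ge0// sqr_ge0.
  apply: (@le_trans _ _ ((((r ^+ l) ^+ 2) ^+ k.+1)%:E *
      (C k * (`|pt T l j.+1 - pt T l j| `^ (2 * H)) ^+ k.+1)%:E)%E).
    by apply: lee_wpmul2l; [rewrite lee_fin exprn_ge0// sqr_ge0|exact: mom].
  rewrite -EFinM lee_fin ptS addrC addKr (ger0_norm (ltW (mesh_gt0 T0 l))) mesh_powR//.
  rewrite le_eqVlt; apply/orP; left; apply/eqP.
  rewrite /D [(T `^ _ * _) ^+ k.+1]exprMn.
  have -> : ((r ^+ 2 * 2^-1 `^ (2 * H)) ^+ k.+1) ^+ l =
      ((r ^+ 2) ^+ k.+1) ^+ l * ((2^-1 `^ (2 * H)) ^+ k.+1) ^+ l.
    by rewrite [(r ^+ 2 * _) ^+ k.+1]exprMn [(_ * _) ^+ l]exprMn.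
  have -> : ((r ^+ l) ^+ 2) ^+ k.+1 = ((r ^+ 2) ^+ k.+1) ^+ l by rewrite -!exprM; congr (_ ^+ _); ring.
  have -> : ((2^-1 `^ (2 * H)) ^+ l) ^+ k.+1 = ((2^-1 `^ (2 * H)) ^+ k.+1) ^+ l by rewrite exprAC.
  by ring.
apply: (@le_trans _ _ (\sum_(0 <= j < 2 ^ l) (D * ((r ^+ 2 * 2^-1 `^ (2 * H)) ^+ k.+1) ^+ l)%:E)%E).
  by apply: lee_sum => j _; exact: term.
rewrite sumEFin lee_fin; set c := D * _.
have -> : \sum_(0 <= j < 2 ^ l) c = 2 ^+ l * c.
  by rewrite big_const_nat subn0 iter_addr addr0 -natrX mulr_natl.
rewrite /c mulrCA -exprMn ler_wpM2l// lerXn2r ?nnegrE ?invr_ge0//.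
by rewrite mulr_ge0// exprn_ge0// mulr_ge0 ?powR_ge0// sqr_ge0.
Qed.

Let int_U : (\int[P]_w U w < +oo)%E.
Proof.
rewrite integral_nneseries//; last 2 first.
- by move=> l; exact/measurable_EFinP.
- by move=> l w _; rewrite lee_fin.
apply: (@le_lt_trans _ _ (2 * D)%:E); last exact: ltry.
apply: lime_le.
  by apply: is_cvg_nneseries => l _ _; apply: integral_ge0 => w _; rewrite lee_fin.
exists 0%N => // n _ /=.
apply: (@le_trans _ _ (\sum_(0 <= l < n) (D * 2^-1 ^+ l)%:E)%E).
  by apply: lee_sum => l _; exact: int_u.
rewrite sumEFin lee_fin.
have -> : \sum_(0 <= l < n) (D * 2^-1 ^+ l) = 2 * D * (1 - 2^-1 ^+ n).
  elim: n => [|n IH]; first by rewrite big_geq// expr0 subrr mulr0.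
  by rewrite big_nat_recr//= IH exprS; field.
apply: ler_piMr; first exact: (mulr_ge0 (ler0n R 2) D0).
by rewrite gerBl exprn_ge0// invr_ge0.
Qed.

Let U_ge0 w : (0 <= U w)%E.
Proof. by apply: nneseries_ge0 => l _ _; rewrite lee_fin. Qed.

Let mU : measurable_fun setT U.
Proof.
apply: ge0_emeasurable_sum => [l w _ _|l _]; first by rewrite lee_fin.
exact/measurable_EFinP.
Qed.

Definition good : set Om := [set w | (U w < +oo)%E].

Lemma measurable_good : measurable good.
Proof.
by have := emeasurable_fun_infty_o measurableT mU +oo%E; rewrite setTI.
Qed.

Lemma ae_good : {ae P, forall w, good w}.
Proof.
have iU : P.-integrable setT U.
  apply/integrableP; split => //.
  under eq_integral => w _ do rewrite (gee0_abs (U_ge0 w)).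
  exact: int_U.
have := integrable_ae measurableT iU; apply: filterS => w /(_ I).
by rewrite fin_numE /good/= ltey => /andP[].
Qed.

Lemma pow_le_max (y c : R) j : 0 <= y -> y ^+ j.+1 <= c -> y <= Num.max 1 c.
Proof.
move=> y0 h; have [y1|y1] := leP y 1; first by rewrite le_max y1.
by rewrite le_max (le_trans _ h) ?orbT// ler_eXnr// ltW.
Qed.

Lemma good_increments w : good w -> exists2 K, 0 <= K & forall l j, (j < 2 ^ l)%N ->
  `|X (pt T l j.+1) w - X (pt T l j) w| <= K * q ^+ l.
Proof.
move=> gw; set c := fine (U w).
have hU : U w = c%:E.
  by rewrite fineK// ge0_fin_numE.
pose K := Num.max 1 (Num.max 1 c).
exists K; first by rewrite le_max ler01.
move=> l j jl; set D1 := X _ w - X _ w.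
have hu : u l w <= c.
  rewrite -lee_fin -hU; apply: le_trans (nneseries_lim_ge l.+1 _); last by move=> i _ _; rewrite lee_fin.
  rewrite big_nat_recr//= leeDr// sume_ge0// => i _; by rewrite lee_fin.
have h1 : ((r ^+ l * D1) ^+ 2) ^+ k.+1 <= c.
  apply: le_trans hu; rewrite /u big_mkord (bigD1 (Ordinal jl))//= lerDl.
  by apply: sumr_ge0 => i _; rewrite exprn_ge0// sqr_ge0.
have h2 := pow_le_max (sqr_ge0 _) h1.
have h3 : `|r ^+ l * D1| <= K.
  by apply: (@pow_le_max _ _ 1) => //; rewrite real_normK ?num_real.
rewrite normrM (ger0_norm (exprn_ge0 l (ltW r0))) in h3.
have ql : q ^+ l * r ^+ l = 1 by rewrite -exprMn mulrC rq expr1n.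
have -> : `|D1| = r ^+ l * `|D1| * q ^+ l.
  by rewrite mulrAC [r ^+ l * _]mulrC ql mul1r.
by apply: ler_wpM2r => //; rewrite exprn_ge0// powR_ge0.
Qed.

(** Outside the measurable set [good] the path is replaced by 0, so the limit exists and is Hölder
    for every [w] and stays measurable. *)
Let Xh w t : R := \1_good w * X t w.

Let Xh_increments w : exists2 K, 0 <= K & forall l j, (j < 2 ^ l)%N ->
  `|Xh w (pt T l j.+1) - Xh w (pt T l j)| <= K * q ^+ l.
Proof.
rewrite /Xh; have [gw|gw] := pselect (good w).
  have [K K0 h] := good_increments gw; exists K => // l j jl.
  by rewrite indicE mem_set// !mul1r; exact: h.
exists 0 => // l j _.
by rewrite indicE memNset// !mul0r subrr normr0.
Qed.

(** Outside [[0, T]] the original process is kept, so that this is a version at all real times. *)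
Definition holder_version t w : R :=
  if (0 <= t) && (t <= T) then dyadic_lim T (Xh w) t else X t w.

Lemma holder_version_cvg t w : 0 <= t -> t <= T ->
  (fun l => Xh w (pt T l (gidx T l t))) @ \oo --> holder_version t w.
Proof.
move=> t0 tT; rewrite /holder_version t0 tT/=.
have [K K0 h] := Xh_increments w.
by have [] := dyadic_lim_cvg T0 g0 K0 h t0 tT.
Qed.

Let mXh t : measurable_fun setT (fun w => Xh w t).
Proof.
by apply: measurable_funM => //; apply: measurable_indic; exact: measurable_good.
Qed.

Lemma measurable_holder_version t : measurable_fun setT (holder_version t).
Proof.
have [/andP[t0 tT]|ht] := boolP ((0 <= t) && (t <= T)); last first.
  by rewrite (_ : holder_version t = X t)//; apply/funext => w; rewrite /holder_version (negbTE ht).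
apply: (measurable_fun_cvg (h := fun l w => Xh w (pt T l (gidx T l t)))) => // w _.
exact: holder_version_cvg.
Qed.

Lemma holder_version_holder w : exists2 K, 0 <= K & holder gamma K T (holder_version ^~ w).
Proof.
have [K K0 h] := Xh_increments w.
have [K' K'0 h'] := dyadic_lim_holder T0 g0 K0 h.
exists K' => // s t s0 st tT.
have t0 := le_trans s0 st; have sT := le_trans st tT.
by rewrite /holder_version s0 t0 sT tT/=; exact: h'.
Qed.

Lemma L2_increment s t : L2le P (fun w => X t w - X s w) (Num.sqrt (C 0) * `|t - s| `^ H).
Proof.
split; first exact: measurable_funB.
have h : (\int[P]_w ((X t w - X s w) ^+ 2)%:E <= (C 0 * `|t - s| `^ (2 * H))%:E)%E := mom 0 s t.
by rewrite exprMn sqr_sqrtr// -[(_ `^ _) ^+ 2]powR_mulrn ?powR_ge0// -powRrM (mulrC H).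
Qed.

(** Along the grid points before [t], [Xh] tends pointwise to the version, and its [L^2] distance to
    [Xh w t] tends to 0 by the second moment; Fatou identifies the two limits. *)
Lemma holder_version_ae t : {ae P, forall w, holder_version t w = X t w}.
Proof.
have [/andP[t0 tT]|ht] := boolP ((0 <= t) && (t <= T)); last first.
  by apply: aeW => w; rewrite /holder_version (negbTE ht).
have L2 b : 0 < b -> L2le P (fun w => holder_version t w - Xh w t) b.
  move=> b0.
  have cv : (fun l => Num.sqrt (C 0) * mesh T l `^ H) @ \oo --> (0 : R).
    rewrite -[X in _ --> X](mulr0 (Num.sqrt (C 0))); apply: cvgM; first exact: cvg_cst.
    exact: mesh_cvg.
  have /cvgrPdist_le/(_ _ b0)[N _ hN] := cv.
  apply: (@L2le_fatou _ _ _ P (fun l w => Xh w (pt T l (gidx T l t)) - Xh w t) _ _ N).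
  - by move=> l; exact: measurable_funB.
  - by move=> w; apply: cvgB; [exact: holder_version_cvg|exact: cvg_cst].
  move=> l /hN /=; rewrite sub0r normrN => hl.
  have bl : 0 <= Num.sqrt (C 0) * mesh T l `^ H by rewrite mulr_ge0 ?sqrtr_ge0// powR_ge0.
  rewrite (ger0_norm bl) in hl.
  apply: L2le_mono bl hl _.
  split; first exact: measurable_funB.
  have [_] := L2_increment t (pt T l (gidx T l t)).
  move=> h; apply: (@le_trans _ _ ((Num.sqrt (C 0) * `|pt T l (gidx T l t) - t| `^ H) ^+ 2)%:E).
    apply: le_trans h; apply: ge0_le_integral_sup => w _; first by rewrite lee_fin sqr_ge0.
    by rewrite lee_fin -mulrBr exprMn ler_piMl ?sqr_ge0.
  have /andP[h1 h2] := gidxP T0 l t0; rewrite ptS in h2.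
  rewrite lee_fin lerXn2r ?nnegrE//.
    by rewrite mulr_ge0 ?sqrtr_ge0// powR_ge0.
  rewrite ler_wpM2l ?sqrtr_ge0//; apply: powR_mono => //; first exact: ltW.
  rewrite distrC ger0_norm ?subr_ge0//; lra.
have L20 : L2le P (fun w => holder_version t w - Xh w t) 0.
  have m : measurable_fun setT (fun w => holder_version t w - Xh w t).
    by apply: measurable_funB => //; exact: measurable_holder_version.
  split => //; rewrite expr0n/=; apply/lee_addgt0Pr => e e0; rewrite add0e.
  have [_] := L2 (Num.sqrt e) ltac:(by rewrite sqrtr_gt0).
  by rewrite sqr_sqrtr// ltW.
have := L2le0_ae L20; have := ae_good; apply: filterS2 => w gw /eqP.
by rewrite subr_eq0 /Xh indicE mem_set// mul1r => /eqP.
Qed.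

End exponent.

Theorem kolmogorov_continuity : exists X' : R -> Om -> R,
  [/\ forall t, {ae P, forall w, X' t w = X t w},
      forall t, measurable_fun setT (X' t) &
      forall w, exists2 K, 0 <= K & holder gamma K T (X' ^~ w)].
Proof.
have [k hk] : exists k : nat, 1 <= k.+1%:R * (H - gamma).
  have Hg : 0 < H - gamma by rewrite subr_gt0.
  exists (Num.truncn (H - gamma)^-1).
  have /truncn_itv/andP[_ h] : 0 <= (H - gamma)^-1 by rewrite invr_ge0 ltW.
  by have := ltW h; rewrite -ler_pdivrMr// div1r.
exists (holder_version k); split.
- by move=> t; exact: holder_version_ae.
- by move=> t; exact: measurable_holder_version.
- by move=> w; exact: holder_version_holder.
Qed.

End kolmogorov.

(** The positive and the negative part of [f] both lie below [g], so their integrals lie between 0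
    and that of [g], and their difference is bounded by it too. *)
Lemma abse_integral_le d (T : measurableType d) (R : realType) (mu : measure T R)
    (D : set T) (f g : T -> \bar R) :
  (forall x, D x -> (`|f x| <= g x)%E) -> (`| \int[mu]_(x in D) f x | <= \int[mu]_(x in D) g x)%E.
Proof.
move=> fg; rewrite integralE.
have hp : (\int[mu]_(x in D) f^\+ x <= \int[mu]_(x in D) g x)%E.
  apply: ge0_le_integral_sup => // x Dx; apply: le_trans (fg x Dx).
  by rewrite funeposE ge_max lee_abs abse_ge0.
have hn : (\int[mu]_(x in D) f^\- x <= \int[mu]_(x in D) g x)%E.
  apply: ge0_le_integral_sup => // x Dx; apply: le_trans (fg x Dx).
  by rewrite funenegE ge_max -abseN lee_abs abse_ge0.
have p0 : (0 <= \int[mu]_(x in D) f^\+ x)%E by exact: integral_ge0.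
have n0 : (0 <= \int[mu]_(x in D) f^\- x)%E by exact: integral_ge0.
move: p0 n0 hp hn; move: (integral _ _ _) (integral _ _ _) (integral _ _ _).
move=> [a| |] [b| |] [c| |] //; rewrite ?lee_fin /= ?leey//= ?lee_fin => a0 b0 ac bc.
by rewrite ler_norml; lra.
Qed.

(** * Wiener integrals *)

Section kernel.
Context {R : realType}.
Notation mu := (@lebesgue_measure R).
Variables T H : R.
Hypotheses (T0 : 0 < T) (H12 : 1 / 2 < H) (H1 : H <= 1).

(** Shell [j] contributes [2 mesh_j mesh_(j+1)^(2H-2) = 4 mesh_(j+1)^(2H-1)], and these terms form a
    geometric series because [2 H > 1]. *)
Definition Ckernel : R := 4 * T `^ (2 * H - 1) / (1 - 2^-1 `^ (2 * H - 1)).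

Let nu0 : 0 < 2 * H - 1. Proof. by move: H12 => ?; lra. Qed.

Lemma Ckernel_ge0 : 0 <= Ckernel.
Proof.
have /andP[_ q1] := half_powR_lt1 nu0.
by rewrite divr_ge0 ?subr_ge0 ?(ltW q1)// mulr_ge0// powR_ge0.
Qed.

Lemma integral_indic_itv (a b c : R) : 0 <= c -> a <= b ->
  (\int[mu]_(v in setT) (c * \1_`[a, b] v)%:E = (c * (b - a))%:E)%E.
Proof.
move=> c0 ab.
under eq_integral do rewrite EFinM.
rewrite ge0_integralZl_EFin//; last first.
  by apply/measurable_EFinP; exact: measurable_indic.
rewrite integral_indic// setIT [X in (_ * X)%E](lebesgue_measure_itv `[a, b])/= lte_fin.
case: ltP => h; first by rewrite EFinM EFinB.
by rewrite (@le_anti _ _ a b) ?ab// subrr mule0 mulr0.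
Qed.

(** The singular kernel is dominated by a series of indicators: on the shell where [|u - v|] lies
    between two consecutive meshes it is largest at the inner radius, since [2 H - 2 <= 0]. *)
Lemma kernel_shells u v : 0 <= u <= T -> 0 <= v <= T ->
  ((`|u - v| `^ (2 * H - 2))%:E <=
    \sum_(j <oo) (mesh T j.+1 `^ (2 * H - 2) * \1_`[u - mesh T j, u + mesh T j] v)%:E)%E.
Proof.
move=> /andP[u0 uT] /andP[v0 vT].
have term0 j : (0 <= (mesh T j.+1 `^ (2 * H - 2) * \1_`[u - mesh T j, u + mesh T j] v)%:E)%E.
  by rewrite lee_fin mulr_ge0// powR_ge0.
suff [k hk] : exists k, `|u - v| `^ (2 * H - 2) <=
    mesh T k.+1 `^ (2 * H - 2) * \1_`[u - mesh T k, u + mesh T k] v.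
  apply: le_trans (nneseries_lim_ge k.+1 _) => //.
  rewrite big_nat_recr//=; apply: (@le_trans _ _ _ _ _ _ (leeDr _ _)); first by rewrite lee_fin; exact: hk.
  by apply: sume_ge0 => i _; exact: term0.
have uv : `|u - v| <= T by rewrite ler_norml; lra.
(* On the diagonal the power of 0 evaluates to 0, or to 1 when [H = 1]; the term of level 0 covers
   both. *)
have [->|uv0] := eqVneq u v.
  exists 0%N; rewrite subrr normr0 indicE mem_set ?mulr1; last first.
    by rewrite /= in_itv/= lerBlDr lerDl andbb ltW// mesh_gt0.
  have [e|ne] := eqVneq (2 * H - 2) 0; first by rewrite e !powRr0.
  by rewrite powR0// powR_ge0.
have n0 : 0 < `|u - v| by rewrite normr_gt0 subr_eq0.
have [k /andP[h1 h2]] := dyadic_level T0 (e := `|u - v|) ltac:(by rewrite n0).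
exists k; rewrite indicE mem_set ?mulr1; last first.
  by move: h2; rewrite /= in_itv/= distrC ler_distl.
have m0 := mesh_gt0 T0 k.+1.
have -> : 2 * H - 2 = - (2 - 2 * H) by ring.
rewrite !powRN lef_pV2 ?posrE ?powR_gt0//.
by apply: powR_mono; [move: H1 => ?; lra|exact: ltW|exact: ltW].
Qed.

Lemma kernel_le u : 0 <= u <= T ->
  (\int[mu]_(v in setT) (\1_`[0%R, T] v * `|u - v| `^ (2 * H - 2))%:E <= Ckernel%:E)%E.
Proof.
move=> uT; pose f j v := mesh T j.+1 `^ (2 * H - 2) * \1_`[u - mesh T j, u + mesh T j] v.
have f0 j v : (0 <= (f j v)%:E)%E by rewrite lee_fin mulr_ge0// powR_ge0.
apply: (@le_trans _ _ (\int[mu]_(v in setT) (\sum_(j <oo) (f j v)%:E))%E).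
  apply: ge0_le_integral_sup => v _; first by rewrite lee_fin mulr_ge0// powR_ge0.
  have [vT|vT] := boolP ((0 <= v) && (v <= T)).
    by rewrite indicE mem_set ?mul1r; [exact: kernel_shells|rewrite /= in_itv].
  rewrite indicE memNset ?mul0r; first by apply: nneseries_ge0 => j _ _.
  by rewrite /= in_itv/=; exact/negP.
rewrite integral_nneseries//; last first.
  move=> j; apply/measurable_EFinP; apply: measurable_funM; first exact: measurable_cst.
  exact: measurable_indic.
have fE j : (\int[mu]_(v in setT) (f j v)%:E =
    (4 * T `^ (2 * H - 1) * (2^-1 `^ (2 * H - 1)) ^+ j.+1)%:E)%E.
  have m0 := mesh_gt0 T0 j; have m1 := mesh_gt0 T0 j.+1.
  rewrite /f integral_indic_itv ?powR_ge0//; last by lra.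
  congr EFin; rewrite -mulrA -mesh_powR//.
  have -> : mesh T j.+1 `^ (2 * H - 1) = mesh T j.+1 `^ (2 * H - 2) * mesh T j.+1.
    rewrite -{3}(powRr1 (ltW m1)) -powRD; first by congr powR; ring.
    by apply/implyP => _; rewrite gt_eqF.
  by rewrite (meshS T j); ring.
apply: lime_le.
  by apply: is_cvg_nneseries => j _ _; apply: integral_ge0 => v _; exact: f0.
exists 0%N => // n _ /=.
under eq_bigr do rewrite fE.
rewrite sumEFin lee_fin -mulr_sumr /Ckernel; set q := 2^-1 `^ _.
have /andP[q0 q1] : 0 <= q < 1 by exact: half_powR_lt1 nu0.
apply: ler_wpM2l; first exact: (mulr_ge0 (ler0n R 4) (powR_ge0 _ _)).
have q10 : 0 < 1 - q by rewrite subr_gt0.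
have -> : \sum_(0 <= i < n) q ^+ i.+1 = (q - q ^+ n.+1) / (1 - q).
  elim: n => [|n IH]; first by rewrite big_geq// expr1 subrr mul0r.
  by rewrite big_nat_recr//= IH !exprS; field; rewrite gt_eqF.
rewrite -[leRHS]div1r ler_pM2r ?invr_gt0//.
have := exprn_ge0 n.+1 q0; lra.
Qed.

(** One factor of [D u D v] is bounded by [e], the other by the indicator of [[0, T]], against which
    the kernel integrates to at most [Ckernel] for each [u]. Convergence in [L^1] under a uniform
    bound thus implies convergence in the fBm norm. *)
Lemma fbm_sqnorm_le (D e : R -> R) : measurable_fun setT e ->
  (forall u, 0 <= e u) -> (forall u, `|D u| <= e u) ->
  (forall u, `|D u| <= \1_`[0, T] u) ->
  (`|fbm_sqnorm H D| <= (H * (2 * H - 1) * Ckernel)%:E * \int[mu]_(u in setT) (e u)%:E)%E.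
Proof.
move=> me e0 De D1.
have H0 : 0 < H by move: H12 => ?; lra.
rewrite /fbm_sqnorm abseM gee0_abs; last by rewrite lee_fin mulr_ge0 ?ltW.
rewrite [in leRHS]EFinM -muleA; apply: lee_wpmul2l; first by rewrite lee_fin mulr_ge0 ?ltW.
rewrite -ge0_integralZl_EFin ?Ckernel_ge0//; last 2 first.
- by move=> u _; rewrite lee_fin.
- exact/measurable_EFinP.
apply: abse_integral_le => u _.
apply: (@le_trans _ _ (\int[mu]_(v in setT)
    ((e u * \1_`[0, T] u)%:E * (\1_`[0%R, T] v * `|u - v| `^ (2 * H - 2))%:E))%E).
  apply: abse_integral_le => v _.
  rewrite -EFinM abse_EFin lee_fin normrM (ger0_norm (powR_ge0 _ _)) mulrA.
  apply: ler_wpM2r; first exact: powR_ge0.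
  rewrite normrM; apply: ler_pM => //.
  have := D1 u; rewrite indicE; case: (u \in _); rewrite ?mulr1// mulr0 => D0.
  exact: D0.
have mk : measurable_fun setT (fun v : R => (\1_`[0%R, T] v * `|u - v| `^ (2 * H - 2))%:E).
  apply/measurable_EFinP; apply: measurable_funM; first exact: measurable_indic.
  apply: (measurableT_comp (measurable_powR _)) => //.
  apply: measurableT_comp => //; apply: measurable_funB => //; exact: measurable_cst.
rewrite ge0_integralZl_EFin//; last by rewrite mulr_ge0.
have [uT|uT] := boolP ((0 <= u) && (u <= T)).
  rewrite indicE mem_set ?mulr1; last by rewrite /= in_itv.
  by rewrite muleC; apply: lee_wpmul2r; [rewrite lee_fin|exact: kernel_le].
rewrite indicE memNset ?mulr0 ?mul0e; first by rewrite -EFinM lee_fin mulr_ge0 ?Ckernel_ge0.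
by rewrite /= in_itv/=; exact/negP.
Qed.

End kernel.

Section step_approximation.
Context {R : realType}.
Notation mu := (@lebesgue_measure R).
Variables T H s t x : R.
Hypotheses (T0 : 0 < T) (H12 : 1 / 2 < H) (H1 : H <= 1).
Hypotheses (s0 : 0 <= s) (st : s <= t) (tT : t <= T) (x0 : 0 <= x).

Definition damp_on (v : R) : R := if (s <= v) && (v <= t) then damp x t v else 0.

(** The kernel is sampled at the right end of each cell, between the last grid points before [s] and
    before [t]; the Wiener sum is then exactly the block sum of [rsum_incr]. *)
Definition damp_step (k : nat) : @stepfun R :=
  [seq (damp x t (pt T k j.+1), pt T k j, pt T k j.+1) | j <- index_iota (gidx T k s) (gidx T k t)].

Lemma damp_step_ok k : step_ok (damp_step k).
Proof.
by rewrite /step_ok all_map; apply/allP => j _ /=; apply: pt_le => //; exact: leqnSn.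
Qed.

Lemma step_wiener_damp_step d (Om : measurableType d) (Xi : R -> Om -> R) k w :
  step_wiener Xi (damp_step k) w =
    psum T x (fun t s => Xi t w - Xi s w) k (gidx T k s) (gidx T k t) t.
Proof. by rewrite /step_wiener big_map. Qed.

Lemma step_val_damp_step k u : step_val (damp_step k) u =
  if (0 <= u) && (gidx T k s <= gidx T k u < gidx T k t)%N
  then damp x t (pt T k (gidx T k u).+1) else 0.
Proof.
rewrite /step_val big_map /=.
have [u0|u0] := leP 0 u.
  rewrite /= -(@big_nat1_eq R 0 +%R (fun j => damp x t (pt T k j.+1))) [RHS]big_mkcond/=.
  apply: eq_bigr => j _.
  have -> : (pt T k j <= u) && (u < pt T k j.+1) = (j == gidx T k u).
    by rewrite -gidx_ge// -gidx_lt// ltnS eqn_leq.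
  by case: eqP; rewrite ?mulr1 ?mulr0.
apply: big1 => j _; rewrite leNgt (lt_le_trans u0) ?mulr0//.
exact: pt_ge0.
Qed.

(** The first term is the variation of the exponential inside a cell. The other two are strips of
    one mesh before [s] and before [t], where only one of the two functions may be nonzero. *)
Definition step_error (k : nat) (u : R) : R := x * mesh T k * \1_`[0, T] u +
  (1 * \1_`[s - mesh T k, s] u + 1 * \1_`[t - mesh T k, t] u).

Let indic_itv (a b u : R) : a <= u -> u <= b -> \1_`[a, b] u = 1 :> R.
Proof. by move=> au ub; rewrite indicE mem_set//= in_itv/= au. Qed.

Let i0 (a b u : R) : 0 <= \1_`[a, b] u :> R. Proof. by rewrite indicE ler0n. Qed.

Lemma step_errorP k u : `|damp_on u - step_val (damp_step k) u| <= step_error k u /\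
  `|damp_on u - step_val (damp_step k) u| <= \1_`[0, T] u.
Proof.
have m0 := mesh_gt0 T0 k.
have t0 := le_trans s0 st.
have xm : 0 <= x * mesh T k by rewrite mulr_ge0// ltW.
have e1 : 0 <= x * mesh T k * \1_`[0, T] u by exact: mulr_ge0.
have e2 := i0 (s - mesh T k) s u.
have e3 := i0 (t - mesh T k) t u.
rewrite step_val_damp_step /damp_on /step_error !mul1r.
have [u0|u0] := leP 0 u; last first.
  by rewrite (lt_geF (lt_le_trans u0 s0))/= subrr normr0 !addr_ge0.
have /andP[s1 s2] := gidxP T0 k s0.
have /andP[t1 t2] := gidxP T0 k t0.
have /andP[u1 u2] := gidxP T0 k u0.
rewrite ptS in s2; rewrite ptS in t2.
case: (boolP (_ && _)) => [/andP[su ut]|sut]; case: (boolP (true && _)) => [/andP[_ /andP[gs gt]]|gst].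
- rewrite (indic_itv u0 (le_trans ut tT)) mulr1 in e1 *.
  have pt' : pt T k (gidx T k u).+1 <= t by apply: le_trans t1; exact: pt_le.
  have -> : damp x t u - damp x t (pt T k (gidx T k u).+1) =
      - (damp x t (pt T k (gidx T k u).+1) * (1 - damp x (pt T k (gidx T k u).+1) u)).
    by rewrite -(dampM x t (pt T k (gidx T k u).+1) u); ring.
  have q0 := one_damp_ge0 x0 (ltW u2).
  rewrite normrN (ger0_norm (mulr_ge0 (ltW (damp_gt0 _ _ _)) q0)).
  have D1 := damp_le1 x0 pt'.
  have le1 : damp x t (pt T k (gidx T k u).+1) * (1 - damp x (pt T k (gidx T k u).+1) u)
      <= 1 - damp x (pt T k (gidx T k u).+1) u by rewrite ler_piMl.
  split.
    apply: (le_trans le1); apply: (@le_trans _ _ (x * mesh T k)); last by rewrite lerDl addr_ge0.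
    apply: (le_trans (one_damp_le _ _ _)); rewrite ler_wpM2l// ptS; lra.
  by apply: (le_trans le1); rewrite gerBl ltW// damp_gt0.
(* The kernel alone: [u] is in the incomplete cell before [t]. *)
- rewrite subr0 (ger0_norm (ltW (damp_gt0 _ _ _))).
  have D1 := damp_le1 x0 ut.
  split; last by rewrite indic_itv// (le_trans ut).
  have gt : (gidx T k t <= gidx T k u)%N.
    by rewrite leqNgt; apply: contra gst => h; rewrite h andbT/= gidx_le.
  have : pt T k (gidx T k t) <= u by rewrite -gidx_ge.
  move=> tu; rewrite (@indic_itv (t - mesh T k) t u)//; last lra.
  lra.
(* The step function alone: [u] is before [s], in the cell that contains [s]. *)
- rewrite sub0r normrN (ger0_norm (ltW (damp_gt0 _ _ _))).
  have pt' : pt T k (gidx T k u).+1 <= t by apply: le_trans t1; exact: pt_le.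
  have D1 := damp_le1 x0 pt'.
  have ut : u <= t by apply: ltW; apply: lt_le_trans pt'.
  split; last by rewrite indic_itv// (le_trans ut).
  have us : u <= s by rewrite leNgt; apply: contra sut => /ltW ->; rewrite ut.
  have : pt T k (gidx T k s) <= u by rewrite -gidx_ge.
  move=> tu; rewrite (@indic_itv (s - mesh T k) s u)//; last lra.
  lra.
- by rewrite subrr normr0 !addr_ge0.
Qed.

Lemma integral_step_error k :
  (\int[mu]_(u in setT) (step_error k u)%:E = ((x * T + 2) * mesh T k)%:E)%E.
Proof.
have m0 := mesh_gt0 T0 k.
have mi (c a b : R) : measurable_fun setT (fun u : R => (c * \1_`[a, b] u)%:E).
  apply/measurable_EFinP; apply: measurable_funM; first exact: measurable_cst.
  exact: measurable_indic.
have xm : 0 <= x * mesh T k by rewrite mulr_ge0// ltW.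
under eq_integral do rewrite /step_error !EFinD.
have i0' (c a b u : R) : 0 <= c -> [set: R] u -> (0 <= (c * \1_`[a, b] u)%:E)%E.
  by move=> c0 _; rewrite lee_fin mulr_ge0.
rewrite ge0_integralD//; last 4 first.
- by move=> u uT; exact: i0'.
- exact: mi.
- by move=> u uT; rewrite adde_ge0 ?i0'.
- by apply: emeasurable_funD; exact: mi.
rewrite ge0_integralD//; last 2 first.
- exact: mi.
- exact: mi.
rewrite !integral_indic_itv//; [|lra|lra|exact: ltW].
by rewrite -!EFinD; congr EFin; ring.
Qed.

Lemma fbm_sqnorm_damp_step :
  (fun k => fbm_sqnorm H (fun u => damp_on u - step_val (damp_step k) u)) @ \oo --> 0%E.
Proof.
pose b k : R := H * (2 * H - 1) * Ckernel T H * ((x * T + 2) * mesh T k).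
have hb k : (`|fbm_sqnorm H (fun u => damp_on u - step_val (damp_step k) u)%R| <= (b k)%:E)%E.
  rewrite /b EFinM -integral_step_error.
  apply: fbm_sqnorm_le => //.
  - by do ![apply: measurable_funD | apply: measurable_funM].
  - by move=> u; have [h _] := step_errorP k u; apply: le_trans h.
  - by move=> u; have [h _] := step_errorP k u.
  - by move=> u; have [_ h] := step_errorP k u.
have b0 : b @ \oo --> (0 : R).
  rewrite -[X in _ --> X](mulr0 (H * (2 * H - 1) * Ckernel T H)).
  apply: cvgM; first exact: cvg_cst.
  rewrite -[X in _ --> X](mulr0 (x * T + 2)).
  apply: cvgM; first exact: cvg_cst.
  rewrite (_ : mesh T = fun k => mesh T k `^ 1); first exact: mesh_cvg.
  by apply/funext => k; rewrite powRr1// ltW// mesh_gt0.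
have bE : (EFin \o b) @ \oo --> 0%E by apply: cvg_EFin => //; near=> k.
have bN : (EFin \o (fun k => - b k)) @ \oo --> 0%E.
  apply: cvg_EFin; first by near=> k.
  by rewrite -oppr0; apply: cvgN.
apply: (squeeze_cvge _ bN bE); near=> k.
apply/andP; split; last exact: le_trans (lee_abs _) (hb k).
rewrite /= EFinN leeNl; apply: le_trans (hb k).
by rewrite -abseN; exact: lee_abs.
Unshelve. all: by end_near.
Qed.

End step_approximation.

Lemma measurable_wconv (R : realType) (T gamma K : R) (p : R -> R) t :
  0 < T -> 0 < gamma <= 1 -> 0 <= K -> holder gamma K T p -> 0 <= t -> t <= T ->
  measurable_fun (`[0%R, +oo[%classic : set R) (wconv T p t).
Proof.
move=> T0 g01 K0 hp t0 tT.
apply: (measurable_fun_cvg (h := fun k x => rsum T x (fun t s => p t - p s) t k)).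
  move=> k; rewrite /rsum /psum; apply: measurable_sum => j.
  by apply: measurable_funM; [exact: measurable_damp|exact: measurable_cst].
move=> x /=; rewrite in_itv/= andbT => x0.
exact: (wconv_cvg T0 g01 K0 hp).
Qed.

(** * Pathwise convolutions as Wiener integrals *)

Section wiener_version.
Context d (Om : measurableType d) (R : realType) (P : probability Om R).
Variables (X X' : R -> Om -> R) (T H gamma c : R).
Hypotheses (T0 : 0 < T) (H0 : 0 < H) (g01 : 0 < gamma <= 1) (c0 : 0 <= c).
Hypothesis mX : forall t, measurable_fun setT (X t).
Hypothesis mX' : forall t, measurable_fun setT (X' t).
Hypothesis incr : forall s t, L2le P (fun w => X t w - X s w) (c * `|t - s| `^ H).
Hypothesis X'X : forall t, {ae P, forall w, X' t w = X t w}.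
Hypothesis hX' : forall w, exists2 K, 0 <= K & holder gamma K T (X' ^~ w).

Let G w (t s : R) : R := X' t w - X' s w.

Let incr' s t : L2le P (fun w => G w t s) (c * `|t - s| `^ H).
Proof.
have [m1 h1] := incr s t.
have m2 : measurable_fun setT (fun w => G w t s) by exact: measurable_funB.
split => //; apply: le_trans h1.
rewrite le_eqVlt; apply/orP; left; apply/eqP.
apply: ge0_ae_eq_integral => //; try exact: measurable_sqr.
- by move=> w _; rewrite lee_fin sqr_ge0.
- by move=> w _; rewrite lee_fin sqr_ge0.
by apply: filterS2 (X'X s) (X'X t) => w es et _; rewrite /G es et.
Qed.

Let mrsum x t k : measurable_fun setT (fun w => rsum T x (G w) t k).
Proof.
rewrite /rsum /psum; apply: measurable_sum => j.
by apply: measurable_funM; [exact: measurable_cst|exact: measurable_funB].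
Qed.

Let rsum_cvg x t w : 0 <= x -> 0 <= t -> t <= T ->
  (fun k => rsum T x (G w) t k) @ \oo --> wconv T (X' ^~ w) t x.
Proof. by move=> x0 t0 tT; have [K K0 hK] := hX' w; exact: (wconv_cvg T0 g01 K0 hK). Qed.

(** The term [2 T (x + 1)] comes from the defects, since [(N + 1) mesh <= 2 T], and the 1 from the
    new cell; [x + 1] and [c + 1] stand for [x] and [c] to keep the bounds positive. *)
Let C x : R := (2 * T * (x + 1) + 1) * (c + 1) * T `^ H.
Let q : R := 2^-1 `^ H.

Let q01 : 0 < q < 1.
Proof. by have /andP[_ ->] := half_powR_lt1 H0; rewrite powR_gt0// invr_gt0. Qed.

Let C_gt0 x : 0 <= x -> 0 < C x.
Proof.
move=> x0; have c1 : 0 < c + 1 by rewrite ltr_wpDl.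
have x1 : 0 < x + 1 by rewrite ltr_wpDl.
have h : 0 < 2 * T * (x + 1) + 1 by rewrite addr_gt0// mulr_gt0// mulr_gt0.
exact: (mulr_gt0 (mulr_gt0 h c1) (powR_gt0 _ T0)).
Qed.

(* One refinement of the grid changes the sum by the defects
   [(1 - exp(-x h)) (X'_m - X'_l)], of size [O(h)] times an increment of [X']. *)
Let rsum_step_L2 x t k : 0 <= x -> 0 <= t -> t <= T ->
  L2le P (fun w => rsum T x (G w) t k.+1 - rsum T x (G w) t k) (C x * q ^+ k).
Proof.
move=> x0 t0 tT.
have m0 := mesh_gt0 T0 k; have m1 := mesh_gt0 T0 k.+1; have m2 := meshS T k.
have pm : 0 < mesh T k `^ H by exact: powR_gt0.
have c1 : 0 < c + 1 by rewrite ltr_wpDl.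
have x1 : 0 < x + 1 by rewrite ltr_wpDl.
set b := (x + 1) * mesh T k * ((c + 1) * mesh T k `^ H).
have b0 : 0 < b by exact: (mulr_gt0 (mulr_gt0 x1 m0) (mulr_gt0 c1 pm)).
have b'0 : 0 < (c + 1) * mesh T k `^ H by exact: mulr_gt0.
have small j : L2le P (fun w => G w (pt T k.+1 j.+1) (pt T k.+1 j)) ((c + 1) * mesh T k `^ H).
  apply: L2le_mono (incr' _ _); first by rewrite mulr_ge0// powR_ge0.
  apply: ler_pM; [exact: c0|exact: powR_ge0|by rewrite lerDl|].
  rewrite ptS addrC addKr (ger0_norm (ltW m1)).
  by apply: powR_mono; [exact: ltW|exact: ltW|lra].
have N2 : (gidx T k t <= 2 ^ k)%N by apply: gidx_max => //; rewrite t0.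
set N := gidx T k t in N2.
have ptN : pt T k N <= t by have /andP[] := gidxP T0 k t0.
have bE : N.+1%:R * b + (c + 1) * mesh T k `^ H <= C x * q ^+ k.
  have -> : C x * q ^+ k = 2 * T * (x + 1) * ((c + 1) * mesh T k `^ H) + (c + 1) * mesh T k `^ H.
    by rewrite mesh_powR//; rewrite /C -/q; ring.
  rewrite lerD2r /b mulrA ler_wpM2r ?(ltW b'0)//.
  have -> : N.+1%:R * ((x + 1) * mesh T k) = N.+1%:R * mesh T k * (x + 1) by ring.
  rewrite ler_wpM2r ?(ltW x1)//.
  have := ptS T k N; rewrite /pt => ->.
  have : mesh T k <= T.
    by rewrite -[leRHS](pt_full T k) /pt ler_peMl ?(ltW m0)// ler1n expn_gt0.
  by rewrite /pt in ptN; lra.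
apply: L2le_mono bE _.
  by apply: addr_ge0; [exact: (mulr_ge0 (ler0n _ _) (ltW b0))|exact: ltW].
rewrite (_ : (fun w => _) = (fun w => \sum_(0 <= j < N)
      (damp x t (pt T k j.+1) * - (1 - damp x (pt T k j.+1) (pt T k.+1 j.*2.+1)) *
         G w (pt T k.+1 j.*2.+1) (pt T k.+1 j.*2))
    + (if gidx T k.+1 t == N.*2 then 0
       else damp x t (pt T k.+1 N.*2.+1)) * G w (pt T k.+1 N.*2.+1) (pt T k.+1 N.*2))); last first.
  apply/funext => w; rewrite rsum_stepE// -/N; congr (_ + _).
    by apply: eq_bigr => j _; rewrite pt_double /G; ring.
  case: eqP => [_|/eqP ne]; first by rewrite mul0r.
  have [e|->//] := gidxS T0 k t0.
  by rewrite e eqxx in ne.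
apply: L2le_add => //; first exact: mulr_gt0.
  apply: L2le_sum => // j jN.
  have e2 : pt T k j.+1 = pt T k.+1 j.*2.+2 by rewrite -doubleS pt_double.
  have jt : pt T k j.+1 <= t by apply: le_trans ptN; exact: pt_le.
  have v2 : pt T k.+1 j.*2.+1 <= pt T k j.+1 by rewrite e2 pt_le.
  apply: L2le_mono (L2le_scale _ (small j.*2)).
    by rewrite mulr_ge0// ltW.
  rewrite ler_wpM2r ?(ltW b'0)//.
  apply: damp_norm_le => //; rewrite normrN ger0_norm ?one_damp_ge0//.
  apply: (le_trans (one_damp_le _ _ _)).
  by apply: ler_pM => //; rewrite ?subr_ge0// ?lerDl// e2 (ptS T k.+1 j.*2.+1) addrC addKr; lra.
apply: L2le_mono (L2le_scale _ (small N.*2)); first by rewrite mulr_ge0// ltW.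
rewrite ler_piMl ?(ltW b'0)//.
case: eqP => [_|/eqP ne]; first by rewrite normr0.
rewrite (ger0_norm (ltW (damp_gt0 _ _ _))) damp_le1//.
have /andP[h _] := gidxP T0 k.+1 t0.
by have [e|e] := gidxS T0 k t0; rewrite -/N in e; rewrite e ?eqxx in ne h.
Qed.

Let C' : R := 1 + (1 - q)^-1.

Let rsum_L2 x t k : 0 <= x -> 0 <= t -> t <= T ->
  L2le P (fun w => wconv T (X' ^~ w) t x - rsum T x (G w) t k) (C x * q ^+ k * C').
Proof.
move=> x0 t0 tT.
apply: (@L2le_geometric _ _ _ P (fun k w => rsum T x (G w) t k)) => //.
- exact: C_gt0.
- by move=> w; exact: rsum_cvg.
- by move=> n; exact: rsum_step_L2.
Qed.

(** The Wiener sum of [damp_step] is a difference of two dyadic sums, at [t] and, damped, at [s];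
    each converges in [L^2] to the pathwise limit at a geometric rate. *)
Lemma wiener_integral_wconv s t x : 1 / 2 < H -> H <= 1 -> 0 <= s -> s <= t -> t <= T -> 0 <= x ->
  wiener_integral P H X (fun v => if (s <= v) && (v <= t) then expR (- (x * (t - v))) else 0)
    (fun w => dconv (wconv T (X' ^~ w)) t s x).
Proof.
move=> H12 H1 s0 st tT x0.
have t0 := le_trans s0 st; have sT := le_trans st tT.
have mZ : measurable_fun setT (fun w => dconv (wconv T (X' ^~ w)) t s x).
  apply: (measurable_fun_cvg (h := fun k w => rsum T x (G w) t k - damp x t s * rsum T x (G w) s k)).
    by move=> k; apply: measurable_funB => //; apply: measurable_funM => //; exact: measurable_cst.
  move=> w _; apply: cvgB; first exact: rsum_cvg.
  by apply: cvgM; [exact: cvg_cst|exact: rsum_cvg].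
split => //; exists (damp_step T s t x); split; first by move=> k; exact: damp_step_ok.
split; first exact: fbm_sqnorm_damp_step.
have /andP[q0 q1] := q01.
have C0 := C_gt0 x0.
have C'0 : 0 < C' by rewrite addr_gt0// invr_gt0 subr_gt0.
have b0 k : 0 < C x * q ^+ k * C' by rewrite mulr_gt0// mulr_gt0// exprn_gt0.
pose b k := C x * q ^+ k * C' + C x * q ^+ k * C'.
have hb k : (\int[P]_(w in setT)
    ((step_wiener X (damp_step T s t x k) w - dconv (wconv T (X' ^~ w)) t s x) ^+ 2)%:E
    <= (b k ^+ 2)%:E)%E.
  pose S w := psum T x (G w) k (gidx T k s) (gidx T k t) t.
  have mS : measurable_fun setT S.
    by apply: measurable_sum => j; apply: measurable_funM; [exact: measurable_cst|exact: measurable_funB].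
  have mW : measurable_fun setT (step_wiener X (damp_step T s t x k)).
    rewrite (_ : step_wiener _ _ = fun w => psum T x (fun t s => X t w - X s w) k (gidx T k s) (gidx T k t) t).
      by apply: measurable_sum => j; apply: measurable_funM; [exact: measurable_cst|exact: measurable_funB].
    by apply/funext => w; exact: step_wiener_damp_step.
  have -> : (\int[P]_(w in setT)
      ((step_wiener X (damp_step T s t x k) w - dconv (wconv T (X' ^~ w)) t s x) ^+ 2)%:E =
      \int[P]_(w in setT) ((dconv (wconv T (X' ^~ w)) t s x - S w) ^+ 2)%:E)%E.
    apply: ge0_ae_eq_integral => //.
    - by apply: measurable_sqr; exact: measurable_funB.
    - by apply: measurable_sqr; exact: measurable_funB.
    - by move=> w _; rewrite lee_fin sqr_ge0.
    - by move=> w _; rewrite lee_fin sqr_ge0.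
    (* The sum samples the process at grid points only, and [X] and [X'] agree at all of them
       outside a countable union of null sets. *)
    have := ae_foralln (fun j => X'X (pt T k j)).
    apply: filterS => w e _; rewrite step_wiener_damp_step -sqrrN opprB /S /psum /G.
    congr (((_ - _) ^+ 2)%:E).
    by apply: eq_bigr => j _; rewrite !e.
  suff [] : L2le P (fun w => dconv (wconv T (X' ^~ w)) t s x - S w) (b k) by [].
  rewrite (_ : (fun w => _) = (fun w => (wconv T (X' ^~ w) t x - rsum T x (G w) t k)
      + - damp x t s * (wconv T (X' ^~ w) s x - rsum T x (G w) s k))); last first.
    by apply/funext => w; rewrite /S -rsum_incr// /dconv; ring.
  apply: L2le_add => //; first exact: rsum_L2.
  apply: L2le_mono (L2le_scale _ (rsum_L2 k x0 s0 sT)).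
    by rewrite mulr_ge0// ltW.
  rewrite ler_piMl ?(ltW (b0 k))//.
  by rewrite normrN (ger0_norm (ltW (damp_gt0 _ _ _))) damp_le1.
have cb : (fun k => b k ^+ 2) @ \oo --> (0 : R).
  have qk : (fun k => q ^+ k) @ \oo --> (0 : R).
    by apply: cvg_expr; rewrite ger0_norm// ltW.
  have bk : b @ \oo --> (0 : R).
    rewrite -[X in _ --> X](addr0 0); apply: cvgD.
      rewrite -[X in _ --> X](mul0r C') -(mulr0 (C x)).
      by apply: cvgM; [apply: cvgM => //; exact: cvg_cst|exact: cvg_cst].
    rewrite -[X in _ --> X](mul0r C') -(mulr0 (C x)).
    by apply: cvgM; [apply: cvgM => //; exact: cvg_cst|exact: cvg_cst].
  by rewrite -[X in _ --> X](mulr0 0); apply: cvgM.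
have bE : (EFin \o (fun k => b k ^+ 2)) @ \oo --> 0%E by apply: cvg_EFin => //; near=> k.
apply: (squeeze_cvge _ (cvg_cst 0%E) bE); near=> k.
rewrite hb andbT; apply: integral_ge0 => w _; rewrite lee_fin; exact: sqr_ge0.
Unshelve. all: by end_near.
Qed.

End wiener_version.

(** * The degenerate dimension and the Hurst parameter *)

Section zero_rows.
Context {R : realType}.
Variables (phi : R -> R) (gamma T : R).
Local Notation Pos := (`]0%R, +oo[%classic : set R).
Local Notation mu := (@lebesgue_measure R).
Hypothesis mphi : measurable_fun Pos phi.
Hypothesis fphi : (\int[mu]_(xi in Pos) (`|phi xi| * (1 + xi `^ gamma))%:E < +oo)%E.
Local Notation N := (Nphi phi gamma).

Let N00 k (g : R -> 'rV[R]_k) : (forall xi, g xi = 0) -> N g = 0%E.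
Proof. by move=> h; apply: (N0 mphi fphi) => xi _. Qed.

Lemma inL0 k (g : R -> 'rV[R]_k) : (forall xi, g xi = 0) -> inL phi gamma g.
Proof.
move=> h; split; last by rewrite N00.
move=> j; rewrite (_ : (fun _ => _) = cst 0); first exact: measurable_cst.
by apply/funext => xi; rewrite h mxE.
Qed.

Lemma hoelder2_0 k mu' (B : R -> R -> R -> 'rV[R]_k) :
  (forall t s xi, B t s xi = 0) -> Defs.hoelder2 phi gamma T mu' B.
Proof. by move=> h; exists 0 => t s _ _ _; rewrite N00 ?mul0r. Qed.

Lemma inC2gamma0 k (B : R -> R -> R -> 'rV[R]_k) :
  (forall t s xi, B t s xi = 0) -> inC2gamma phi gamma T B.
Proof.
move=> h; split; last exact: hoelder2_0.
split=> [t s _|t s _ e e0]; first exact: inL0.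
by exists 1 => // t' s' _ _ _; rewrite N00 ?lte_fin// => xi; rewrite !h subrr.
Qed.

Lemma dtilde1_0 k (t s xi : R) : dtilde1 (fun _ _ => 0 : 'rV[R]_k) t s xi = 0.
Proof. by rewrite /dtilde1 scaler0 subrr. Qed.

Lemma inC1gamma0 k : inC1gamma phi gamma T (fun _ _ => 0 : 'rV[R]_k).
Proof.
split; first split=> [s _|s _ e e0]; first exact: inL0.
  by exists 1 => // s' _ _; rewrite N00 ?lte_fin// => xi; rewrite subrr.
split; first by exists 0 => s _; rewrite N00.
by apply: hoelder2_0 => t s xi; rewrite dtilde1_0.
Qed.

(* Without noise components the driving integral vanishes, and sewing uniqueness
   leaves only the zero solution, for any [gamma]. *)
Lemma rde_solution_dim0 m (Xt : R -> R -> R -> 'rV[R]_0) (sigma : 'rV[R]_m -> 'M[R]_(0, m)) a0 :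
  0 < T ->
  exists Y : R -> R -> 'rV[R]_m, solves_rde phi gamma T Xt sigma a0 Y /\
    forall Y', solves_rde phi gamma T Xt sigma a0 Y' ->
    forall t, 0 <= t <= T -> Leq phi gamma (Y' t) (Y t).
Proof.
move=> T0; have z (v : 'rV[R]_0) (M : 'M[R]_(0, m)) : v *m M = 0 by rewrite (flatmx0 M) mulmx0.
exists (fun _ _ => 0); split.
  split; first exact: inC1gamma0.
  split; first by apply: N00 => xi; rewrite subr0.
  split; first by exists 0 => -[].
  have L0 t s xi (M : 'M[R]_(0, m)) : dtilde1 (fun _ _ => 0 : 'rV[R]_m) t s xi - Xt t s xi *m M = 0.
    by rewrite dtilde1_0 z subr0.
  exists 2; split; first by rewrite ltr1n.
  split; first by exists 0 => t u s _ _ _ _ _; rewrite N00 ?mul0r.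
  split; first by move=> t s _; apply: inL0.
  split; first by apply: hoelder2_0.
  move=> t u s _ _ _ _; apply: N00 => xi.
  by rewrite /dtilde2 !L0 z scaler0 !subr0.
move=> Y' [[[LY' _] _] [Y'0 [_ [mu1 [mu11 [_ [LLam [hLam dLam]]]]]]]] t /andP[].
have LamE t' s xi (M : 'M[R]_(0, m)) : dtilde1 Y' t' s xi - Xt t' s xi *m M = dtilde1 Y' t' s xi.
  by rewrite z subr0.
set Lam : R -> R -> R -> 'rV[R]_m := (fun t s xi => dtilde1 Y' t s xi - _) in LLam hLam dLam.
have mQ t' s : 0 <= s -> s <= t' -> t' <= T -> mrow (Lam t' s).
  by move=> s0 st tT; apply: inL_mrow; apply: LLam.
have dQ t' u s : 0 <= s -> s <= u -> u <= t' -> t' <= T -> N (dtilde2 Lam t' u s) = 0%E.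
  move=> s0 su ut tT; apply: etrans (dLam t' u s s0 su ut tT); apply: Nphi_ext => xi _.
  by rewrite z subr0.
have QN := sewing_unique mphi mu11 mQ hLam dQ.
rewrite le_eqVlt => /orP[/eqP <- _|t0 tT]; first exact: Y'0.
have t00 := ltW t0.
apply/le_anti; rewrite Nphi_ge0 andbT.
apply: (@le_trans _ _ (N (Lam t 0%R) + N (Y' 0%R))%E); last first.
  rewrite QN// add0e -Y'0; apply: Nphi_mono => xi _; by rewrite subr0.
apply: (@Nphi_triangle R phi gamma mphi m m m (Lam t 0) (Y' 0)); [exact: mQ| |].
  by apply: inL_mrow; apply: LY'; rewrite lexx ltW.
move=> xi xi0.
have -> : Y' t xi - 0 = Lam t 0 xi + damp xi t 0 *: Y' 0 xi.
  by rewrite /Lam LamE dtilde1E subrK subr0.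
apply: (le_trans (ler_normD _ _)); rewrite lerD2l normrZ (ger0_norm (ltW (damp_gt0 _ _ _))).
by rewrite ler_piMl// damp_le1.
Qed.

End zero_rows.

(** * Variances of fractional Brownian motion and the bound on the Hurst parameter *)

Section fbm.
Context d (Om : measurableType d) (R : realType) (P : probability Om R).

(* For [v < 0] the square root is the junk value [0], and [normal_prob 0 0] is the uniform
   law on [[0, 1]]: it charges no negative number, hence cannot be the law of both [Y] and [- Y]. *)
Lemma centered_gaussian_ge0 (Y : Om -> R) v :
  centered_gaussian P Y v -> centered_gaussian P (fun w => - Y w) v -> 0 <= v.
Proof.
move=> [mY hY] [mY' hY']; rewrite leNgt; apply/negP => v0.
have A0 : normal_prob 0 (Num.sqrt v) (`]-oo, 0%R]%classic : set R) = 0%E.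
  rewrite ler0_sqrtr ?ltW// /normal_prob /normal_pdf eqxx integral_indic//.
  rewrite (_ : _ `&` _ = [set 0]); first exact: lebesgue_measure_set1.
  apply/seteqP; split => x /=; rewrite !in_itv/=.
    by move=> [/andP[x0 _] x0']; apply/le_anti; rewrite x0 x0'.
  by move=> ->; rewrite lexx ler01.
have := hY (`]-oo, 0%R]%classic : set R) (measurable_itv _).
have := hY' (`]-oo, 0%R]%classic : set R) (measurable_itv _).
rewrite (lt_eqF v0) A0 => h2 h1.
have m1 : measurable (Y @^-1` (`]-oo, 0%R]%classic : set R)).
  by rewrite -[X in measurable X]setTI; apply: mY => //; exact: measurable_itv.
have m2 : measurable ((fun w => - Y w) @^-1` (`]-oo, 0%R]%classic : set R)).
  by rewrite -[X in measurable X]setTI; apply: mY' => //; exact: measurable_itv.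
have : (1 <= 0 :> \bar R)%E.
  rewrite -{1}(@probability_setT _ _ _ P).
  rewrite (_ : setT = Y @^-1` (`]-oo, 0%R]%classic : set R) `|`
      (fun w => - Y w) @^-1` (`]-oo, 0%R]%classic : set R)).
    apply: (le_trans (measureU2 _ m1 m2)).
    by rewrite [X in (X + _)%E]h1 [X in (_ + X)%E]h2 adde0.
  apply/seteqP; split => // w _ /=; rewrite !in_itv/= oppr_le0.
  by have [h|h] := leP (Y w) 0; [left|right; exact: ltW].
by rewrite lee_fin ler10.
Qed.

Variables (n : nat) (H : R) (X : 'I_n -> R -> Om -> R).
Hypotheses (fX : is_fBm P H X) (H0 : 0 < H).

Lemma fbm_measurable i t : measurable_fun setT (X i t).
Proof.
have [m _] := @fX 1 (fun=> i) (fun=> t) (fun=> 1).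
by rewrite (_ : X i t = fun w => \sum_(l < 1) 1 * X i t w)//; apply/funext => w; rewrite big_ord1 mul1r.
Qed.

Lemma fbm_pair i s t a b : centered_gaussian P (fun w => a * X i s w + b * X i t w)
  (a ^+ 2 * `|s| `^ (2 * H) + b ^+ 2 * `|t| `^ (2 * H)
    + a * b * (`|s| `^ (2 * H) + `|t| `^ (2 * H) - `|t - s| `^ (2 * H))).
Proof.
have z0 : (0 : R) `^ (2 * H) = 0 by apply: powR0; rewrite mulf_neq0// gt_eqF.
have := @fX 2 (fun=> i) (fun l => if l == 0 then s else t) (fun l => if l == 0 then a else b).
rewrite (_ : (fun w => _) = (fun w => a * X i s w + b * X i t w)); last first.
  by apply/funext => w; rewrite !big_ord_recl big_ord0/= addr0.
rewrite !big_ord_recl !big_ord0/= !eqxx/= /fbm_cov !subrr normr0 z0 (distrC s t).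
by congr centered_gaussian; field.
Qed.

Lemma fbm_increment i s t : centered_gaussian P (fun w => X i t w - X i s w) (`|t - s| `^ (2 * H)).
Proof.
have := fbm_pair i s t (-1) 1.
rewrite (_ : (fun w => _) = (fun w => X i t w - X i s w)); last first.
  by apply/funext => w; rewrite mulN1r mul1r addrC.
by congr centered_gaussian; ring.
Qed.

(* [X_2 - 2 X_1] would have variance [4 - 2^(2H)]. *)
Lemma fbm_hurst_le1 (i : 'I_n) : H <= 1.
Proof.
have := centered_gaussian_ge0 (fbm_pair i 2 1 1 (-2)).
rewrite (_ : (fun w => - _) = (fun w => -1 * X i 2 w + 2 * X i 1 w)); last first.
  by apply/funext => w; ring.
have h1 : `|1 : R| = 1 by exact: normr1.
have h2 : `|2 : R| = 2 by exact: normr_nat.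
have h3 : `|1 - 2 : R| = 1 by rewrite distrC (_ : 2 - 1 = 1) ?normr1//; ring.
have := fbm_pair i 2 1 (-1) 2; rewrite h1 h2 h3 powR1 => g1 h.
have {h}: 0 <= 4 - (2 : R) `^ (2 * H).
  have e : 1 ^+ 2 * 2 `^ (2 * H) + (-2) ^+ 2 * 1 + 1 * -2 * (2 `^ (2 * H) + 1 - 1) = 4 - 2 `^ (2 * H) :> R.
    by ring.
  rewrite -e; apply: h; move: g1; congr centered_gaussian; ring.
move=> v0; rewrite leNgt; apply/negP => H1'; move: v0; rewrite leNgt => /negP; apply.
rewrite subr_lt0 (_ : 4 = 2 `^ 2 :> R); last by rewrite (powR_mulrn 2) ?ler0n//; ring.
by rewrite /powR pnatr_eq0/= ltr_expR ltr_pM2r ?ln_gt0 ?ltr1n//; lra.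
Qed.

End fbm.

Theorem theorem3p14 (R : realType) (d : measure_display) (Om : measurableType d)
  (P : probability Om R) (n : nat) (H : R) (X : 'I_n -> R -> Om -> R)
  (phi : R -> R) (gamma T : R) :
  is_fBm P H X -> 1 / 2 < H -> 0 < T ->
  1 / 2 < gamma -> gamma < H ->
  measurable_fun (`]0%R, +oo[%classic : set R) phi ->
  (\int[lebesgue_measure]_(xi in (`]0%R, +oo[%classic : set R)) (`|phi xi| * (1 + xi `^ gamma))%:E < +oo)%E ->
  exists (X' : 'I_n -> R -> Om -> R) (Xt : R -> R -> R -> Om -> 'rV[R]_n),
    (* X' is a version of X *)
    (forall i t, {ae P, forall w, X' i t w = X i t w}) /\
    (* Xt is a version of the Wiener integrals int_s^t e^{-xi(t-v)} dX^(i)_v *)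
    (forall (i : 'I_n) (t s xi : R), 0 <= s -> s <= t -> t <= T -> 0 <= xi ->
       wiener_integral P H (X i)
         (fun v => if (s <= v) && (v <= t) then expR (- (xi * (t - v))) else 0)
         (fun w => Xt t s xi w 0 i)) /\
    (* almost surely: Hoelder regularity and dtilde Xt = 0 *)
    {ae P, forall w,
       (exists C : R, forall i s t, 0 <= s <= T -> 0 <= t <= T ->
          `|X' i t w - X' i s w| <= C * `|t - s| `^ gamma) /\
       inC2gamma phi gamma T (fun t s xi => Xt t s xi w) /\
       (forall t u s, 0 <= s -> s <= u -> u <= t -> t <= T ->
          Leq phi gamma (dtilde2 (fun t s xi => Xt t s xi w) t u s) (fun _ => 0))} /\
    (* consequently: unique solvability of the rough convolutional equation *)
    (forall (m : nat) (sigma : 'rV[R]_m -> 'M[R]_(n, m)) (a0 : 'rV[R]_m),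
       (forall i j, C2b (fun x => sigma x i j)) ->
       {ae P, forall w,
          exists Y : R -> R -> 'rV[R]_m,
            solves_rde phi gamma T (fun t s xi => Xt t s xi w) sigma a0 Y /\
            forall Y' : R -> R -> 'rV[R]_m,
              solves_rde phi gamma T (fun t s xi => Xt t s xi w) sigma a0 Y' ->
              forall t, 0 <= t <= T -> Leq phi gamma (Y' t) (Y t)}).
Proof.
move=> fX H12 T0 g12 gH mphi fphi.
have H0 : 0 < H by lra.
(* The bound [gamma <= 1] is deduced from [H <= 1], which the variance of one component yields;
   without components neither exponent is bounded above. *)
case: n X fX => [|n'] X fX.
  exists X, (fun _ _ _ _ => 0); split; first by case.
  split; first by case.
  split.
    apply: aeW => w; split; first by exists 0 => -[].
    split; first exact: (inC2gamma0 _ mphi fphi).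
    move=> t u s _ _ _ _; apply: (N0 mphi fphi) => xi _.
    by rewrite /dtilde2 scaler0 !subr0.
  by move=> m sigma a0 _; apply: aeW => w; exact: (rde_solution_dim0 mphi fphi).
set n := n'.+1 in X fX *.
have H1 : H <= 1 := fbm_hurst_le1 fX H0 ord0.
have g0 : 0 < gamma by lra.
have g1 : gamma <= 1 by lra.
have g01 : 0 < gamma <= 1 by rewrite g0 g1.
have mom i k s t : (\int[P]_w (((X i t w - X i s w) ^+ 2) ^+ k.+1)%:E <=
    (Cmoment k * (`|t - s| `^ (2 * H)) ^+ k.+1)%:E)%E.
  by apply: gaussian_moment; [exact: powR_ge0|exact: fbm_increment].
have mX i t : measurable_fun setT (X i t) by exact: (fbm_measurable fX).
have /choice[X' hX'] : forall i, exists X' : R -> Om -> R,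
    [/\ forall t, {ae P, forall w, X' t w = X i t w},
        forall t, measurable_fun setT (X' t) &
        forall w, exists2 K, 0 <= K & holder gamma K T (X' ^~ w)].
  move=> i; apply: (@kolmogorov_continuity _ _ _ _ _ _ H _ (@Cmoment R)) => //.
  exact: Cmoment_ge0.
pose A w i := wconv T (X' i ^~ w).
have hA w : exists K, [/\ 0 <= K, forall i, holder gamma K T (X' i ^~ w) &
    forall i, conv_holder gamma (4 * K) T (A w i)].
  have [|i|K K0 hK] := @fin_bound R 'I_n (fun i c => holder gamma c T (X' i ^~ w)).
  - move=> i c c' hc cc' s t s0 st tT; apply: (le_trans (hc s t s0 st tT)).
    by apply: ler_wpM2r => //; exact: powR_ge0.
  - by have [_ _ /(_ w)[K _ hK]] := hX' i; exists K.
  by exists K; split => // i; apply: wconv_holder.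
have mA w i t : 0 <= t -> t <= T -> measurable_fun (`[0%R, +oo[%classic : set R) (A w i t).
  by have [K [K0 hK _]] := hA w; exact: (measurable_wconv T0 g01 K0 (hK i)).
exists X', (fun t s xi w => xrow (A w) t s xi); split; first by move=> i; case: (hX' i).
split.
  move=> i t s xi s0 st tT xi0.
  rewrite (_ : (fun w => _) = fun w => dconv (A w i) t s xi); last first.
    by apply/funext => w; rewrite mxE.
  have [X'X mX' hol] := hX' i.
  apply: (wiener_integral_wconv T0 H0 g01 (sqrtr_ge0 (Cmoment 0)) (mX i) mX' _ X'X hol) => //.
  by move=> u v; exact: (L2_increment (mX i) (Cmoment_ge0 (R := R)) (mom i)).
split.
  apply: aeW => w; have [K [K0 hK cK]] := hA w.
  have K4 : 0 <= 4 * K by rewrite mulr_ge0.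
  split.
    exists K => i s t /andP[s0 sT] /andP[t0 tT].
    have [st|ts] := leP s t; first by rewrite (ger0_norm (x := t - s)) ?subr_ge0//; exact: hK.
    rewrite distrC [ `|t - s|]distrC (ger0_norm (x := s - t)) ?subr_ge0 ?(ltW ts)//.
    by apply: hK => //; exact: ltW.
  split; last by move=> t u s _ _ _ _; exact: xrow_chen.
  apply: (xrow_inC2gamma g12 K4 mphi fphi cK _ (mA w)) => i x.
  exact: wconv0.
move=> m sigma a0 hs; apply: aeW => w; have [K [K0 hK cK]] := hA w.
have K4 : 0 <= 4 * K by rewrite mulr_ge0.
exact: (rde_solution T0 g12 g1 K4 mphi fphi cK (mA w)).
Qed.
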